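(* There is a polynomial $p$ such that the following holds. Let $n,k,d$ be positive integers with $k\le n$ and $d\le n$, let $\sigma>0$, let $\mu_1,\ldots,\mu_n\in[0,1]^d$ be arbitrary, and let $\mathcal{X}=\{x_1,\ldots,x_n\}\subseteq\mathbb{R}^d$, where $x_i=\mu_i+g_i$ and $g_1,\ldots,g_n$ are independent $d$-dimensional Gaussian random vectors with mean $0$ whose coordinates are independent with standard deviation $\sigma$. Then for every choice of initial centers, the expected number of iterations of the $k$-means method on $\mathcal{X}$ is at most $k^{kd}\cdot p(n,1/\sigma)$.
   Context: The $k$-means method on a finite point set $\mathcal{X}\subseteq\mathbb{R}^d$ with $k$ clusters: (1) select initial cluster centers $c_1,\ldots,c_k\in\mathbb{R}^d$; (2) assign every $x\in\mathcal{X}$ to the cluster $C_i$ whose center $c_i$ is closest to $x$; (3) set $c_i=\frac{1}{|C_i|}\sum_{x\in C_i}x$ for every $i$; (4) if the clusters or the centers have changed, go to (2), otherwise terminate. An iteration is one execution of steps (2)–(3); the running time is the number of iterations. The paper's standing assumptions are $k\le n$ and $d\le n$. *)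

(* Defs.v *)
From HB Require Import structures.
From mathcomp Require Import all_boot all_order all_algebra.
From mathcomp Require Import all_classical all_reals all_analysis.
From mathcomp Require Import measurable_realfun normal_distribution.

Set Implicit Arguments.
Unset Strict Implicit.
Unset Printing Implicit Defensive.

Import Order.TTheory GRing.Theory Num.Theory.

Local Open Scope classical_set_scope.
Local Open Scope ring_scope.

Section KMeans.
Variable R : realType.

Definition sqdist (d : nat) (u v : 'rV[R]_d) : R :=
  \sum_(j < d) (u ord0 j - v ord0 j) ^+ 2.

Definition closest_assignment (n k d : nat) (X : 'I_n -> 'rV[R]_d)
    (c : 'I_k -> 'rV[R]_d) (a : 'I_n -> 'I_k) : Prop :=
  forall i : 'I_n,
    (forall l : 'I_k, sqdist (X i) (c (a i)) <= sqdist (X i) (c l)) /\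
    (forall l : 'I_k, (l < a i)%N -> sqdist (X i) (c (a i)) < sqdist (X i) (c l)).

Definition update_centers (n k d : nat) (X : 'I_n -> 'rV[R]_d)
    (c : 'I_k -> 'rV[R]_d) (a : 'I_n -> 'I_k) : 'I_k -> 'rV[R]_d :=
  fun l => let C := [set i | a i == l] in
    if C == set0 then c l else (#|C|%:R)^-1 *: \sum_(i in C) X i.

(** A run of the k-means method from the initial centers [c0]:
    [a t] and [c t] are the clusters and the centers after iteration t (t >= 1). *)
Definition kmeans_run (n k d : nat) (X : 'I_n -> 'rV[R]_d)
    (c0 : 'I_k -> 'rV[R]_d)
    (a : nat -> 'I_n -> 'I_k) (c : nat -> 'I_k -> 'rV[R]_d) : Prop :=
  c 0%N = c0 /\
  forall t : nat, closest_assignment X (c t) (a t.+1) /\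
                  c t.+1 = update_centers X (c t) (a t.+1).

(** Number of iterations of a run: the first iteration t after which neither
    the clusters nor the centers changed (there are no clusters before
    iteration 1, so t >= 2); +oo if the method never terminates. *)
Definition run_iterations (n k d : nat) (a : nat -> 'I_n -> 'I_k)
    (c : nat -> 'I_k -> 'rV[R]_d) : \bar R :=
  ereal_inf [set (t%:R)%:E | t in
     [set t : nat | (2 <= t)%N /\ a t = a t.-1 /\ c t = c t.-1]].

(** Number of iterations of the k-means method on X from initial centers c0
    (the run is uniquely determined; we take the sup over all runs). *)
Definition kmeans_iterations (n k d : nat) (X : 'I_n -> 'rV[R]_d)
    (c0 : 'I_k -> 'rV[R]_d) : \bar R :=
  ereal_sup [set x | exists a c, kmeans_run X c0 a c /\ x = run_iterations a c].

Definition kmeans_worst_iterations (n k d : nat) (X : 'I_n -> 'rV[R]_d) : \bar R :=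
  ereal_sup [set kmeans_iterations X c0 | c0 in [set: 'I_k -> 'rV[R]_d]].

(** Expectation of F (g) where g = (g_1,...,g_m) has i.i.d. N(0, sigma^2)
    coordinates, written as the iterated integral against the normal law
    (equal to the integral against the product law, by Tonelli, for
    nonnegative measurable F). *)
Fixpoint gauss_expect (sigma : R) (m : nat) : (m.-tuple R -> \bar R) -> \bar R :=
  match m return (m.-tuple R -> \bar R) -> \bar R with
  | 0%N => fun F => F [tuple]
  | m'.+1 => fun F =>
      (\int[normal_prob 0 sigma]_t gauss_expect sigma (fun s => F (cons_tuple t s)))%E
  end.

(** Outer expectation of a possibly non-measurable nonnegative F: the infimum
    of the expectations of measurable majorants (equal to the expectation
    when F is measurable). *)
Definition gauss_outer_expect (sigma : R) (m : nat) (F : m.-tuple R -> \bar R) : \bar R :=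
  ereal_inf [set gauss_expect sigma G | G in
    [set G : m.-tuple R -> \bar R | measurable_fun setT G /\ forall g, (F g <= G g)%E]].

Definition perturbed (n d : nat) (mu : 'I_n -> 'rV[R]_d) (g : (n * d).-tuple R)
    : 'I_n -> 'rV[R]_d :=
  fun i => mu i + \row_(j < d) tnth g (mxvec_index i j).

End KMeans.

(* Main.v *)
(** Write [b] for a natural number of order [n + 1/sigma]. The number of iterations exceeds
    [T_E = 64^k b^(O(1) + 4E)] with probability at most [b^(-5E)] (up to measurability, and
    for moderate Gaussian coordinates), and it never exceeds [k^n + 2]; hence the expectation
    is at most [64^k b^O(1)], and [64^k = O(k^(kd))].

    In a run of more than [T_E] iterations, the potential decreases at each step by at least the
    squared motion of each center, so during some block of [4^k (nk)^r + 1] iterations every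
    center moves by at most [rho = sigma b^(-2E)]. Since a Hamming ball of radius [r] has at most
    [(nk)^r] elements, this block contains two clusterings that differ in more than [r] points
    but have the same empty clusters and the same cluster sizes modulo 3. Each point on which
    they differ is nearly equidistant from two centers, and each center [z_l] nearly satisfies
    [(|in_l| - |out_l|) z_l = sum in_l - sum out_l]. If the coefficient is nonzero then it is a
    multiple of 3, so at least 3 points change at [l]; counting shows that there are far more
    equidistance conditions than undetermined centers, unless many points lie near a hyperplane
    or several disjoint small integer combinations of the points nearly vanish.

    Each of these events is unlikely by a packing argument. Translating the points by a small
    vector changes the Gaussian measure by at most a constant factor, and a large family of
    translates of the event covers each point few times: the conditions determine the
    translation up to a code with few values. *)

Require Import Defs.
From HB Require Import structures.
From mathcomp Require Import all_boot all_order all_algebra.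
From mathcomp Require Import all_classical all_reals all_analysis.
From mathcomp Require Import measurable_realfun normal_distribution.
From mathcomp Require Import ring lra zify.

Import Order.TTheory GRing.Theory Num.Theory.
Local Open Scope ring_scope.

Set Implicit Arguments.
Unset Strict Implicit.
Unset Printing Implicit Defensive.

Local Open Scope classical_set_scope.

(** * Gaussian expectations and translations *)

Section translation.
Variable R : realType.

(** The count behind the exponents, up to fixed powers of [b]: put [eta = sigma b^(-E)] and
    [rho = sigma b^(-2E)], so that [rho sigma = eta^2]. A changed point whose two centers differ by
    at least [eta] in some coordinate is translated in [b^E] steps of size [eta]; one step alters
    its difference of squared distances by [eta^2], more than all errors of order [rho]. Each such
    point thus contributes a factor [b^E] to the family of translations. The obstacle is that the
    centers move along with the points. All points are therefore translated along one common
    direction: a single integer, worth [b^E] codes, then fixes all [d] coordinates of the shift of a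
    center with nonzero coefficient. Any other center is rounded, at a cost of [b^(2Ed)] codes. The
    [m] changed points have [2m] ends; a center of the first kind uses at least 3 of them, all but
    boundedly many of the second kind at least [9d]. A cost of at most [E/3] per end leaves a gain
    of [b^(Em/3)], which for large [m] pays for the [b^O(m)] patterns and for the factor [b^(5E)].
    With sizes modulo 2 only, centers with 2 ends could use up the whole gain. *)

Definition addr_fun (a : R) : measurableTypeR R -> measurableTypeR R := fun x => x + a.

Fact measurable_addr_fun a : measurable_fun [set: measurableTypeR R] (addr_fun a).
Proof. exact: measurable_funD. Qed.

HB.instance Definition _ a :=
  isMeasurableFun.Build _ _ _ _ (addr_fun a) (measurable_addr_fun a).

Lemma lebesgue_measure_addr (a : R) (A : set (measurableTypeR R)) : measurable A ->
  pushforward lebesgue_measure (addr_fun a) A = lebesgue_measure A.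
Proof.
move=> mA; apply/esym/lebesgue_measure_unique => //= _ [[x y]] _ <-.
rewrite /pushforward (_ : _ @^-1` _ = `]x - a, y - a]).
  rewrite !lebesgue_measure_itv/= !lte_fin ltrD2r.
  by case: ifP => // _; congr (_%:E); ring.
by apply/seteqP; split => z /=; rewrite !in_itv/= ltrBlDr lerBrDr.
Qed.

Lemma lebesgue_integral_addr (t : R) (A : set (measurableTypeR R))
    (f : measurableTypeR R -> \bar R) :
  measurable A -> measurable_fun A f -> (forall x, 0 <= f x)%E ->
  (\int[lebesgue_measure]_(x in A) f x =
   \int[lebesgue_measure]_(x in addr_fun (- t) @^-1` A) f (x - t)%R)%E.
Proof.
move=> mA mf f0.
transitivity (\int[pushforward lebesgue_measure (addr_fun (- t))]_(x in A) f x)%E.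
  by apply: eq_measure_integral => B mB _; rewrite -[LHS](lebesgue_measure_addr (- t)).
by rewrite (ge0_integral_pushforward (measurable_addr_fun (- t)))//.
Qed.

(** The ratio of the two densities is [expR ((2 * x * t + t ^+ 2) / (2 * s ^+ 2))], unbounded in
    [x]; this is why events are later restricted to coordinates of size at most [Y * s]. *)
Lemma normal_pdf_shift_le (s Y t x : R) : 0 < s -> 0 <= Y ->
  `|x| <= Y * s -> `|t| <= s ->
  normal_pdf 0 s x <= expR (`|t| * (Y + 1) / s) * normal_pdf 0 s (x + t).
Proof.
move=> s0 Y0 xY ts.
rewrite normal_pdfE ?gt_eqF// mulrCA; apply: ler_wpM2l; first exact: normal_peak_ge0.
rewrite /normal_fun -expRD ler_expR !subr0.
have s2 : 0 < s ^+ 2 *+ 2 by rewrite pmulrn_lgt0 // exprn_gt0.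
have -> : `|t| * (Y + 1) / s = `|t| * (Y * s + s) * 2 / (s ^+ 2 *+ 2).
  by field; rewrite gt_eqF.
rewrite -mulrDl ler_pM2r ?invr_gt0//.
have xt : x * t <= Y * s * `|t|.
  by apply: le_trans (ler_norm _) _; rewrite normrM ler_wpM2r.
have tt : t ^+ 2 <= s * `|t|.
  by rewrite -normr_id -real_normK ?num_real// normr_id expr2 ler_wpM2r.
rewrite (_ : (x + t) ^+ 2 = x ^+ 2 + 2 * (x * t) + t ^+ 2); last by ring.
have t0 := normr_ge0 t.
nra.
Qed.

Lemma normal_prob_shift_le (s Y t : R) (A : set (measurableTypeR R)) : 0 < s -> 0 <= Y ->
  measurable A -> (forall x, A x -> `|x| <= Y * s) -> `|t| <= s ->
  (normal_prob 0 s A <=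
   (expR (`|t| * (Y + 1) / s))%:E * normal_prob 0 s (addr_fun (- t) @^-1` A))%E.
Proof.
move=> s0 Y0 mA AY ts; rewrite /normal_prob.
have mp u : measurable_fun [set: measurableTypeR R] (fun x : measurableTypeR R => (normal_pdf 0 s (x + u))%:E).
  apply/measurable_EFinP.
  exact: (measurableT_comp (measurable_normal_pdf 0 s) (measurable_addr_fun u)).
have mp0 : measurable_fun [set: measurableTypeR R] (fun x : measurableTypeR R => (normal_pdf 0 s x)%:E).
  by apply/measurable_EFinP; exact: measurable_normal_pdf.
have E := @lebesgue_integral_addr t A (fun x => (normal_pdf 0 s (x + t))%:E) mA
  (measurable_funTS (mp t)) (fun x => normal_pdf_ge0 0 s (x + t)).
have {}E : (\int[lebesgue_measure]_(x in addr_fun (- t) @^-1` A) (normal_pdf 0 s x)%:E =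
  \int[lebesgue_measure]_(x in A) (normal_pdf 0 s (x + t))%:E)%E.
  by etransitivity; last (exact: esym E); apply: eq_integral => x _ /=; rewrite subrK.
rewrite E.
have pt x : A x -> normal_pdf 0 s x <= expR (`|t| * (Y + 1) / s) * normal_pdf 0 s (x + t).
  by move=> Ax; apply: normal_pdf_shift_le => //; exact: AY.
move: (expR _) (expR_ge0 (`|t| * (Y + 1) / s)) pt => c c0 pt.
rewrite -(@ge0_integralZl_EFin _ (measurableTypeR R) R lebesgue_measure A mA
    (fun x => (normal_pdf 0 s (x + t))%:E)); first last.
- exact: c0.
- exact: (measurable_funTS (mp t)).
- by move=> x _; rewrite lee_fin normal_pdf_ge0.
apply: (@ge0_le_integral _ (measurableTypeR R) R lebesgue_measure A mA
  (fun x => (normal_pdf 0 s x)%:E)).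
- by move=> x _; rewrite lee_fin normal_pdf_ge0.
- exact: (measurable_funTS mp0).
- by apply: measurable_funeM; exact: (measurable_funTS (mp t)).
- by move=> x Ax; rewrite -EFinM lee_fin; exact: pt.
Qed.

Lemma normal_integral_shift_le (s Y t : R) (f : R -> \bar R) : 0 < s -> 0 <= Y ->
  measurable_fun [set: R] f -> (forall x, 0 <= f x)%E ->
  (forall x, Y * s < `|x| -> f x = 0%E) -> `|t| <= s ->
  (\int[normal_prob 0 s]_x f x <=
   (expR (`|t| * (Y + 1) / s))%:E * \int[normal_prob 0 s]_x f (x - t)%R)%E.
Proof.
move=> s0 Y0 mf f0 fY ts.
pose I : set (measurableTypeR R) := `[- (Y * s), Y * s].
have mI : measurable I by exact: measurable_itv.
have suppI (P : measure (measurableTypeR R) R) : (\int[P]_x f x = \int[P]_(x in I) f x)%E.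
  rewrite [RHS]integral_mkcond; apply: eq_integral => x _.
  rewrite patchE; case: ifPn => //; rewrite notin_setE /I/= in_itv/= -ler_norml => /negP.
  by rewrite -ltNge => /fY.
(* The claim becomes an inequality between two measures, the restriction to [I] and the scaled image
   under the translation, and it suffices to compare them on sets. *)
pose K := NngNum (expR_ge0 (`|t| * (Y + 1) / s)).
pose m1 := mrestr (normal_prob 0 s) mI.
pose m2 := mscale K (measure_function_pushforward__canonical__measure_function_Measure
  (normal_prob 0 s) (measurable_addr_fun (- t))).
have m12 S : measurable S -> (m1 S <= m2 S)%E.
  move=> mS; apply: (le_trans (y := (K%:num%:E * normal_prob 0 s (addr_fun (- t) @^-1` (S `&` I)))%E)).
    apply: normal_prob_shift_le => //; first exact: measurableI.
    by move=> x [_]; rewrite /I/= in_itv/= ler_norml.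
  rewrite /m2 /mscale/= lee_pmul2l ?lte_fin ?expR_gt0//.
  rewrite /pushforward; apply: le_measure; rewrite ?inE.
  - by rewrite -[X in measurable X]setTI; apply: measurable_addr_fun => //; exact: measurableI.
  - by rewrite -[X in measurable X]setTI; apply: measurable_addr_fun.
  - by move=> x [].
rewrite suppI.
have -> : (\int[normal_prob 0 s]_(x in I) f x = \int[m1]_(x in I) f x)%E.
  apply: eq_measure_integral => A mA AI.
  by transitivity (normal_prob 0 s (A `&` I)) => //; congr (normal_prob 0 s _); exact: esym (setIidl AI).
apply: le_trans (ge0_le_measure_integral m12 mI f0 mf) _.
rewrite /m2 -suppI ge0_integral_mscale//.
by rewrite (ge0_integral_pushforward (measurable_addr_fun _))// preimage_setT.
Qed.

End translation.

Lemma emeasurable_sum_cond d (T : measurableType d) (R : realType) (I : Type) (r : seq I)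
    (P : pred I) (F : I -> T -> \bar R) : (forall i, measurable_fun setT (F i)) ->
  measurable_fun setT (fun x => \sum_(i <- r | P i) F i x)%E.
Proof.
move=> mF; have : measurable_fun setT (fun g => \sum_(i <- [seq i <- r | P i]) F i g)%E.
  exact: emeasurable_sum.
by under [X in measurable_fun _ X -> _]eq_fun do rewrite big_filter.
Qed.

Section gauss_expect_theory.
Variables (R : realType) (s : R).
Local Notation E := (@gauss_expect R s _).
Local Notation mR := (measurableTypeR R).

Lemma gauss_expect_ge0 m (F : m.-tuple R -> \bar R) :
  (forall g, 0 <= F g)%E -> (0 <= E F)%E.
Proof.
elim: m F => [|m ih] F F0 /=; first exact: F0.
by apply: integral_ge0 => t _; apply: ih.
Qed.

Lemma measurable_fun_cons_tuple m d (T : measurableType d) (F : T * m.+1.-tuple mR -> \bar R) :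
  measurable_fun setT F ->
  measurable_fun [set: (T * mR) * m.-tuple mR] (fun p => F (p.1.1, cons_tuple p.1.2 p.2)).
Proof.
move=> mF; apply: (measurableT_comp mF).
apply: measurable_fun_pair; first exact: (measurableT_comp measurable_fst measurable_fst).
apply: measurable_cons; last exact: measurable_snd.
exact: (measurableT_comp measurable_snd measurable_fst).
Qed.

(** The arbitrary parameter space [T] drives the induction: each coordinate in turn is moved from
    the tuple into the parameter. *)
Lemma measurable_gauss_expect m d (T : measurableType d) (F : T * m.-tuple mR -> \bar R) :
  measurable_fun setT F -> (forall p, 0 <= F p)%E ->
  measurable_fun [set: T] (fun x => E (fun g => F (x, g))).
Proof.
elim: m d T F => [|m ih] d T F mF F0 /=.
  by apply: (measurableT_comp mF); apply: measurable_fun_pair.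
pose G (p : T * mR) := E (fun g => F (p.1, cons_tuple p.2 g)).
have mG : measurable_fun setT G.
  apply: (ih _ _ (fun p : (T * mR) * m.-tuple mR => F (p.1.1, cons_tuple p.1.2 p.2))).
    exact: measurable_fun_cons_tuple.
  by move=> p; exact: F0.
have G0 p : (0 <= G p)%E by apply: gauss_expect_ge0.
exact: (@measurable_fun_fubini_tonelli_F _ _ T mR R (normal_prob 0 s) G mG G0).
Qed.

Lemma measurable_cons_section m (F : m.+1.-tuple mR -> \bar R) :
  measurable_fun setT F ->
  measurable_fun [set: mR * m.-tuple mR] (fun p => F (cons_tuple p.1 p.2)).
Proof.
move=> mF; apply: (measurableT_comp mF).
by apply: measurable_cons; [exact: measurable_fst|exact: measurable_snd].
Qed.

Lemma measurable_gauss_section m (F : m.+1.-tuple mR -> \bar R) :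
  measurable_fun setT F -> (forall p, 0 <= F p)%E ->
  measurable_fun [set: mR] (fun t => E (fun g => F (cons_tuple t g))).
Proof.
move=> mF F0.
by apply: (measurable_gauss_expect (F := fun p => F (cons_tuple p.1 p.2))) => //;
  exact: measurable_cons_section.
Qed.

Lemma measurable_cons_tuple m (F : m.+1.-tuple mR -> \bar R) (t : mR) :
  measurable_fun setT F -> measurable_fun setT (fun g : m.-tuple mR => F (cons_tuple t g)).
Proof.
move=> /measurable_cons_section mF.
apply: (measurableT_comp (g := fun g : m.-tuple mR => (t, g)) mF).
by apply: measurable_fun_pair.
Qed.

Lemma le_gauss_expect m (F G : m.-tuple mR -> \bar R) :
  measurable_fun setT F -> measurable_fun setT G -> (forall g, 0 <= F g)%E ->
  (forall g, F g <= G g)%E -> (E F <= E G)%E.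
Proof.
elim: m F G => [|m ih] F G mF mG F0 FG /=; first exact: FG.
have G0 g : (0 <= G g)%E by exact: le_trans (F0 g) (FG g).
apply: ge0_le_integral => //.
- by move=> t _; apply: gauss_expect_ge0.
- exact: measurable_gauss_section.
- exact: measurable_gauss_section.
- by move=> t _; apply: ih => //; exact: measurable_cons_tuple.
Qed.

Lemma gauss_expectD m (F G : m.-tuple mR -> \bar R) :
  measurable_fun setT F -> measurable_fun setT G -> (forall g, 0 <= F g)%E ->
  (forall g, 0 <= G g)%E -> E (fun g => F g + G g)%E = (E F + E G)%E.
Proof.
elim: m F G => [//|m ih] F G mF mG F0 G0 /=.
rewrite -ge0_integralD//; first last.
- exact: measurable_gauss_section.
- by move=> t _; apply: gauss_expect_ge0.
- exact: measurable_gauss_section.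
- by move=> t _; apply: gauss_expect_ge0.
by apply: eq_integral => t _; rewrite ih//; exact: measurable_cons_tuple.
Qed.

Lemma gauss_expectZ m (c : R) (F : m.-tuple mR -> \bar R) : 0 <= c ->
  measurable_fun setT F -> (forall g, 0 <= F g)%E ->
  E (fun g => c%:E * F g)%E = (c%:E * E F)%E.
Proof.
move=> c0; elim: m F => [//|m ih] F mF F0 /=.
rewrite -ge0_integralZl_EFin//; first last.
- exact: measurable_gauss_section.
- by move=> t _; apply: gauss_expect_ge0.
by apply: eq_integral => t _; rewrite ih//; exact: measurable_cons_tuple.
Qed.

Lemma gauss_expect_cst m (c : \bar R) : @gauss_expect R s m (fun=> c) = c.
Proof.
elim: m => [//|m ih] /=.
under eq_integral do rewrite ih.
rewrite (@integral_cst _ mR R (normal_prob 0 s) setT)//.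
exact: etrans (congr1 (fun z => (c * z)%E) (@probability_setT _ mR R (normal_prob 0 s))) (mule1 c).
Qed.

Lemma gauss_expect_sum m (I : Type) (r : seq I) (P : pred I) (F : I -> m.-tuple mR -> \bar R) :
  (forall i, measurable_fun setT (F i)) -> (forall i g, 0 <= F i g)%E ->
  E (fun g => \sum_(i <- r | P i) F i g)%E = (\sum_(i <- r | P i) E (F i))%E.
Proof.
move=> mF F0; elim: r => [|i r ih].
  under eq_fun do rewrite big_nil.
  by rewrite big_nil gauss_expect_cst.
under eq_fun do rewrite big_cons.
rewrite big_cons; case: (P i) => //; rewrite gauss_expectD// ?ih//.
- exact: emeasurable_sum_cond.
- by move=> g; exact: sume_ge0.
Qed.

Definition sub_tuple m (t g : m.-tuple mR) : m.-tuple mR := [tuple tnth g i - tnth t i | i < m].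

Lemma measurable_sub_tuple m (t : m.-tuple mR) : measurable_fun setT (sub_tuple t).
Proof.
apply/measurable_fun_tnthP => i.
rewrite (_ : _ \o _ = fun g => tnth g i - tnth t i); last first.
  by apply/funext => g; rewrite /= tnth_mktuple.
exact: (measurableT_comp (measurable_addr_fun (- tnth t i)) (measurable_tnth i)).
Qed.

Lemma sub_tuple_cons m (t0 g0 : R) (t g : m.-tuple R) :
  sub_tuple (cons_tuple t0 t) (cons_tuple g0 g) = cons_tuple (g0 - t0) (sub_tuple t g).
Proof.
apply: eq_from_tnth => i; rewrite tnth_mktuple.
case: (unliftP ord0 i) => [j ->|->]; last by rewrite !(tnth_nth 0).
by rewrite !tnthS tnth_mktuple.
Qed.

Hypothesis s0 : 0 < s.

Lemma gauss_expect_shift_le m (Y th : R) (t : m.-tuple mR) (F : m.-tuple mR -> \bar R) :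
  0 <= Y -> th <= s -> (forall i, `|tnth t i| <= th) ->
  measurable_fun setT F -> (forall g, 0 <= F g)%E ->
  (forall g i, Y * s < `|tnth g i| -> F g = 0%E) ->
  (E F <= (expR (th * (Y + 1) / s *+ m))%:E * E (F \o sub_tuple t))%E.
Proof.
move=> Y0 ths; elim: m t F => [|m ih] t F tth mF F0 FY /=.
  by rewrite mulr0n expR0 mul1e [X in (_ <= F X)%E]tuple0.
case/tupleP: t tth => t0 t tth.
have th0 : 0 <= th by apply: le_trans (tth ord0).
pose K := expR (th * (Y + 1) / s *+ m).
have K0 : 0 <= K by exact: expR_ge0.
have t0th : `|t0| <= th := tth ord0.
pose G (x : mR) := E (fun g : m.-tuple mR => F (cons_tuple x (sub_tuple t g))).
have mFs : measurable_fun setT (fun p : mR * m.-tuple mR => F (cons_tuple p.1 (sub_tuple t p.2))).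
  apply: (measurableT_comp mF); apply: measurable_cons; first exact: measurable_fst.
  exact: (measurableT_comp (measurable_sub_tuple t) measurable_snd).
have mG : measurable_fun setT G.
  by apply: (measurable_gauss_expect (F := fun p => F (cons_tuple p.1 (sub_tuple t p.2)))).
have G0 x : (0 <= G x)%E by apply: gauss_expect_ge0.
have GY x : Y * s < `|x| -> G x = 0%E.
  move=> xY; rewrite /G.
  under eq_fun => g do rewrite (FY _ ord0)//.
  exact: gauss_expect_cst.
apply: (le_trans (y := (K%:E * \int[normal_prob 0 s]_x G x)%E)).
  rewrite -ge0_integralZl_EFin//.
  apply: ge0_le_integral => //.
  - by move=> x _; apply: gauss_expect_ge0.
  - exact: measurable_gauss_section.
  - exact: measurable_funeM.
  - move=> x _; apply: ih => //.
    + by move=> i; have := tth (lift ord0 i); rewrite tnthS.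
    + exact: measurable_cons_tuple.
    + by move=> g i gi; apply: (FY _ (lift ord0 i)); rewrite tnthS.
have -> : (\int[normal_prob 0 s]_t1 gauss_expect s (fun s1 : m.-tuple R =>
    (F \o sub_tuple (cons_tuple t0 t)) (cons_tuple t1 s1)) =
  \int[normal_prob 0 s]_x G (x - t0)%R)%E.
  by apply: eq_integral => x _; congr gauss_expect; apply/funext => g /=; rewrite sub_tuple_cons.
rewrite mulrS expRD [(expR _ * K)]mulrC EFinM -muleA lee_wpmul2l ?lee_fin//.
apply: (le_trans (normal_integral_shift_le s0 Y0 mG G0 GY (le_trans t0th ths))).
apply: lee_wpmul2r; first by apply: integral_ge0 => x _; exact: G0.
by rewrite lee_fin ler_expR ler_pM2r ?invr_gt0// ler_wpM2r// addr_ge0.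
Qed.

End gauss_expect_theory.

(** * Packing by translations *)

Section hull.
Variables (R : realType) (N : nat).
Local Notation mR := (measurableTypeR R).
Implicit Types (e : R) (A : set (N.-tuple mR)).

(** Union of the cells of the grid of mesh [e] that meet [A], measurable even if [A] is not. *)
Definition hull e A : set (N.-tuple mR) :=
  [set g | exists2 h, A h & forall p, Num.floor (tnth g p / e) = Num.floor (tnth h p / e)].

Lemma sub_hull e A : A `<=` hull e A.
Proof. by move=> g Ag; exists g. Qed.

Lemma hullP e A g : 0 < e -> hull e A g ->
  exists2 h, A h & forall p, `|tnth h p - tnth g p| <= e.
Proof.
move=> e0 [h Ah gh]; exists h => // p.
have /andP[h1 h2] := floor_itv (tnth h p / e).
have /andP[g1 g2] := floor_itv (tnth g p / e).
rewrite gh in g1 g2.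
move: h1 h2 g1 g2; rewrite !ler_pdivlMr// !ltr_pdivrMr// intrD mulrDl mul1r.
by move=> h1 h2 g1 g2; rewrite ler_norml; apply/andP; split; lra.
Qed.

Lemma measurable_cell e (z : int) : 0 < e ->
  measurable [set x : mR | Num.floor (x / e) = z].
Proof.
move=> e0; rewrite (_ : [set _ | _] = `[z%:~R * e, (z + 1)%:~R * e[%classic).
  exact: measurable_itv.
apply/seteqP; split => x /=; rewrite in_itv/= -ler_pdivlMr// -ltr_pdivrMr//.
  by move=> <-; exact: floor_itv.
by move=> /floor_def.
Qed.

(** Cells are indexed by tuples of integers, so any union of cells is a countable union. *)
Lemma measurable_hull e A : 0 < e -> measurable (hull e A).
Proof.
move=> e0.
pose cell (z : N.-tuple int) : set (N.-tuple mR) :=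
  \bigcap_(p in [set: 'I_N]) [set g | Num.floor (tnth g p / e) = tnth z p].
have mcell z : measurable (cell z).
  apply: fin_bigcap_measurable; first exact: finite_finset.
  move=> p _; rewrite -[X in measurable X]setTI.
  exact: (measurable_tnth p measurableT (measurable_cell (tnth z p) e0)).
rewrite (_ : hull e A = \bigcup_z (if `[< exists2 h, A h & cell z h >] then cell z else set0)).
  apply: countable_bigcupT_measurable; first exact: countableP.
  by move=> z; case: ifP.
apply/seteqP; split => g /=.
  move=> [h Ah gh]; exists [tuple Num.floor (tnth h p / e) | p < N] => //.
  rewrite ifT; first by move=> p _ /=; rewrite tnth_mktuple.
  by apply/asboolP; exists h => // p _ /=; rewrite tnth_mktuple.
move=> [z _]; case: ifP => // /asboolP[h Ah zh] zg; exists h => // p.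
by rewrite (zg p I) (zh p I).
Qed.

End hull.

Section packing.
Variables (R : realType) (s : R).
Hypothesis s0 : 0 < s.
Local Notation mR := (measurableTypeR R).

Definition gauss_prob N (A : set (N.-tuple mR)) : \bar R :=
  gauss_expect s (fun g => (\1_A g)%:E).

Lemma measurable_indicE N (A : set (N.-tuple mR)) :
  measurable A -> measurable_fun setT (fun g => (\1_A g)%:E : \bar R).
Proof. by move=> mA; apply/measurable_EFinP; exact: measurable_indic. Qed.

Lemma gauss_prob_bigcup N (I : finType) (P : pred I) (A : set (N.-tuple mR))
    (B : I -> set (N.-tuple mR)) :
  measurable A -> (forall i, measurable (B i)) ->
  (forall g, A g -> exists2 i, P i & B i g) ->
  (gauss_prob A <= \sum_(i | P i) gauss_prob (B i))%E.
Proof.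
move=> mA mB AB; rewrite -gauss_expect_sum; last 2 first.
- by move=> i; exact: measurable_indicE.
- by move=> i g; rewrite lee_fin.
apply: le_gauss_expect; first exact: measurable_indicE.
- by apply: emeasurable_sum_cond => i; exact: measurable_indicE.
- by move=> g; rewrite lee_fin.
move=> g; rewrite indicE; case: (boolP (g \in A)) => [/set_mem/AB[i Pi Big]|_]; last first.
  by apply: sume_ge0 => i _; rewrite lee_fin.
by rewrite (bigD1 i)//= indicE mem_set//= leeDl// sume_ge0.
Qed.

(** The sets [A + tau v], [v : S], cover no point more than [#|C|] times, while a
    bounded translation changes the Gaussian measure by at most a constant factor. *)
Lemma gauss_packing N (A : set (N.-tuple mR)) (Y th e : R) (S C : finType)
    (tau : S -> N.-tuple mR) (code : N.-tuple mR -> S -> C) :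
  0 <= Y -> 0 < e -> e <= s ->
  (forall h p, A h -> `|tnth h p| <= Y * s) ->
  (forall v p, `|tnth (tau v) p| <= th) -> th <= s -> th * (Y + 2) *+ N <= s ->
  (forall h h' v v', A h -> A h' ->
    (forall p, `|(tnth h p + tnth (tau v) p) - (tnth h' p + tnth (tau v') p)| <= e *+ 2) ->
    code h v = code h' v' -> v = v') ->
  (#|S|%:R%:E * gauss_prob (hull e A) <= (expR 1 * #|C|%:R)%:E)%E.
Proof.
move=> Y0 e0 es AY tauth ths thN sep.
have mH := measurable_hull A e0.
pose F g : \bar R := (\1_(hull e A) g)%:E.
have mF : measurable_fun setT F by exact: measurable_indicE.
have F0 g : (0 <= F g)%E by rewrite lee_fin.
have FY g p : (Y + 1) * s < `|tnth g p| -> F g = 0%E.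
  move=> gY; rewrite /F indicE memNset// => /(hullP e0)[h Ah /(_ p) hg].
  have := AY h p Ah => hY.
  have := ler_normB (tnth h p) (tnth h p - tnth g p).
  rewrite opprB addrC subrK => gh.
  move: gY; rewrite ltNge => /negP; apply; apply: le_trans gh _; nra.
have step v : (gauss_prob (hull e A) <= (expR 1)%:E * gauss_expect s (F \o sub_tuple (tau v)))%E.
  have Y1 : 0 <= Y + 1 by apply: addr_ge0.
  apply: le_trans (gauss_expect_shift_le s0 Y1 ths (tauth v) mF F0 FY) _.
  apply: lee_wpmul2r; first by apply: gauss_expect_ge0 => g; exact: F0.
  rewrite lee_fin ler_expR -mulrnAl ler_pdivrMr// mul1r -[_ + _ + _]addrA.
  by rewrite (_ : (1 + 1) = 2 :> R).
have mFt v : measurable_fun setT (F \o sub_tuple (tau v)).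
  exact: (measurableT_comp mF (measurable_sub_tuple _)).
apply: (le_trans (y := ((expR 1)%:E * gauss_expect s (fun g => \sum_(v : S) (F \o sub_tuple (tau v)) g))%E)).
  rewrite (gauss_expect_sum s _ _ mFt (fun v g => F0 _)) ge0_sume_distrr; last first.
    by move=> v _; apply: gauss_expect_ge0 => g; exact: F0.
  apply: le_trans (lee_sum _ (fun v _ => step v)).
  by rewrite sumr_const mule_natl.
rewrite EFinM; apply: lee_wpmul2l; first by rewrite lee_fin expR_ge0.
rewrite -[X in (_ <= X)%E](gauss_expect_cst s N).
apply: le_gauss_expect => //.
- exact: emeasurable_sum_cond.
- by move=> g; apply: sume_ge0 => v _; exact: F0.
move=> g; rewrite /F /= sumEFin lee_fin.
pose b v := sub_tuple (tau v) g \in hull e A.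
rewrite (eq_bigr (fun v => (b v)%:R)) => [|v _]; last by rewrite indicE.
rewrite -natr_sum ler_nat (eq_bigr (fun v => if b v then 1%N else 0%N)) => [|v _]; last by case: (b v).
rewrite -big_mkcond sum1_card.
(* A point of the hull is coded through a point of [A] in its cell. Translated back, two such
   representatives are both within [e] of [g], whence the tolerance [e *+ 2] in [sep]. The other
   branch is a default value: [f] is only compared where [b] holds. *)
pose f v := if pselect (hull e A (sub_tuple (tau v) g)) is left H
            then code (s2val (cid2 (hullP e0 H))) v else code g v.
rewrite -(card_in_image (f := f)); first exact: max_card.
move=> v v' bv bv'.
have Hv : hull e A (sub_tuple (tau v) g) by apply: set_mem; exact: bv.
have Hv' : hull e A (sub_tuple (tau v') g) by apply: set_mem; exact: bv'.
rewrite /f; case: pselect => // H; case: pselect => // H'.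
case: cid2 => h Ah hg; case: cid2 => h' Ah' hg' /=.
apply: sep => // p.
have := hg p; have := hg' p; rewrite !tnth_mktuple => /[dup] + + /[dup].
rewrite mulr2n !ler_norml => /andP[? ?] _ /andP[? ?] _; apply/andP; split; lra.
Qed.

End packing.

(** * Gaussian tails *)

Section tail.
Variables (R : realType) (s : R).
Hypothesis s0 : 0 < s.
Local Notation mR := (measurableTypeR R).

Lemma gauss_expect_coord N (p : 'I_N) (f : mR -> \bar R) :
  gauss_expect s (fun g => f (tnth g p)) = (\int[normal_prob 0 s]_x f x)%E.
Proof.
elim: N p => [[]//|N ih] p /=.
case: (unliftP ord0 p) => [j ->|->].
  under eq_integral => t _.
    under eq_fun do rewrite tnthS.
    rewrite ih.
    over.
  rewrite (@integral_cst _ mR R (normal_prob 0 s) setT)//.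
  exact: etrans (congr1 (fun z => (_ * z)%E) (@probability_setT _ mR R (normal_prob 0 s))) (mule1 _).
apply: eq_integral => t _; under eq_fun do rewrite tnth0.
by rewrite gauss_expect_cst.
Qed.

(** Comparison with the density centered at [c]: the ratio is [expR (2^-1 - x * c / s ^+ 2)], at
    most [expR (2^-1 - Y)] on [A]. The sign of [c] selects the tail. *)
Lemma normal_prob_tail (Y c : R) (A : set mR) : measurable A -> `|c| = s ->
  (forall x, A x -> x * c >= Y * s ^+ 2) ->
  (normal_prob 0 s A <= (expR (2^-1 - Y))%:E)%E.
Proof.
move=> mA cs AY; rewrite /normal_prob.
have mp : measurable_fun [set: mR] (fun x : mR => (normal_pdf 0 s (x - c))%:E).
  apply/measurable_EFinP.
  exact: (measurableT_comp (measurable_normal_pdf 0 s) (measurable_addr_fun (- c))).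
have mp0 : measurable_fun [set: mR] (fun x : mR => (normal_pdf 0 s x)%:E).
  by apply/measurable_EFinP; exact: measurable_normal_pdf.
have pt x : A x -> normal_pdf 0 s x <= expR (2^-1 - Y) * normal_pdf 0 s (x - c).
  move=> /AY xc.
  rewrite normal_pdfE ?gt_eqF// mulrCA; apply: ler_wpM2l; first exact: normal_peak_ge0.
  rewrite /normal_fun -expRD ler_expR !subr0.
  have s2 : 0 < s ^+ 2 *+ 2 by rewrite pmulrn_lgt0 // exprn_gt0.
  rewrite -[X in _ <= X + _](mulfK (lt0r_neq0 s2)) -mulrDl ler_pM2r ?invr_gt0//.
  have : c ^+ 2 = s ^+ 2 by rewrite -[LHS]real_normK ?num_real// cs.
  nra.
have E := @lebesgue_integral_addr R c setT (fun x => (normal_pdf 0 s x)%:E) measurableT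
   mp0 (fun x => normal_pdf_ge0 0 s x).
have {}E : (\int[lebesgue_measure]_x (normal_pdf 0 s (x - c))%:E = 1)%E.
  by etransitivity; first (exact: esym E); exact: integral_normal_pdf.
move: (expR _) (expR_ge0 (2^-1 - Y)) pt => k k0 pt.
apply: (le_trans (y := (k%:E * \int[lebesgue_measure]_x (normal_pdf 0 s (x - c))%:E)%E)); last first.
  by rewrite E mule1.
rewrite -(@ge0_integralZl_EFin _ mR R lebesgue_measure setT measurableT
    (fun x => (normal_pdf 0 s (x - c))%:E)); first last.
- exact: k0.
- exact: mp.
- by move=> x _; rewrite lee_fin normal_pdf_ge0.
apply: (le_trans (y := (\int[lebesgue_measure]_(x in A) (k%:E * (normal_pdf 0 s (x - c))%:E))%E)).
  apply: (@ge0_le_integral _ mR R lebesgue_measure A mA (fun x => (normal_pdf 0 s x)%:E)).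
  - by move=> x _; rewrite lee_fin normal_pdf_ge0.
  - exact: (measurable_funTS mp0).
  - by apply: measurable_funeM; exact: (measurable_funTS mp).
  - by move=> x Ax; rewrite -EFinM lee_fin; exact: pt.
apply: ge0_subset_integral => //.
- exact: measurable_funeM.
- by move=> x _; rewrite -EFinM lee_fin mulr_ge0// normal_pdf_ge0.
Qed.

Definition gauss_out N (Y : R) : set (N.-tuple mR) := [set g | exists p, Y * s < `|tnth g p|].

Lemma measurable_gauss_out N Y : measurable (@gauss_out N Y).
Proof.
rewrite (_ : gauss_out _ = \bigcup_(p in [set: 'I_N]) ((@tnth _ _)^~ p @^-1` [set x | Y * s < `|x|])).
  apply: fin_bigcup_measurable; first exact: finite_finset.
  move=> p _; rewrite -[X in measurable X]setTI.
  apply: (measurable_tnth p measurableT).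
  rewrite (_ : [set x | _] = `]Y * s, +oo[%classic `|` `]-oo, - (Y * s)[%classic).
    by apply: measurableU; exact: measurable_itv.
  apply/seteqP; split => x /=; rewrite !in_itv/= andbT.
    by rewrite real_ltr_normr ?num_real// ltrNr => /orP.
  by rewrite real_ltr_normr ?num_real// ltrNr => /orP.
by apply/seteqP; split => [g [p gp]|g [p _ gp]]; exists p.
Qed.

Lemma gauss_out_le N Y : (gauss_prob s (@gauss_out N Y) <= (expR (2^-1 - Y) *+ (2 * N))%:E)%E.
Proof.
pose B (i : bool) : set mR := if i then `]Y * s, +oo[%classic else `]-oo, - (Y * s)[%classic.
have mB i : measurable (B i) by case: i; exact: measurable_itv.
pose B' (ip : bool * 'I_N) : set (N.-tuple mR) := (@tnth _ _)^~ ip.2 @^-1` (B ip.1).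
have mB' i : measurable (B' i).
  rewrite -[X in measurable X]setTI; exact: (measurable_tnth i.2 measurableT (mB i.1)).
have le1 i : (gauss_prob s (B' i) <= (expR (2^-1 - Y))%:E)%E.
  rewrite /gauss_prob.
  rewrite (_ : (fun g => _) = (fun g => (\1_(B i.1) (tnth g i.2))%:E)); last first.
    by apply/funext => g; rewrite !indicE.
  rewrite (gauss_expect_coord i.2 (fun x => (\1_(B i.1) x)%:E)) integral_indic// setIT.
  case: i.1 (mB i.1) => mBi.
    apply: (@normal_prob_tail _ s) => //; first by rewrite ger0_norm// ltW.
    move=> x /=; rewrite in_itv/= andbT => ?; rewrite expr2 mulrA ler_pM2r//; exact: ltW.
  apply: (@normal_prob_tail _ (- s)) => //; first by rewrite normrN ger0_norm// ltW.
  move=> x /=; rewrite in_itv/= => ?; rewrite expr2 mulrA mulrN -mulNr ler_pM2r//.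
  by rewrite lerNr; exact: ltW.
apply: le_trans (gauss_prob_bigcup (P := xpredT) s (measurable_gauss_out Y) mB' _) _.
  move=> g [p gp].
  have [gp0|gp0] := leP 0 (tnth g p).
    by exists (true, p) => //; rewrite /B' /= in_itv/= andbT -(ger0_norm gp0).
  exists (false, p) => //; rewrite /B' /= in_itv/= ltrNr.
  by rewrite -(ltr0_norm gp0).
apply: le_trans (lee_sum _ (fun i _ => le1 i)) _.
rewrite sumr_const.
have -> n (x : R) : (x *+ n)%:E = (x%:E *+ n)%R by rewrite -mulr_natl EFinM mule_natl.
by rewrite card_prod card_bool card_ord.
Qed.

End tail.

(** * Outer expectation by layers *)

Section layers.
Variables (R : realType) (m : nat) (s : R) (F : m.-tuple R -> \bar R).
Local Notation mR := (measurableTypeR R).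

(** A measurable majorant is assembled from the levels. Off [O], if [U i.+1] is the first level not
    below [F g], then [F g] exceeds [U i], so [g] lies in [A i] and the single term [U i.+1]
    dominates. On [O] only the worst-case bound [W] is available. *)
Lemma gauss_outer_layers (U : nat -> nat) (A : nat -> set (m.-tuple mR)) (O : set (m.-tuple mR)) (W I : nat) :
  (forall i, measurable (A i)) -> measurable O ->
  (forall g, F g <= W%:R%:E)%E -> (W <= U I)%N ->
  (forall i g, ~ O g -> ((U i)%:R%:E < F g)%E -> A i g) ->
  (gauss_outer_expect s F <= (U 0%N)%:R%:E + \sum_(i < I) (U i.+1)%:R%:E * gauss_prob s (A i)
    + W%:R%:E * gauss_prob s O)%E.
Proof.
move=> mA mO FW WU UA.
pose term (c : nat) (B : set (m.-tuple mR)) g : \bar R := (c%:R%:E * (\1_B g)%:E)%E.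
have term0 c B g : (0 <= term c B g)%E by rewrite /term -EFinM lee_fin mulr_ge0.
have mterm c B : measurable B -> measurable_fun setT (term c B).
  by move=> mB; apply: measurable_funeM; exact: measurable_indicE.
have Eterm c B : measurable B -> gauss_expect s (term c B) = (c%:R%:E * gauss_prob s B)%E.
  move=> mB; apply: gauss_expectZ => //; exact: measurable_indicE.
pose S g : \bar R := (\sum_(i < I) term (U i.+1) (A i) g)%E.
have S0 g : (0 <= S g)%E by exact: sume_ge0.
have mS : measurable_fun setT S by apply: emeasurable_sum_cond => i; exact: mterm.
have mUS : measurable_fun setT (fun g => (U 0%N)%:R%:E + S g)%E.
  by apply: emeasurable_funD.
have US0 g : (0 <= (U 0%N)%:R%:E + S g)%E by rewrite adde_ge0// lee_fin.
apply: (@le_trans _ _ (gauss_expect s (fun g => (U 0%N)%:R%:E + S g + term W O g)%E)).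
  apply: ereal_inf_lbound => /=; eexists; last reflexivity.
  split; first by apply: emeasurable_funD => //; exact: mterm.
  move=> g; have [Og|nO] := pselect (O g).
    apply: le_trans (FW g) _; rewrite /term indicE mem_set// mule1.
    by rewrite leeDr.
  have [hle|] := pselect (F g <= (U 0%N)%:R%:E)%E.
    by apply: le_trans hle _; rewrite -addeA leeDl// adde_ge0.
  move=> /negP; rewrite -ltNge => lt0.
  have ex : exists i, (F g <= (U i)%:R%:E)%E.
    by exists I; apply: le_trans (FW g) _; rewrite lee_fin ler_nat.
  have [[|i] hi mini] := ex_minnP ex; first by move: hi; rewrite leNgt lt0.
  have iI : (i < I)%N by apply: mini; apply: le_trans (FW g) _; rewrite lee_fin ler_nat.
  have Ai : A i g.
    by apply: UA => //; rewrite ltNge; apply/negP => /mini; rewrite ltnn.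
  apply: le_trans hi _; rewrite [X in (_ <= X + _)%E]addeC -addeA.
  apply: (@le_trans _ _ (S g)); last by rewrite leeDl// adde_ge0// lee_fin.
  rewrite /S (bigD1 (Ordinal iI))//= /term indicE mem_set// mule1 leeDl//.
  by apply: sume_ge0 => j _; exact: term0.
rewrite gauss_expectD//; last exact: mterm.
rewrite Eterm// gauss_expectD//.
rewrite gauss_expect_cst gauss_expect_sum//; last by move=> i; exact: mterm.
by rewrite (eq_bigr _ (fun i _ => Eterm _ _ (mA _))).
Qed.

End layers.

(** * The k-means dynamics *)

Section kmeans_dynamics.
Variables (R : realType) (n k d : nat) (X : 'I_n -> 'rV[R]_d) (c0 : 'I_k -> 'rV[R]_d).
Variables (a : nat -> 'I_n -> 'I_k) (c : nat -> 'I_k -> 'rV[R]_d).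
Hypothesis run : kmeans_run X c0 a c.

Definition cluster (u : 'I_n -> 'I_k) (l : 'I_k) : {set 'I_n} := [set i | u i == l]%SET.

Definition potential t : R := \sum_i sqdist (X i) (c t (a t i)).

Definition stable_at t := a t = a t.-1 /\ c t = c t.-1.

Lemma sqdist_ge0 (u v : 'rV[R]_d) : 0 <= sqdist u v.
Proof. by apply: sumr_ge0 => j _; exact: sqr_ge0. Qed.

Lemma sqdist_coord (u v : 'rV[R]_d) j : (u ord0 j - v ord0 j) ^+ 2 <= sqdist u v.
Proof. by rewrite /sqdist (bigD1 j)//= lerDl sumr_ge0// => i _; exact: sqr_ge0. Qed.

Lemma potential_ge0 t : 0 <= potential t.
Proof. by apply: sumr_ge0 => i _; exact: sqdist_ge0. Qed.

Lemma sum_cluster_sqdist (C : {set 'I_n}) (m z : 'rV[R]_d) :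
  \sum_(i in C) X i = m *+ #|C| ->
  \sum_(i in C) sqdist (X i) z = \sum_(i in C) sqdist (X i) m + sqdist m z *+ #|C|.
Proof.
move=> mC; rewrite /sqdist exchange_big [in X in _ = X + _]exchange_big -sumrMnl -big_split/=.
apply: eq_bigr => j _.
have mCj : \sum_(i in C) X i ord0 j = m ord0 j *+ #|C|.
  by rewrite -summxE mC mulmxnE.
pose p := m ord0 j - z ord0 j.
rewrite (eq_bigr (fun i => (X i ord0 j - m ord0 j) ^+ 2 +
  (2 * p * X i ord0 j - p * (m ord0 j + z ord0 j)))); last by move=> i _; rewrite /p; ring.
rewrite big_split/=; congr (_ + _).
rewrite sumrB -mulr_sumr mCj sumr_const mulrnAr -mulrnBl; congr (_ *+ _).
by rewrite /p; ring.
Qed.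

(** The set comprehension in [update_centers] is a classical set, not a finset. *)
Lemma update_centersE (z : 'I_k -> 'rV[R]_d) (u : 'I_n -> 'I_k) l :
  update_centers X z u l = if cluster u l == finset.set0 then z l
    else (#|cluster u l|%:R)^-1 *: \sum_(i in cluster u l) X i.
Proof.
have mC i : (i \in [set i | u i == l]%classic) = (i \in cluster u l).
  by rewrite inE; apply/idP/idP => [/set_mem|/mem_set].
rewrite /update_centers (eq_card mC) (eq_bigl _ _ mC).
have -> // : ([set i | u i == l]%classic == set0) = (cluster u l == finset.set0).
apply/eqP/eqP => [E|/setP E].
  by apply/setP => i; rewrite -mC E finset.in_set0; apply/negP => /set_mem.
by apply/seteqP; split => // i /mem_set; rewrite mC E finset.in_set0.
Qed.

Lemma center_cluster t l : \sum_(i in cluster (a t.+1) l) X i = c t.+1 l *+ #|cluster (a t.+1) l|.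
Proof.
have [_ /(_ t)[_ ->]] := run; rewrite update_centersE.
have [->|C0] := eqVneq (cluster (a t.+1) l) finset.set0; first by rewrite big_set0 cards0 mulr0n.
rewrite -scaler_nat scalerA.
by rewrite mulfV ?scale1r// pnatr_eq0 cards_eq0.
Qed.

Lemma center_empty t l : cluster (a t.+1) l = finset.set0 -> c t.+1 l = c t l.
Proof.
have [_ /(_ t)[_ ->]] := run; rewrite update_centersE => ->.
by rewrite eqxx.
Qed.

Lemma sum_clusters (u : 'I_n -> 'I_k) (F : 'I_n -> 'I_k -> R) :
  \sum_i F i (u i) = \sum_l \sum_(i in cluster u l) F i l.
Proof.
rewrite (partition_big u xpredT)//=; apply: eq_bigr => l _.
by apply: eq_big => [i|i /eqP <-//]; rewrite inE.
Qed.

(** Reassignment does not increase the potential, and recentering gains exactly the parallel-axis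
    term. Indices start at 1 because a run does not constrain [a 0]. *)
Lemma potential_drop t :
  potential t.+2 + \sum_l sqdist (c t.+2 l) (c t.+1 l) *+ #|cluster (a t.+2) l| <= potential t.+1.
Proof.
apply: (le_trans (y := \sum_i sqdist (X i) (c t.+1 (a t.+2 i)))); last first.
  apply: ler_sum => i _; have [_ /(_ t.+1)[/(_ i)[H _] _]] := run; exact: H.
rewrite /potential !(sum_clusters (a t.+2) (fun i l => sqdist (X i) (c _ l))) -big_split/=.
apply: ler_sum => l _.
by rewrite -(sum_cluster_sqdist _ (center_cluster _ _)).
Qed.

Lemma potential_decr t : potential t.+2 <= potential t.+1.
Proof.
apply: le_trans (potential_drop t); rewrite lerDl; apply: sumr_ge0 => l _.
by rewrite mulrn_wge0// sqdist_ge0.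
Qed.

Lemma sqdist_center_le t l : sqdist (c t.+2 l) (c t.+1 l) <= potential t.+1 - potential t.+2.
Proof.
rewrite lerBrDl; apply: le_trans (potential_drop t); rewrite lerD2l.
have [C0|C0] := eqVneq (cluster (a t.+2) l) finset.set0.
  rewrite center_empty// [X in X <= _]big1 => [|j _]; last by rewrite subrr expr0n.
  by apply: sumr_ge0 => i _; rewrite mulrn_wge0// sqdist_ge0.
rewrite (bigD1 l)//=.
apply: (le_trans (y := sqdist (c t.+2 l) (c t.+1 l) *+ #|cluster (a t.+2) l|)).
  rewrite -[X in X <= _]mulr1n ler_wpMn2l ?sqdist_ge0//.
  by rewrite lt0n cards_eq0.
by rewrite lerDl; apply: sumr_ge0 => i _; rewrite mulrn_wge0// sqdist_ge0.
Qed.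

Lemma sqdist_eq0 (u v : 'rV[R]_d) : sqdist u v <= 0 -> u = v.
Proof.
move=> uv; apply/rowP => j; apply/eqP; rewrite -subr_eq0 -sqrf_eq0.
by rewrite eq_le sqr_ge0 andbT; exact: le_trans (sqdist_coord u v j) uv.
Qed.

Lemma closest_assignment_inj (z : 'I_k -> 'rV[R]_d) (u v : 'I_n -> 'I_k) :
  closest_assignment X z u -> closest_assignment X z v -> u = v.
Proof.
move=> hu hv; apply/funext => i; have [u1 u2] := hu i; have [v1 v2] := hv i.
apply/val_inj/eqP; rewrite /= eqn_leq (leqNgt (u i)) (leqNgt (v i)); apply/andP; split; apply/negP => lt.
  by have := u2 _ lt; rewrite ltNge v1.
by have := v2 _ lt; rewrite ltNge u1.
Qed.

(** Without a drop the centers agree at [t.+1] and [t.+2]; then the next assignment repeats, so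
    stability shows only one iteration later, at [t.+3]. *)
Lemma potential_lt t : ~ stable_at t.+3 -> potential t.+2 < potential t.+1.
Proof.
move=> ns; rewrite lt_neqAle potential_decr andbT; apply/eqP => E; apply: ns.
have cc : c t.+2 = c t.+1.
  apply/funext => l; apply: sqdist_eq0.
  by apply: le_trans (sqdist_center_le t l) _; rewrite E subrr.
have [_ H] := run.
have aa : a t.+3 = a t.+2.
  apply: (@closest_assignment_inj (c t.+2)); first exact: (H t.+2).1.
  by rewrite cc; exact: (H t.+1).1.
split => //=; apply/funext => l; rewrite (H t.+2).2 update_centersE aa.
case: ifP => // C0.
by rewrite [RHS](congr1 (fun z => z l) (H t.+1).2) update_centersE C0.
Qed.

Lemma eq_center_assignment s t l : a s.+1 = a t.+1 -> cluster (a s.+1) l != finset.set0 ->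
  c s.+1 l = c t.+1 l.
Proof.
move=> E C0; have := center_cluster s l; rewrite E center_cluster -E.
move=> /eqP; rewrite -subr_eq0 -mulrnBl -scaler_nat scaler_eq0 pnatr_eq0 cards_eq0 (negPf C0)/=.
by rewrite subr_eq0 => /eqP.
Qed.

Lemma eq_potential s t : a s.+1 = a t.+1 -> potential s.+1 = potential t.+1.
Proof.
move=> E; apply: eq_bigr => i _; rewrite -E; congr sqdist.
by apply: eq_center_assignment => //; apply/set0Pn; exists i; rewrite inE.
Qed.

Lemma potential_lt_trans T s t : (forall u, (2 <= u <= T)%N -> ~ stable_at u) ->
  (s < t)%N -> (t.+1 < T)%N -> potential t.+1 < potential s.+1.
Proof.
move=> ns; elim: t => // t ih; rewrite ltnS leq_eqVlt => /orP[/eqP ->|st] tT.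
  by apply: potential_lt; apply: ns.
apply: lt_trans (ih st (ltnW tT)).
by apply: potential_lt; apply: ns.
Qed.

(** The potential depends on the clustering alone, since centers of empty clusters do not enter it,
    and it decreases strictly until the method stops. *)
Lemma assignment_inj T s t : (forall u, (2 <= u <= T)%N -> ~ stable_at u) ->
  (s.+1 < T)%N -> (t.+1 < T)%N -> a s.+1 = a t.+1 -> s = t.
Proof.
move=> ns sT tT /eq_potential E; case: (ltngtP s t) => // st.
- by have := potential_lt_trans ns st tT; rewrite E ltxx.
- by have := potential_lt_trans ns st sT; rewrite E ltxx.
Qed.

Lemma center_bound (D : R) t l j : (forall i j, `|X i ord0 j| <= D) ->
  cluster (a t.+1) l != finset.set0 -> `|c t.+1 l ord0 j| <= D.
Proof.
move=> XD C0; have C1 : (0 < #|cluster (a t.+1) l|)%N by rewrite lt0n cards_eq0.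
rewrite -(ler_pMn2r C1) -normrMn.
have -> : c t.+1 l ord0 j *+ #|cluster (a t.+1) l| = \sum_(i in cluster (a t.+1) l) X i ord0 j.
  by rewrite -mulmxnE -center_cluster summxE.
apply: le_trans (ler_norm_sum _ _ _) _.
by rewrite -sumr_const; apply: ler_sum.
Qed.

Lemma potential_bound (D : R) t : (forall i j, `|X i ord0 j| <= D) ->
  potential t.+1 <= (2 * D) ^+ 2 *+ (n * d).
Proof.
move=> XD.
have -> : (2 * D) ^+ 2 *+ (n * d) = \sum_(i < n) \sum_(j < d) (2 * D) ^+ 2.
  by rewrite !sumr_const !card_ord mulnC mulrnA.
apply: ler_sum => i _; apply: ler_sum => j _.
have Ci : cluster (a t.+1) (a t.+1 i) != finset.set0 by apply/set0Pn; exists i; rewrite inE.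
have := center_bound j XD Ci; have := XD i j.
move=> h1 h2; rewrite -[X in X <= _]real_normK ?num_real//.
rewrite lerXn2r ?nnegrE ?mulr_ge0// ?(le_trans _ h1)//.
by apply: le_trans (ler_normB _ _) _; lra.
Qed.

(** Otherwise each of the [M] blocks would lower the potential by [delta], and it would become
    negative. *)
Lemma block_exists (delta : R) (L M : nat) :
  potential 1 < delta *+ M ->
  exists2 q, (q < M)%N & potential (q * L).+1 - potential (q.+1 * L).+1 < delta.
Proof.
move=> PM; apply: contrapT => H.
suff : forall m, (m <= M)%N -> delta *+ m <= potential 1 - potential (m * L).+1.
  move=> /(_ M (leqnn _)) h; have := potential_ge0 (M * L).+1; move: h PM; lra.
elim=> [|m ih] mM; first by rewrite mul0n mulr0n subrr.
have := ih (ltnW mM); rewrite mulrSr.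
have [//|] := ltP (potential (m * L).+1 - potential (m.+1 * L).+1) delta.
  by move=> h; case: H; exists m.
by lra.
Qed.

Lemma potential_nincr s t : (s <= t)%N -> potential t.+1 <= potential s.+1.
Proof.
move=> /subnK <-; elim: (t - s)%N => // m ih; rewrite addSn.
exact: le_trans (potential_decr _) ih.
Qed.

Lemma block_center_move (eps : R) t0 L s t l j : 0 <= eps ->
  potential t0.+1 - potential (t0 + L).+1 <= eps ^+ 2 ->
  (t0 <= s <= t0 + L)%N -> (t0 <= t <= t0 + L)%N ->
  `|c s.+1 l ord0 j - c t.+1 l ord0 j| <= eps *+ L.
Proof.
move=> e0 PL.
have step u : (t0 <= u < t0 + L)%N -> `|c u.+2 l ord0 j - c u.+1 l ord0 j| <= eps.
  move=> /andP[u0 uL].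
  rewrite -(ler_pXn2r (n := 2))// ?nnegrE// real_normK ?num_real//.
  apply: le_trans (sqdist_coord _ _ _) _; apply: le_trans (sqdist_center_le _ _) _.
  apply: le_trans PL.
  by have := potential_nincr u0; have := potential_nincr uL; lra.
have main s' m : (t0 <= s')%N -> (s' + m <= t0 + L)%N ->
    `|c (s' + m).+1 l ord0 j - c s'.+1 l ord0 j| <= eps *+ m.
  move=> s0; elim: m => [|m ih] sm; first by rewrite addn0 subrr normr0.
  rewrite mulrSr addnS.
  have -> : c (s' + m).+2 l ord0 j - c s'.+1 l ord0 j =
    (c (s' + m).+1 l ord0 j - c s'.+1 l ord0 j) + (c (s' + m).+2 l ord0 j - c (s' + m).+1 l ord0 j) by ring.
  apply: le_trans (ler_normD _ _) _; apply: lerD.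
    by apply: ih; lia.
  by apply: step; lia.
wlog st : s t / (s <= t)%N.
  move=> h; case/orP: (leq_total s t) => st hs ht; first exact: h.
  by rewrite distrC; apply: h.
move=> hs ht; rewrite distrC -(subnKC st).
apply: le_trans (main _ _ _ _) _; [lia|lia|].
by apply: ler_wpMn2l => //; lia.
Qed.

End kmeans_dynamics.

(** * Hamming balls *)

Section hamming.
Variables (n : nat) (V : finType).
Implicit Types f g : {ffun 'I_n -> V}.

Definition hamming f g := #|[set i | f i != g i]%SET|.

Definition upd f (p : 'I_n * V) : {ffun 'I_n -> V} :=
  [ffun i => if i == p.1 then p.2 else f i].

(** Every element of the ball of radius [r.+1] is a one-point update of an element of the ball of
    radius [r]; [0 < n] provides a trivial update for [g] itself. *)
Lemma card_hamming_ball g r : (0 < n)%N ->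
  (#|[set f | hamming f g <= r]%SET| <= (n * #|V|) ^ r)%N.
Proof.
move=> n0; elim: r => [|r ih].
  rewrite expn0 (_ : [set f | _]%SET = [set g]%SET) ?cards1//.
  apply/setP => f; rewrite !inE leqn0 cards_eq0; apply/eqP/eqP => [/setP fg|->].
    by apply/ffunP => i; have := fg i; rewrite !inE => /negbFE/eqP.
  by apply/setP => i; rewrite !inE eqxx.
pose B := [set f | (hamming f g <= r)%N]%SET.
apply: (@leq_trans #|[set upd x.1 x.2 | x in finset.setX B [set: 'I_n * V]]%SET|).
  apply/subset_leq_card/fintype.subsetP => f; rewrite inE => fg.
  have [i fi|f0] := pickP (fun i => f i != g i); last first.
    apply/imsetP; exists (f, (Ordinal n0, f (Ordinal n0))).
      rewrite !inE /= /hamming (_ : #|_| = 0)%N//.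
      by apply/eqP; rewrite cards_eq0; apply/eqP/setP => i; rewrite finset.in_set0 inE f0.
    by apply/ffunP => i; rewrite ffunE; case: eqP => // ->.
  apply/imsetP; exists (upd f (i, g i), (i, f i)); last first.
    by apply/ffunP => j; rewrite !ffunE /=; case: eqP => // ->.
  rewrite !inE /= andbT /hamming.
  have fi' : i \in [set i | f i != g i]%SET by rewrite inE.
  move: fg; rewrite /hamming (cardsD1 i) fi' add1n ltnS => /(leq_trans _); apply.
  apply/subset_leq_card/fintype.subsetP => j; rewrite !inE ffunE.
  by have [->|//] /= := eqVneq j i; rewrite eqxx.
apply: leq_trans (leq_imset_card _ _) _.
by rewrite cardsX cardsT card_prod card_ord expnS mulnC leq_mul2l ih orbT.
Qed.

Lemma hamming_far (K : finType) (cl : {ffun 'I_n -> V} -> K) (A : {set {ffun 'I_n -> V}}) r :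
  (0 < n)%N -> (#|K| * (n * #|V|) ^ r < #|A|)%N ->
  exists f g, [/\ f \in A, g \in A, cl f = cl g & (r < hamming f g)%N].
Proof.
move=> n0 hA; apply: contrapT => H.
suff : (#|A| <= #|K| * (n * #|V|) ^ r)%N by lia.
rewrite -sum1_card (partition_big cl xpredT)//=.
rewrite -sum_nat_const; apply: leq_sum => z _.
have [g /andP[gA /eqP gz]|A0] := pickP (fun f => (f \in A) && (cl f == z)); last first.
  by rewrite big_pred0.
rewrite sum1_card; apply: leq_trans (card_hamming_ball g r n0).
apply/subset_leq_card/fintype.subsetP => f; rewrite !inE => /andP[fA /eqP fz].
by rewrite leqNgt; apply/negP => rf; apply: H; exists f, g; split=> //; rewrite fz gz.
Qed.

End hamming.

(** * Two far clusterings with nearly the same centers *)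

Section stable_pair.
Variables (R : realType) (n k d : nat) (X : 'I_n -> 'rV[R]_d).

(** What survives of two iterations, with clusterings [u] and [v], taken from a block
    during which all centers stay within [rho] of [z]. *)
Record stable_pair (rho : R) (u v : {ffun 'I_n -> 'I_k}) (z : 'I_k -> 'rV[R]_d) : Prop := {
  sp_empty : forall l, (cluster u l == finset.set0) = (cluster v l == finset.set0);
  sp_mod3 : forall l, #|cluster u l| = #|cluster v l| %[mod 3];
  sp_mean : forall l, \sum_(i in cluster u l) X i = z l *+ #|cluster u l|;
  sp_mean' : forall l j, `|\sum_(i in cluster v l) X i ord0 j - z l ord0 j *+ #|cluster v l| |
                         <= rho *+ #|cluster v l|;
  sp_closest : exists2 z', closest_assignment X z' u & forall l j, `|z' l ord0 j - z l ord0 j| <= rho;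
  sp_closest' : exists2 z', closest_assignment X z' v & forall l j, `|z' l ord0 j - z l ord0 j| <= rho
}.

Definition block_length r := (4 ^ k * (n * k) ^ r).+1.

Variables (c0 : 'I_k -> 'rV[R]_d) (a : nat -> 'I_n -> 'I_k) (c : nat -> 'I_k -> 'rV[R]_d).
Hypothesis run : kmeans_run X c0 a c.

Lemma no_stable_bound T : (forall u, (2 <= u <= T)%N -> ~ stable_at a c u) -> (T <= (k ^ n).+1)%N.
Proof.
case: T => // T ns; pose f (i : 'I_T) : {ffun 'I_n -> 'I_k} := finfun (a i.+1).
have f_inj : injective f.
  move=> i j /ffunP E; apply/val_inj; apply: (assignment_inj run ns); rewrite ?ltnS ?(ltn_ord i) ?(ltn_ord j)//.
  by apply/funext => x; have := E x; rewrite !ffunE.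
by have := leq_card _ f_inj; rewrite card_ffun !card_ord.
Qed.

Lemma stable_pair_exists (D eps : R) r M T : (0 < n)%N -> 0 <= eps ->
  (forall i j, `|X i ord0 j| <= D) -> (2 * D) ^+ 2 *+ (n * d) < eps ^+ 2 *+ M ->
  ((M * block_length r).+1 < T)%N ->
  (forall u, (2 <= u <= T)%N -> ~ stable_at a c u) ->
  exists u v z, stable_pair (eps *+ block_length r) u v z /\ (r < hamming u v)%N.
Proof.
move=> n0 e0 XD DM MT ns; set L := block_length r.
have [q qM drop] := block_exists L (le_lt_trans (potential_bound run 0 XD) DM).
pose t0 := (q * L)%N.
have t0L : ((t0 + L).+1 < T)%N.
  by apply: leq_ltn_trans MT; rewrite /t0 -mulSnr ltnS leq_mul2r qM orbT.
have dropL : potential X a c t0.+1 - potential X a c (t0 + L).+1 <= eps ^+ 2.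
  by rewrite /t0 -mulSnr ltW.
have move_ s t l j := block_center_move run l j e0 dropL (s := s) (t := t).
(* With the offset 2, both the centers that produced the clustering, at [(t0 + i).+1], and the
   centers computed from it, at [(t0 + i).+2], belong to the block. *)
pose f (i : 'I_L) : {ffun 'I_n -> 'I_k} := finfun (a (t0 + i).+2).
have f_inj : injective f.
  move=> i j /ffunP E; apply/val_inj => /=.
  have /addnI// : (t0 + i = t0 + j)%N.
  apply: succn_inj; apply: (assignment_inj run ns).
  - by have := ltn_ord i; lia.
  - by have := ltn_ord j; lia.
  by apply/funext => x; have := E x; rewrite !ffunE.
(* Four classes per cluster, namely empty or one of three residues of the size; this is the factor
   [4 ^ k] in [block_length]. *)
pose cl (g : {ffun 'I_n -> 'I_k}) : {ffun 'I_k -> 'I_4} :=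
  [ffun l => inord (if cluster g l == finset.set0 then 0 else (#|cluster g l| %% 3).+1)%N].
have hA : (#|{ffun 'I_k -> 'I_4}| * (n * #|'I_k|) ^ r < #|f @: 'I_L|)%N.
  by rewrite card_imset// card_ffun !card_ord.
have [_ [_ [/imsetP[i _ ->] /imsetP[j _ ->] clE far]]] := hamming_far cl n0 hA.
have clij l : ((cluster (a (t0 + i).+2) l == finset.set0) = (cluster (a (t0 + j).+2) l == finset.set0))
  /\ (#|cluster (a (t0 + i).+2) l| = #|cluster (a (t0 + j).+2) l| %[mod 3]).
  have fE (x : 'I_L) : cluster (f x) l = cluster (a (t0 + x).+2) l.
    by apply/setP => y; rewrite !inE ffunE.
  move/ffunP/(_ l): clE; rewrite !ffunE !fE => /(congr1 val) /=.
  have m3 m : (m %% 3 < 3)%N by rewrite ltn_mod.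
  rewrite !inordK; last 2 first.
  - by case: ifP => // _; rewrite ltnS.
  - by case: ifP => // _; rewrite ltnS.
  case: eqP => [->|_]; case: eqP => [->|_] // [].
  by [].
exists (f i), (f j), (c (t0 + i).+2); split=> //.
have fE (x : 'I_L) l : cluster (f x) l = cluster (a (t0 + x).+2) l.
  by apply/setP => y; rewrite !inE ffunE.
have fE' (x : 'I_L) : (f x : 'I_n -> 'I_k) = a (t0 + x).+2.
  by apply/funext => y; rewrite ffunE.
have iL := ltn_ord i; have jL := ltn_ord j.
split.
- by move=> l; rewrite !fE; have [] := clij l.
- by move=> l; rewrite !fE; have [] := clij l.
- by move=> l; rewrite !fE; exact: center_cluster run _ _.
- move=> l x; rewrite !fE.
  rewrite -summxE (center_cluster run) mulmxnE -mulrnBl normrMn ler_wMn2r//.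
  by apply: move_; lia.
- exists (c (t0 + i).+1); first by rewrite fE'; have [_ /(_ (t0 + i).+1)[]] := run.
  by move=> l x; apply: move_; lia.
- exists (c (t0 + j).+1); first by rewrite fE'; have [_ /(_ (t0 + j).+1)[]] := run.
  by move=> l x; apply: move_; lia.
Qed.

End stable_pair.

Lemma kmeans_worst_gt (R : realType) (n k d : nat) (X : 'I_n -> 'rV[R]_d) (T : nat) :
  (T%:R%:E < kmeans_worst_iterations k X)%E ->
  exists (c0 : 'I_k -> 'rV[R]_d) a c, kmeans_run X c0 a c /\ forall u, (2 <= u <= T)%N -> ~ stable_at a c u.
Proof.
move=> /ereal_sup_gt[_ [c0 _ <-]] /ereal_sup_gt[_ [a [c [run ->]]] Tlt].
exists c0, a, c; split=> // u /andP[u2 uT] st.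
move: Tlt; rewrite ltNge => /negP; apply.
apply: (@le_trans _ _ (u%:R)%:E); last by rewrite lee_fin ler_nat.
by apply: ereal_inf_lbound; exists u.
Qed.

Lemma kmeans_worst_le (R : realType) (n k d : nat) (X : 'I_n -> 'rV[R]_d) :
  (kmeans_worst_iterations k X <= ((k ^ n).+2)%:R%:E)%E.
Proof.
rewrite leNgt; apply/negP => /kmeans_worst_gt[c0 [a [c [run ns]]]].
by have := no_stable_bound run ns; rewrite ltnn.
Qed.

Local Close Scope classical_set_scope.

(** * Rare events *)

Lemma card_bigcup_le (I T : finType) (P : pred I) (A : I -> {set T}) :
  (#|\bigcup_(i | P i) A i| <= \sum_(i | P i) #|A i|)%N.
Proof.
apply: (big_ind2 (fun (B : {set T}) m => #|B| <= m)%N); rewrite ?cards0//.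
move=> B m B' m' Bm Bm'; apply: leq_trans (leq_card_setU B B') _.
exact: leq_add.
Qed.

Section events.
Variables (R : realType) (n k d : nat).
Implicit Types (X : 'I_n -> 'rV[R]_d).

(** The normal vector is scaled so that its largest coordinate, at [j0], equals 1: a translation
    along coordinate [j0] then shows unreduced in the distance to the hyperplane. *)
Definition slab_event (kappa : R) (Y : {set 'I_n}) (j0 : 'I_d) X : Prop :=
  exists (v : 'I_d -> R) (b : R), [/\ v j0 = 1, forall j, `|v j| <= 1 &
    forall y, y \in Y -> `|\sum_j v j * X y ord0 j - b| <= kappa].

(** Integer weights in [[-n, n]] on the points, coded by [x |-> x + n]. *)
Definition weights := {ffun 'I_n -> 'I_(n.*2.+1)}.
Definition wcoef (x : 'I_(n.*2.+1)) : R := x%:R - n%:R.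
Definition wsupp (w : weights) : {set 'I_n} := [set i | nat_of_ord (w i) != n]%SET.

Definition coincidence (kappa : R) (m : nat) (w : weights) X : Prop :=
  (0 < #|wsupp w| <= m)%N /\ forall j, `|\sum_i wcoef (w i) * X i ord0 j| <= kappa.

Definition coincidence_family (kappa : R) (m g : nat) (W : {ffun 'I_g -> weights}) X : Prop :=
  (forall f f', f != f' -> [disjoint wsupp (W f) & wsupp (W f')]) /\
  forall f, coincidence kappa m (W f) X.
 
Lemma wcoef_eq0 (w : weights) i : i \notin wsupp w -> wcoef (w i) = 0.
Proof. by rewrite inE negbK => /eqP wi; rewrite /wcoef wi subrr. Qed.

Lemma wcoef_ge1 (w : weights) i : i \in wsupp w -> 1 <= `|wcoef (w i)|.
Proof.
rewrite inE /wcoef => wi.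
case: (ltngtP (w i) n) wi => // lt _.
  by rewrite distrC ler_normr -natrB ?(ltnW lt)// ler1n subn_gt0 lt.
by rewrite ler_normr -natrB ?(ltnW lt)// ler1n subn_gt0 lt.
Qed.

(** Greedy choice: a family with disjoint supports either is extended by one more coincidence, or
    the union of its supports meets every coincidence. *)
Lemma coincidence_hit kappa m g X :
  (exists W : {ffun 'I_g -> weights}, coincidence_family kappa m W X) \/
  exists Z : {set 'I_n}, (#|Z| <= g.-1 * m)%N /\
    forall w, coincidence kappa m w X -> exists2 i, i \in wsupp w & i \in Z.
Proof.
elim: g => [|g [[W [Wd Wc]]|[Z [Zm Zh]]]].
- left; exists [ffun=> [ffun=> ord0]]; split; first by case.
  by case.
- have [H|H] := pselect (forall w, coincidence kappa m w X ->
      exists2 i, i \in wsupp w & i \in \bigcup_f wsupp (W f)).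
    right; exists (\bigcup_f wsupp (W f))%SET; split=> //=.
    apply: (leq_trans (card_bigcup_le _ _)).
    apply: (@leq_trans (\sum_(f < g) m)); last by rewrite sum_nat_const card_ord.
    by apply: leq_sum => f _; have [/andP[]] := Wc f.
  left; move/existsNP: H => [w /not_implyP[wc wZ]].
  pose W' : {ffun 'I_g.+1 -> weights} := [ffun i : 'I_g.+1 => if unlift ord_max i is Some f then W f else w].
  have dw f : [disjoint wsupp (W f) & wsupp w].
    rewrite disjoint_sym; apply/pred0P => i /=; apply/negP => /andP[iw iW].
    by apply: wZ; exists i => //; apply/bigcupP; exists f.
  exists W'; split.
    move=> f f'; rewrite !ffunE.
    case: unliftP => [i ->|->]; case: unliftP => [i' ->|->].
    - by rewrite (inj_eq lift_inj); exact: Wd.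
    - by move=> _; exact: dw.
    - by move=> _; rewrite disjoint_sym; exact: dw.
    - by rewrite eqxx.
  by move=> f; rewrite ffunE; case: unliftP => [i _|_].
- right; exists Z; split=> //; apply: leq_trans Zm _.
  by rewrite leq_mul2r leq_pred orbT.
Qed.

(** A blueprint records, for each point on which two clusterings differ, its two
    clusters, a coordinate, an integer weight for this coordinate, and whether the
    centers of its two clusters are well separated. *)
Definition edge := ('I_k * 'I_k * 'I_d * 'I_n.+1 * bool)%type.
Definition esrc (x : edge) := x.1.1.1.1.
Definition edst (x : edge) := x.1.1.1.2.
Definition ecoord (x : edge) := x.1.1.2.
Definition eweight (x : edge) := x.1.2.
Definition egood (x : edge) := x.2.

Definition blueprint := {ffun 'I_n -> option edge}.
Implicit Types b : blueprint.

Definition bpred (P : edge -> bool) b i := if b i is Some x then P x else false.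
Definition bedges b : {set 'I_n} := finset (fun i => isSome (b i)).
Definition bout b l : {set 'I_n} := finset (bpred (fun x : edge => esrc x == l) b).
Definition bin b l : {set 'I_n} := finset (bpred (fun x : edge => edst x == l) b).
Definition bgood b : {set 'I_n} := finset (bpred egood b).
Definition bdeg b l := (#|bout b l| + #|bin b l|)%N.
Definition bactive b : {set 'I_k} := [set l | (0 < bdeg b l)%N]%SET.
(** The centers that their equation determines from translated points, at the cost of one integer.
    Clusters of degree at least [9 * d] are left to [bnet]: they have enough edges to pay for [d]
    rounded coordinates. *)
Definition blow b : {set 'I_k} :=
  [set l in bactive b | [&& #|bin b l| != #|bout b l|, (bdeg b l < 9 * d)%N &
     (bout b l :|: bin b l) \subset bgood b]]%SET.
Definition bnet b : {set 'I_k} := (bactive b :\: blow b)%SET.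
(** The common direction of translation. It is read off from the blueprint and not from the points,
    since the family of translations has to be fixed before the points are. *)
Definition bdir b (j : 'I_d) : R :=
  \sum_i if b i is Some x then (if ecoord x == j then (eweight x)%:R else 0) else 0.

Definition blueprint_event (D epsF eta epsW : R) b X : Prop :=
  exists z : 'I_k -> 'rV[R]_d,
  [/\ forall l j, l \in bactive b -> `|z l ord0 j| <= D,
      forall i x, b i = Some x ->
        `|sqdist (X i) (z (esrc x)) - sqdist (X i) (z (edst x))| <= epsF,
      forall i x, b i = Some x -> egood x ->
        eta / 2 <= `|\sum_j bdir b j * (z (esrc x) ord0 j - z (edst x) ord0 j)| &
      forall l j, `|z l ord0 j * (#|bin b l|%:R - #|bout b l|%:R) -
        (\sum_(i in bin b l) X i ord0 j - \sum_(i in bout b l) X i ord0 j)| <= epsW].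

(** The last inequality counts ends of edges: at least 3 at each low cluster and at least [9 * d] at
    each net cluster, with boundedly many exceptions that go into [C1]. *)
Definition blueprint_adm (r C1 C2 : nat) b : bool :=
  [&& (r < #|bedges b|)%N, (#|bedges b :\: bgood b| <= C2)%N &
    (3 * #|blow b| + 9 * (d * #|bnet b|) <= 2 * #|bedges b| + 9 * C1)%N].

End events.

(** * A direction that separates all pairs of centers *)

Section direction.
Variables (R : realType) (n d : nat).

(** For fixed other weights, at most one value of [w i] makes the [i]-th pairing small. *)
Lemma weights_exist (M G : {set 'I_n}) (jj : 'I_n -> 'I_d) (delta : 'I_n -> 'I_d -> R) (eta : R) :
  0 < eta -> G \subset M -> (forall i, i \in G -> eta <= `|delta i (jj i)|) ->
  exists w : {ffun 'I_n -> 'I_n.+1}, forall i, i \in G ->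
    eta / 2 <= `|\sum_(e in M) (w e)%:R * delta i (jj e)|.
Proof.
move=> eta0 GM hdelta.
pose F (w : {ffun 'I_n -> 'I_n.+1}) i := \sum_(e in M) (w e)%:R * delta i (jj e).
pose bad i := [set w | `|F w i| < eta / 2]%SET.
have uniq i (w w' : {ffun 'I_n -> 'I_n.+1}) : i \in G -> w \in bad i -> w' \in bad i ->
    (forall e, e != i -> w e = w' e) -> w = w'.
  move=> iG; rewrite !inE => bw bw' E.
  have iM : i \in M by apply: (fintype.subsetP GM).
  have FE : F w i - F w' i = ((w i)%:R - (w' i)%:R) * delta i (jj i).
    rewrite /F (bigD1 i)//= [X in _ - X](bigD1 i)//=.
    rewrite (eq_bigr (fun e => (w' e)%:R * delta i (jj e))) => [|e /andP[_ ei]]; last by rewrite E.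
    by ring.
  have lt : `|((w i)%:R - (w' i)%:R) * delta i (jj i)| < eta.
    by rewrite -FE; apply: le_lt_trans (ler_normB _ _) _; lra.
  apply/ffunP => e; have [->|/E//] := eqVneq e i.
  apply/val_inj/eqP; apply: contraLR lt => ne; rewrite -leNgt normrM.
  have : 1 <= `|(w i)%:R - (w' i)%:R : R|.
    case: (ltngtP (val (w i)) (val (w' i))) ne => // l1 _.
    by rewrite distrC ler_normr -natrB ?(ltnW l1)// ler1n subn_gt0 l1.
  by rewrite ler_normr -natrB ?(ltnW l1)// ler1n subn_gt0 l1.
  have := hdelta i iG; nra.
have cardbad i : i \in G -> (#|bad i| * n.+1 <= n.+1 ^ n)%N.
  move=> iG; pose f (x : {ffun 'I_n -> 'I_n.+1} * 'I_n.+1) := upd x.1 (i, x.2).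
  rewrite -[X in (_ * X)%N](card_ord n.+1) -cardsT -cardsX.
  rewrite -(card_in_imset (f := f)).
    by apply: leq_trans (max_card _) _; rewrite card_ffun !card_ord.
  move=> [w x] [w' x']; rewrite !inE /= !andbT => bw bw' /ffunP E.
  have Ei := E i; rewrite !ffunE !eqxx /= in Ei.
  congr pair => //; apply: (uniq i) => //; rewrite ?inE// => e ei.
  by have := E e; rewrite !ffunE /= (negPf ei).
(* Each of at most [n] bad sets is at most a fraction [1 / n.+1] of all weights, so they do not
   cover everything. *)
have [w wP] : exists w, w \notin (\bigcup_(i in G) bad i)%SET.
  apply/existsP; rewrite -negb_forall; apply/negP => /forallP H.
  have : (#|[set: {ffun 'I_n -> 'I_n.+1}]%SET| <= #|\bigcup_(i in G) bad i|)%N.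
    by apply/subset_leq_card/fintype.subsetP => w _; exact: H.
  rewrite cardsT card_ffun !card_ord => le1.
  have le2 : (#|\bigcup_(i in G) bad i| * n.+1 <= n * n.+1 ^ n)%N.
    apply: (@leq_trans ((\sum_(i in G) #|bad i|) * n.+1)).
      by rewrite leq_mul2r card_bigcup_le orbT.
    rewrite big_distrl /=; apply: (@leq_trans (\sum_(i in G) n.+1 ^ n)); first exact: leq_sum.
    rewrite sum_nat_const leq_mul2r; apply/orP; right.
    by apply: leq_trans (max_card _) _; rewrite card_ord.
  have : (0 < n.+1 ^ n)%N by rewrite expn_gt0.
  nia.
exists w => i iG; rewrite leNgt; apply/negP => lt.
by move/negP: wP; apply; apply/bigcupP; exists i => //; rewrite inE.
Qed.

End direction.

(** * Long runs force a rare event *)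

Section structure.
Variables (R : realType) (n k d : nat) (X : 'I_n -> 'rV[R]_d).
Variables (D rho eta kappa1 kappa2 : R).
Variables (u v : {ffun 'I_n -> 'I_k}) (z : 'I_k -> 'rV[R]_d).
Hypothesis sp : stable_pair X rho u v z.
Hypothesis XD : forall i j, `|X i ord0 j| <= D.
Hypotheses (d0 : (0 < d)%N) (rho0 : 0 <= rho) (rhoD : rho <= D) (eta0 : 0 < eta).
Hypothesis noslab : forall (Y : {set 'I_n}) j, #|Y| = (9 * d)%N -> ~ slab_event kappa1 Y j X.
Variable Z : {set 'I_n}.
Hypothesis hitZ : forall w : weights n, coincidence kappa2 (9 * d) w X ->
  exists2 i, i \in wsupp w & i \in Z.
Hypothesis hkappa1 : 2 * eta *+ (d * n) <= kappa1.
Hypothesis hkappa2 : 2 * eta *+ (n * n) <= kappa2.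
Hypothesis hkappa2' : rho *+ n <= kappa2.

Local Notation P := (cluster u).

Lemma center_bound_sp l j : P l != finset.set0 -> `|z l ord0 j| <= D.
Proof.
move=> C0; have C1 : (0 < #|P l|)%N by rewrite lt0n cards_eq0.
rewrite -(ler_pMn2r C1) -normrMn -mulmxnE -(sp_mean sp) summxE.
apply: le_trans (ler_norm_sum _ _ _) _.
by rewrite -sumr_const; apply: ler_sum.
Qed.

Lemma sum_cluster_coord l j : \sum_(i in P l) X i ord0 j = z l ord0 j *+ #|P l|.
Proof. by rewrite -summxE (sp_mean sp) mulmxnE. Qed.

(** Within a cluster all signed distances to the hyperplane have one sign, so each is bounded by
    their sum, which is the cluster size times the signed distance of the mean. The two means are on
    opposite sides and close to each other, hence both close to the hyperplane. *)
Lemma affine_side_bound (c : 'I_d -> R) (b zeta : R) (l l' : 'I_k) :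
  (forall j, `|c j| <= 1) -> P l != finset.set0 -> P l' != finset.set0 ->
  (forall j, `|z l ord0 j - z l' ord0 j| <= zeta) ->
  (forall y, y \in P l -> \sum_j c j * X y ord0 j <= b) ->
  (forall y, y \in P l' -> b <= \sum_j c j * X y ord0 j) ->
  forall y, y \in P l :|: P l' -> `|\sum_j c j * X y ord0 j - b| <= zeta *+ (d * n).
Proof.
move=> c1 Pl Pl' zz hl hl'.
pose g (x : 'rV[R]_d) := \sum_j c j * x ord0 j - b.
have sumg x : \sum_(y in P x) g (X y) = g (z x) *+ #|P x|.
  rewrite /g sumrB exchange_big sumr_const mulrnBl -sumrMnl; congr (_ - _).
  by apply: eq_bigr => j _; rewrite -mulr_sumr sum_cluster_coord mulrnAr.
have gl y : y \in P l -> g (X y) <= 0 by move=> yl; rewrite subr_le0 hl.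
have gl' y : y \in P l' -> 0 <= g (X y) by move=> yl; rewrite subr_ge0 hl'.
have Cl : (0 < #|P l|)%N by rewrite lt0n cards_eq0.
have Cl' : (0 < #|P l'|)%N by rewrite lt0n cards_eq0.
have gz : g (z l) <= 0.
  by rewrite -(pmulrn_lle0 _ Cl) -sumg; apply: sumr_le0 => y; exact: gl.
have gz' : 0 <= g (z l').
  by rewrite -(pmulrn_lge0 _ Cl') -sumg; apply: sumr_ge0 => y; exact: gl'.
have gzz : g (z l') - g (z l) <= zeta *+ d.
  rewrite /g opprB addrA subrK -sumrB; apply: le_trans (ler_norm _) _.
  apply: le_trans (ler_norm_sum _ _ _) _.
  rewrite -[X in _ *+ X](card_ord d) -sumr_const; apply: ler_sum => j _.
  rewrite -mulrBr normrM distrC -[zeta]mul1r.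
  by apply: ler_pM => //; exact: c1.
have zeta0 : 0 <= zeta *+ d by lra.
have bd (C : {set 'I_n}) : zeta *+ d *+ #|C| <= zeta *+ (d * n).
  by rewrite mulrnA; apply: ler_wpMn2l => //; rewrite -[X in (_ <= X)%N](card_ord n) max_card.
move=> y; rewrite inE => /orP[yl|yl].
  rewrite -/(g (X y)) ler0_norm ?gl//; apply: le_trans (bd (P l)).
  apply: (@le_trans _ _ (\sum_(y in P l) - g (X y))).
    rewrite (bigD1 y)//= lerDl; apply: sumr_ge0 => y' /andP[y'l _].
    by rewrite oppr_ge0 gl.
  by rewrite sumrN sumg -mulNrn lerMn2r; apply/orP; right; lra.
rewrite -/(g (X y)) ger0_norm ?gl'//; apply: le_trans (bd (P l')).
apply: (@le_trans _ _ (\sum_(y in P l') g (X y))).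
  rewrite (bigD1 y)//= lerDl; apply: sumr_ge0 => y' /andP[y'l _].
  by rewrite gl'.
by rewrite sumg lerMn2r; apply/orP; right; lra.
Qed.

Lemma sqdistB (x p q : 'rV[R]_d) : sqdist x p - sqdist x q =
  2 * \sum_j (q ord0 j - p ord0 j) * x ord0 j - \sum_j (q ord0 j ^+ 2 - p ord0 j ^+ 2).
Proof.
rewrite /sqdist -sumrB mulr_sumr -sumrB.
by apply: eq_bigr => j _; ring.
Qed.

Lemma subset_of_card (A : {set 'I_n}) m : (m <= #|A|)%N -> exists2 Y : {set 'I_n}, Y \subset A & #|Y| = m.
Proof.
move=> mA; exists [set x in take m (enum A)]%SET.
  by apply/fintype.subsetP => x; rewrite inE => /mem_take; rewrite mem_enum.
rewrite cardsE (card_uniqP _) ?take_uniq ?enum_uniq// size_take.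
by rewrite -cardE; case: ltngtP mA.
Qed.

(** The two clusters lie on different sides of a hyperplane, and their means are close to
    it; hence all their points are close to it. *)
Lemma close_centers_small l l' (zeta : R) : l != l' -> P l != finset.set0 -> P l' != finset.set0 ->
  (forall j, `|z l ord0 j - z l' ord0 j| <= zeta) -> zeta *+ (d * n) <= kappa1 ->
  (#|P l :|: P l'| < 9 * d)%N.
Proof.
move=> ll' Pl Pl' zz hz; rewrite ltnNge; apply/negP => /subset_of_card[Y YP Ycard].
have [z' closest _] := sp_closest sp.
pose delta j := z' l' ord0 j - z' l ord0 j.
have side y : y \in P l -> sqdist (X y) (z' l) <= sqdist (X y) (z' l').
  by rewrite inE => /eqP <-; have [] := closest y.
have side' y : y \in P l' -> sqdist (X y) (z' l') <= sqdist (X y) (z' l).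
  by rewrite inE => /eqP <-; have [] := closest y.
(* If the two centers coincided, the tie rule would leave the cluster of larger index empty. *)
have [j1 hj1] : exists j, delta j != 0.
  apply: contrapT => H.
  have zE : z' l = z' l'.
    apply/rowP => j; apply/eqP; rewrite eq_sym -subr_eq0; apply: contrapT => /negP h.
    by apply: H; exists j.
  have [y yl] := set0Pn _ Pl; have [y' yl'] := set0Pn _ Pl'.
  move: yl yl'; rewrite !inE => /eqP yl /eqP yl'.
  have [_ h1] := closest y; have [_ h2] := closest y'.
  case: (ltngtP l l') => [lt|lt|/val_inj E]; last by rewrite E eqxx in ll'.
    by have := h2 l; rewrite yl' zE ltxx => /(_ lt).
  by have := h1 l'; rewrite yl zE ltxx => /(_ lt).
pose j0 := [arg max_(j > j1) `|delta j|]%O.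
have j0max j : `|delta j| <= `|delta j0|.
  by rewrite /j0; case: arg_maxP => // i _ /(_ j isT).
have dj0 : delta j0 != 0.
  by rewrite -normr_gt0; apply: lt_le_trans (j0max j1); rewrite normr_gt0.
pose c j := delta j / delta j0.
have c1 j : `|c j| <= 1.
  by rewrite /c normrM normfV ler_pdivrMr ?normr_gt0// mul1r.
pose b := (\sum_j (z' l' ord0 j ^+ 2 - z' l ord0 j ^+ 2)) / (2 * delta j0).
have diffE y : sqdist (X y) (z' l) - sqdist (X y) (z' l') =
    2 * delta j0 * (\sum_j c j * X y ord0 j - b).
  rewrite sqdistB mulrBr /b mulrCA divff ?mulr1; last by rewrite mulf_neq0// pnatr_eq0.
  rewrite -mulrA; congr (2 * _ - _); rewrite mulr_sumr; apply: eq_bigr => j _.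
  by rewrite /c mulrA [delta j0 * _]mulrC divfK.
apply: (@noslab Y j0 Ycard); exists c, b; split=> //; first by rewrite /c divff.
move=> y /(fintype.subsetP YP) yP; apply: le_trans hz.
have [dpos|dneg] := ltP 0 (delta j0).
- apply: (affine_side_bound c1 Pl Pl' zz) => // x /[dup] xl.
    move=> /side; rewrite -subr_le0 diffE pmulr_rle0 ?subr_le0//; lra.
  move=> /side'; rewrite -subr_ge0 diffE pmulr_rge0 ?subr_ge0//; lra.
- have {}dneg : delta j0 < 0 by rewrite lt_neqAle dj0.
  rewrite finset.setUC in yP.
  apply: (affine_side_bound c1 Pl' Pl _ _ _ yP) => [j|x xl|x xl]; first by rewrite distrC.
    move: (side' _ xl); rewrite -subr_ge0 diffE nmulr_rge0 ?subr_le0//; lra.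
  move: (side _ xl); rewrite -subr_le0 diffE nmulr_rle0 ?subr_ge0//; lra.
Qed.

(** Weights [#|P l'|] on [P l] and [- #|P l|] on [P l'] combine the points to a multiple of
    [z l - z l'], so two close centers produce a coincidence; its support is small by
    [close_centers_small]. *)
Lemma close_centers_hit l l' (zeta : R) : l != l' -> P l != finset.set0 -> P l' != finset.set0 ->
  (forall j, `|z l ord0 j - z l' ord0 j| <= zeta) -> zeta *+ (d * n) <= kappa1 ->
  zeta *+ (n * n) <= kappa2 -> exists2 i, i \in P l :|: P l' & i \in Z.
Proof.
move=> ll' Pl Pl' zz h1 h2.
have cardn (C : {set 'I_n}) : (#|C| <= n)%N by rewrite -[X in (_ <= X)%N](card_ord n) max_card.
have Cl : (0 < #|P l|)%N by rewrite lt0n cards_eq0.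
have Cl' : (0 < #|P l'|)%N by rewrite lt0n cards_eq0.
pose w : weights n := [ffun i => inord (if u i == l then (n + #|P l'|)%N
  else if u i == l' then (n - #|P l|)%N else n)].
have wE i : nat_of_ord (w i) = (if u i == l then (n + #|P l'|)%N
  else if u i == l' then (n - #|P l|)%N else n).
  rewrite ffunE inordK// ltnS -addnn; case: ifP => _; first by rewrite leq_add2l cardn.
  by case: ifP => _; rewrite ?leq_addr// (leq_trans (leq_subr _ _)) ?leq_addr.
have wsE : wsupp w = P l :|: P l'.
  apply/setP => i; rewrite !inE wE.
  case: ifP => _ /=; last case: ifP => _ /=.
  - by rewrite -[X in _ != X]addn0 eqn_add2l -lt0n.
  - by rewrite neq_ltn ltn_subrL Cl (leq_trans Cl (cardn _)).
  - by rewrite eqxx.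
rewrite -wsE; apply: hitZ; split.
  rewrite wsE; apply/andP; split; last by apply: ltnW; exact: close_centers_small zz h1.
  by rewrite card_gt0; apply/set0Pn; have [i il] := set0Pn _ Pl; exists i; rewrite inE il.
move=> j; apply: le_trans h2.
have -> : \sum_i wcoef R (w i) * X i ord0 j =
  (z l ord0 j - z l' ord0 j) *+ (#|P l| * #|P l'|).
  have coefE i : wcoef R (w i) * X i ord0 j = (if u i == l then #|P l'|%:R * X i ord0 j else 0)
     - (if u i == l' then #|P l|%:R * X i ord0 j else 0).
    rewrite /wcoef wE; have [->|nl] := eqVneq (u i) l.
      by rewrite (negPf ll') subr0 natrD addrC addKr.
    case: eqP => _; last by rewrite subrr mul0r subr0.
    by rewrite sub0r natrB ?cardn// addrC addKr mulNr.
  rewrite (eq_bigr _ (fun i _ => coefE i)) sumrB -!big_mkcond /=.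
  have E x (m : nat) : \sum_(i | u i == x) m%:R * X i ord0 j = z x ord0 j *+ (#|P x| * m).
    rewrite -mulr_sumr mulrnA -sum_cluster_coord mulr_natl; congr (_ *+ _).
    by apply: eq_bigl => i; rewrite inE.
  by rewrite !E [(#|P l'| * _)%N]mulnC -mulrnBl.
have zeta0 : 0 <= zeta by apply: le_trans (zz j).
rewrite normrMn; apply: (@le_trans _ _ (zeta *+ (#|P l| * #|P l'|))).
  by rewrite lerMn2r zz orbT.
by apply: ler_wpMn2l => //; apply: leq_mul.
Qed.

Definition close_to l l' := [&& l != l', P l != finset.set0, P l' != finset.set0 &
  [forall j, `|z l ord0 j - z l' ord0 j| < eta]].
Definition exceptional : {set 'I_k} := [set l | [exists l', close_to l l']]%SET.

Lemma close_toP l l' : close_to l l' -> [/\ l != l', P l != finset.set0, P l' != finset.set0 &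
  forall j, `|z l ord0 j - z l' ord0 j| <= eta].
Proof. by move=> /and4P[? ? ? /forallP h]; split=> // j; exact: ltW. Qed.

Lemma eta_le2 m : eta *+ m <= 2 * eta *+ m.
Proof. by rewrite lerMn2r; apply/orP; right; have := eta0; lra. Qed.

(** At most [#|Z|] exceptional clusters contain a point of [Z]. For any other one, its close partner
    contains a point of [Z], and partners are distinct: two clusters with a common partner are
    within [2 * eta] of each other, so one of them would contain a point of [Z]. *)
Lemma card_exceptional : (#|exceptional| <= 2 * #|Z|)%N.
Proof.
pose A := (exceptional :&: [set u i | i in Z])%SET.
pose B := (exceptional :\: [set u i | i in Z])%SET.
have cA : (#|A| <= #|Z|)%N.
  apply: leq_trans (leq_imset_card (fun i => u i) _).
  by apply: subset_leq_card; apply: finset.subsetIr.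
have pick_close l : l \in exceptional -> exists l', close_to l l' by rewrite inE => /existsP.
pose f l := odflt l [pick l' | close_to l l'].
have fP l : l \in exceptional -> close_to l (f l).
  move=> /pick_close[l' h]; rewrite /f; case: pickP => //= h'.
  by have := h' l'; rewrite h.
have notZ l i : l \in B -> i \in P l -> i \in Z -> False.
  rewrite !inE => /andP[/negP h _] /eqP ul iZ.
  by apply: h; apply/imsetP; exists i.
have cB : (#|B| <= #|Z|)%N.
  rewrite -(card_in_imset (f := f)).
    apply: leq_trans (leq_imset_card (fun i => u i) _).
    apply/subset_leq_card/fintype.subsetP => _ /imsetP[l lB ->].
    have [ll' Pl Pl' zz] : [/\ l != f l, P l != finset.set0, P (f l) != finset.set0 &
       forall j, `|z l ord0 j - z (f l) ord0 j| <= eta].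
      by apply: close_toP; apply: fP; move: lB; rewrite inE => /andP[].
    have [i + iZ] := close_centers_hit ll' Pl Pl' zz (le_trans (eta_le2 _) hkappa1) (le_trans (eta_le2 _) hkappa2).
    rewrite inE => /orP[il|]; first by case: (notZ _ _ lB il iZ).
    by rewrite inE => /eqP <-; apply/imsetP; exists i.
  move=> l1 l2 l1B l2B ff; apply/eqP; apply: contrapT => /negP l12.
  have [ll1 Pl1 Pf1 zz1] : [/\ l1 != f l1, P l1 != finset.set0, P (f l1) != finset.set0 &
     forall j, `|z l1 ord0 j - z (f l1) ord0 j| <= eta].
    by apply: close_toP; apply: fP; move: l1B; rewrite inE => /andP[].
  have [ll2 Pl2 Pf2 zz2] : [/\ l2 != f l2, P l2 != finset.set0, P (f l2) != finset.set0 &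
     forall j, `|z l2 ord0 j - z (f l2) ord0 j| <= eta].
    by apply: close_toP; apply: fP; move: l2B; rewrite inE => /andP[].
  have zz j : `|z l1 ord0 j - z l2 ord0 j| <= 2 * eta.
    have := zz1 j; have := zz2 j; rewrite -ff !ler_norml => /andP[? ?] /andP[? ?].
    by apply/andP; split; lra.
  have [i + iZ] := close_centers_hit l12 Pl1 Pl2 zz hkappa1 hkappa2.
  by rewrite inE => /orP[il|il]; [case: (notZ _ _ l1B il iZ)|case: (notZ _ _ l2B il iZ)].
have -> : exceptional = A :|: B by rewrite finset.setID.
apply: leq_trans (leq_card_setU A B) _.
by rewrite mul2n -addnn leq_add.
Qed.

Lemma exceptional_small l : l \in exceptional -> (#|P l| <= 9 * d)%N.
Proof.
rewrite inE => /existsP[l' /close_toP[ll' Pl Pl' zz]].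
have := close_centers_small ll' Pl Pl' zz (le_trans (eta_le2 _) hkappa1).
by move=> /ltnW; apply: leq_trans; apply: subset_leq_card; apply: finset.subsetUl.
Qed.

Definition moved : {set 'I_n} := [set i | u i != v i]%SET.
Definition separated i := [exists j, eta <= `|z (u i) ord0 j - z (v i) ord0 j|].
Definition sep_coord i : 'I_d :=
  odflt (Ordinal d0) [pick j | eta <= `|z (u i) ord0 j - z (v i) ord0 j|].

Lemma nonempty_u i : P (u i) != finset.set0.
Proof. by apply/set0Pn; exists i; rewrite inE. Qed.

(** This is why the pair must agree on the empty clusters: at both ends of an edge, [z] is then the
    mean of a nonempty cluster. *)
Lemma nonempty_v i : P (v i) != finset.set0.
Proof. by rewrite (sp_empty sp); apply/set0Pn; exists i; rewrite inE. Qed.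

Lemma unseparated_exceptional i : i \in moved -> ~~ separated i ->
  (u i \in exceptional) && (v i \in exceptional).
Proof.
rewrite inE => uv; rewrite negb_exists => /forallP h.
have lt j : `|z (u i) ord0 j - z (v i) ord0 j| < eta by rewrite ltNge.
rewrite !inE; apply/andP; split; apply/existsP.
  by exists (v i); rewrite /close_to uv nonempty_u nonempty_v; apply/forallP.
exists (u i); rewrite /close_to eq_sym uv nonempty_u nonempty_v; apply/forallP => j.
by rewrite distrC.
Qed.

Variable w : {ffun 'I_n -> 'I_n.+1}.
Hypothesis wP : forall i, i \in [set i in moved | separated i] ->
  eta / 2 <= `|\sum_(e in moved) (w e)%:R *
     (z (u i) ord0 (sep_coord e) - z (v i) ord0 (sep_coord e))|.

Definition bp_of : blueprint n k d :=
  [ffun i => if u i != v i then Some (u i, v i, sep_coord i, w i, separated i) else None].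

Lemma bpE P' i : bpred P' bp_of i = (u i != v i) && P' (u i, v i, sep_coord i, w i, separated i).
Proof. by rewrite /bpred ffunE; case: ifP. Qed.

Lemma bedges_bp : bedges bp_of = moved.
Proof. by apply/setP => i; rewrite !inE ffunE; case: ifP. Qed.

Lemma bout_bp l : bout bp_of l = P l :\: cluster v l.
Proof.
apply/setP => i; rewrite !inE bpE /esrc /=.
by rewrite andbC [RHS]andbC; case: eqP => //= ->; rewrite eq_sym.
Qed.

Lemma bin_bp l : bin bp_of l = cluster v l :\: P l.
Proof.
apply/setP => i; rewrite !inE bpE /edst /=.
by rewrite andbC [RHS]andbC; case: eqP => //= ->.
Qed.

Lemma bgood_bp : bgood bp_of = [set i in moved | separated i]%SET.
Proof. by apply/setP => i; rewrite !inE bpE /egood. Qed.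

Lemma bin_bout_mod l : #|bin bp_of l| = #|bout bp_of l| %[mod 3].
Proof.
have hm := sp_mod3 sp l.
have h1 := cardsID (cluster v l) (P l); have h2 := cardsID (P l) (cluster v l).
rewrite finset.setIC in h2; rewrite bout_bp bin_bp.
move: h1 h2 hm; set A := #|_ :&: _|; set B := #|_ :\: _|; set C := #|cluster v l :\: _|.
by move=> <- <- /eqP; rewrite eqn_modDl => /eqP.
Qed.

Lemma sum_bout l j : \sum_(i in bin bp_of l) X i ord0 j - \sum_(i in bout bp_of l) X i ord0 j =
  \sum_(i in cluster v l) X i ord0 j - \sum_(i in P l) X i ord0 j.
Proof.
rewrite bin_bp bout_bp (big_setID (P l) (A := cluster v l)) /=.
rewrite [X in _ = _ - X](big_setID (cluster v l)) /= finset.setIC.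
by rewrite opprD addrACA subrr add0r.
Qed.

Lemma card_bout (l : 'I_k) : (#|bin bp_of l|%:R - #|bout bp_of l|%:R : R) =
  #|cluster v l|%:R - #|P l|%:R.
Proof.
rewrite bin_bp bout_bp -(cardsID (P l) (cluster v l)) -(cardsID (cluster v l) (P l)).
by rewrite finset.setIC !natrD opprD addrACA subrr add0r.
Qed.

Lemma center_equation l j : `|z l ord0 j * (#|bin bp_of l|%:R - #|bout bp_of l|%:R) -
  (\sum_(i in bin bp_of l) X i ord0 j - \sum_(i in bout bp_of l) X i ord0 j)| <= rho *+ n.
Proof.
rewrite sum_bout card_bout sum_cluster_coord mulrBr !mulr_natr.
rewrite opprB addrA subrK -normrN opprB.
apply: le_trans (sp_mean' sp l j) _; apply: ler_wpMn2l => //.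
by rewrite -[X in (_ <= X)%N](card_ord n) max_card.
Qed.

(** If as many points enter as leave, the center drops out of its equation, and weights [1] on the
    entering and [-1] on the leaving points give a coincidence. *)
Lemma balanced_hit l : l \in bactive bp_of -> #|bin bp_of l| = #|bout bp_of l| ->
  (bdeg bp_of l < 9 * d)%N -> exists2 i, i \in bout bp_of l :|: bin bp_of l & i \in Z.
Proof.
rewrite inE => act bal deg.
have inout i : i \in bout bp_of l -> i \notin bin bp_of l.
  by rewrite bout_bp bin_bp !inE => /andP[_ ->].
have dis : [disjoint bout bp_of l & bin bp_of l].
  by apply/pred0P => i /=; apply/negP => /andP[/inout/negP].
have n0 : (0 < n)%N.
  move: act; rewrite /bdeg bal addnn double_gt0 => h; apply: leq_trans h _.
  by rewrite -[X in (_ <= X)%N](card_ord n) max_card.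
pose W : weights n := [ffun i => inord (if i \in bout bp_of l then n.-1
  else if i \in bin bp_of l then n.+1 else n)].
have WE i : nat_of_ord (W i) = (if i \in bout bp_of l then n.-1
  else if i \in bin bp_of l then n.+1 else n).
  rewrite ffunE inordK// ltnS -addnn; case: ifP => _; first by rewrite (leq_trans (leq_pred _)) ?leq_addr.
  by case: ifP => _; rewrite ?leq_addr// -addn1 leq_add2l.
have WsE : wsupp W = bout bp_of l :|: bin bp_of l.
  apply/setP => i; rewrite inE finset.in_setU WE.
  case: ifP => _ /=; last case: ifP => _ /=; rewrite ?eqxx//.
  - by rewrite neq_ltn prednK// leqnn.
  - by rewrite neq_ltn leqnn orbT.
have cardW : #|wsupp W| = bdeg bp_of l.
  by rewrite WsE; apply/eqP; rewrite (eq_leqif (leq_card_setU _ _)).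
rewrite -WsE; apply: hitZ; split; first by rewrite cardW act ltnW.
move=> j; have := center_equation l j; rewrite bal subrr mulr0 sub0r normrN => h.
apply: le_trans (le_trans h hkappa2').
rewrite le_eqVlt; apply/orP; left; apply/eqP; congr `|_|.
rewrite [X in _ = X - _]big_mkcond [X in _ = _ - X]big_mkcond -sumrB /=.
apply: eq_bigr => i _; rewrite /wcoef WE.
case: (boolP (i \in bout bp_of l)) => [/inout/negPf ->|_].
  rewrite sub0r -subn1 natrB//; by rewrite addrC addKr mulN1r.
case: ifP => _; last by rewrite !subrr mul0r.
by rewrite subr0 -[in X in X - _]addn1 natrD addrC addKr mul1r.
Qed.

Lemma sum_bdeg : (\sum_l bdeg bp_of l = 2 * #|moved|)%N.
Proof.
rewrite big_split mul2n -addnn /=; congr addn.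
  rewrite -sum1_card (partition_big u xpredT)//=; apply: eq_bigr => l _.
  rewrite -sum1_card; apply: eq_bigl => i; rewrite inE bpE /esrc/= inE.
  by [].
rewrite -sum1_card (partition_big v xpredT)//=; apply: eq_bigr => l _.
by rewrite -sum1_card; apply: eq_bigl => i; rewrite inE bpE /edst/= inE.
Qed.

Lemma bedge_exceptional l : l \in bactive bp_of ->
  ~~ (bout bp_of l :|: bin bp_of l \subset bgood bp_of) -> l \in exceptional.
Proof.
move=> _ /fintype.subsetPn[i + ng]; rewrite finset.in_setU => il.
have iM : i \in moved.
  by move: il; rewrite !inE !bpE; case: (u i != v i).
have ns : ~~ separated i by move: ng; rewrite bgood_bp inE iM.
have /andP[eu ev] := unseparated_exceptional iM ns.
case/orP: il => il.
  have : i \in bout bp_of l by [].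
  by rewrite bout_bp finset.in_setD => /andP[_]; rewrite inE => /eqP <-.
have : i \in bin bp_of l by [].
by rewrite bin_bp finset.in_setD => /andP[_]; rewrite inE => /eqP <-.
Qed.

(** Here [h] counts the clusters of degree at least [9 * d], and [e] those of smaller degree that
    are balanced or exceptional, at most [2 * #|Z|] of each sort. The rest is the degree sum. *)
Lemma card_bnet_bp : exists h e, [/\ (#|bnet bp_of| <= h + e)%N,
   (3 * #|blow bp_of| + 9 * d * h <= 2 * #|moved|)%N & (e <= 4 * #|Z|)%N].
Proof.
pose H := [set l in bactive bp_of | (9 * d <= bdeg bp_of l)%N]%SET.
pose Bal := [set l in bactive bp_of | (#|bin bp_of l| == #|bout bp_of l|) && (bdeg bp_of l < 9 * d)%N]%SET.
have cBal : (#|Bal| <= 2 * #|Z|)%N.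
  apply: (@leq_trans #|[set u i | i in Z] :|: [set v i | i in Z]|).
    apply/subset_leq_card/fintype.subsetP => l.
    rewrite inE => /andP[act /andP[/eqP bal deg]].
    have [i + iZ] := balanced_hit act bal deg.
    rewrite !inE !bpE => /orP[/andP[_ /eqP <-]|/andP[_ /eqP <-]]; apply/orP; [left|right];
      by apply/imsetP; exists i.
  apply: leq_trans (leq_card_setU _ _) _; rewrite mul2n -addnn.
  by apply: leq_add; exact: leq_imset_card.
exists #|H|, #|Bal :|: exceptional|; split.
- apply: leq_trans (leq_card_setU H (Bal :|: exceptional)).
  apply/subset_leq_card/fintype.subsetP => l; rewrite /bnet finset.in_setD => /andP[nl act].
  move: nl; rewrite inE act /= negb_and negbK negb_and -leqNgt.
  rewrite !finset.in_setU => /or3P[bal|hi|ng].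
  + have [deg|deg] := ltnP (bdeg bp_of l) (9 * d).
      by apply/orP; right; apply/orP; left; rewrite inE act bal deg.
    by apply/orP; left; rewrite inE act deg.
  + by apply/orP; left; rewrite inE act hi.
  + by apply/orP; right; apply/orP; right; apply: bedge_exceptional.
- rewrite -sum_bdeg.
  have dis : [disjoint blow bp_of & H].
    apply/pred0P => l /=; apply/negP => /andP[]; rewrite !inE => /andP[_ /and3P[_ + _]] /andP[_].
    by rewrite ltnNge => /negP.
  apply: (@leq_trans (\sum_(l in blow bp_of :|: H) bdeg bp_of l)); last first.
    by rewrite [X in (_ <= X)%N](bigID (mem (blow bp_of :|: H))) /= leq_addr.
  rewrite (eq_bigl [predU blow bp_of & H]) => [|l]; last by rewrite finset.in_setU.
  rewrite bigU//=.
  apply: leq_add.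
    (* Distinct numbers congruent modulo 3 have sum at least 3. *)
    rewrite mulnC -sum_nat_const; apply: leq_sum => l; rewrite !inE => /andP[act /and3P[unb _ _]].
    have := bin_bout_mod l; move: unb act; rewrite /bdeg => /eqP.
    by move: #|bin _ l| #|bout _ l|; clear => x y; lia.
  rewrite mulnC -sum_nat_const; apply: leq_sum => l; rewrite !inE => /andP[_].
  by [].
- apply: leq_trans (leq_card_setU _ _) _.
  rewrite (_ : 4 = 2 + 2)%N// mulnDl; apply: leq_add => //; exact: card_exceptional.
Qed.

(** An unseparated point lies in an exceptional cluster, and such clusters are few and small. *)
Lemma card_bad_bp : (#|bedges bp_of :\: bgood bp_of| <= 2 * #|Z| * (9 * d))%N.
Proof.
apply: (@leq_trans (\sum_(l in exceptional) #|P l|)).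
  apply: leq_trans (card_bigcup_le _ _).
  apply/subset_leq_card/fintype.subsetP => i; rewrite bedges_bp bgood_bp finset.in_setD inE.
  move=> /andP[+ iM]; rewrite iM /= => ns.
  have /andP[eu _] := unseparated_exceptional iM ns.
  by apply/bigcupP; exists (u i) => //; rewrite inE.
apply: (@leq_trans (\sum_(l in exceptional) (9 * d))); first by apply: leq_sum => l; exact: exceptional_small.
by rewrite sum_nat_const leq_mul2r card_exceptional orbT.
Qed.

(** The factor 5 bounds [q - p + 2 * p - 2 * x] using [rho <= D]. Two such errors make the constant
    10 in [bp_of_event]. *)
Lemma sqdist_perturb (x p q : 'rV[R]_d) : (forall j, `|x ord0 j| <= D) ->
  (forall j, `|p ord0 j| <= D) -> (forall j, `|q ord0 j - p ord0 j| <= rho) ->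
  `|sqdist x q - sqdist x p| <= 5 * D * rho *+ d.
Proof.
move=> xD pD qp; rewrite /sqdist -sumrB; apply: le_trans (ler_norm_sum _ _ _) _.
rewrite -[X in _ *+ X](card_ord d) -sumr_const; apply: ler_sum => j _.
have -> : (x ord0 j - q ord0 j) ^+ 2 - (x ord0 j - p ord0 j) ^+ 2 =
  (q ord0 j - p ord0 j + 2 * p ord0 j - 2 * x ord0 j) * (q ord0 j - p ord0 j) by ring.
rewrite normrM; apply: ler_pM => //.
have := qp j; have := xD j; have := pD j; rewrite !ler_norml; have rD := rhoD.
by move=> /andP[? ?] /andP[? ?] /andP[? ?]; apply/andP; split; lra.
Qed.

Lemma bp_of_event (epsF epsW : R) : 10 * D * rho *+ d <= epsF -> rho *+ n <= epsW ->
  blueprint_event D epsF eta epsW bp_of X.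
Proof.
move=> hF hW; exists z; split.
- move=> l j; rewrite inE /bdeg addn_gt0 bout_bp bin_bp => act.
  apply: center_bound_sp.
  case/orP: act => /card_gt0P[i]; rewrite !inE => /andP[_ /eqP <-].
    exact: nonempty_u.
  exact: nonempty_v.
- move=> i x; rewrite ffunE; case: ifP => // uv [<-]; rewrite /esrc /edst /=.
  apply: le_trans hF.
  have zD l : P l != finset.set0 -> forall j, `|z l ord0 j| <= D by move=> h j; exact: center_bound_sp.
  have [z1 c1 e1] := sp_closest sp; have [z2 c2 e2] := sp_closest' sp.
  have h1u := sqdist_perturb (XD i) (zD _ (nonempty_u i)) (e1 (u i)).
  have h1v := sqdist_perturb (XD i) (zD _ (nonempty_v i)) (e1 (v i)).
  have h2u := sqdist_perturb (XD i) (zD _ (nonempty_u i)) (e2 (u i)).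
  have h2v := sqdist_perturb (XD i) (zD _ (nonempty_v i)) (e2 (v i)).
  (* The center of [u i] is closest in one assignment and that of [v i] in the other, which bounds
     the difference of squared distances from both sides. *)
  have [k1 _] := c1 i; have [k2 _] := c2 i.
  have {}k1 := k1 (v i); have {}k2 := k2 (u i).
  have -> : 10 * D * rho *+ d = 5 * D * rho *+ d + 5 * D * rho *+ d.
    by rewrite -mulrnDl; congr (_ *+ _); ring.
  move: h1u h1v h2u h2v; rewrite !ler_norml.
  by move=> /andP[? ?] /andP[? ?] /andP[? ?] /andP[? ?]; apply/andP; split; lra.
- move=> i x; rewrite ffunE; case: ifP => // uv [<-]; rewrite /esrc /edst /egood /= => si.
  have iG : i \in [set i in moved | separated i]%SET by rewrite !inE uv.
  apply: le_trans (wP iG) _; rewrite le_eqVlt; apply/orP; left; apply/eqP; congr `|_|.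
  rewrite /bdir.
  under [RHS]eq_bigr => j _ do rewrite mulr_suml.
  rewrite exchange_big big_mkcond /=; apply: eq_bigr => e _.
  rewrite inE; under [RHS]eq_bigr => j _ do rewrite ffunE.
  case: ifP => _; last by rewrite big1// => j _; rewrite mul0r.
  rewrite (bigD1 (sep_coord e))//= /ecoord /eweight /= eqxx big1 ?addr0// => j jn.
  by rewrite eq_sym (negPf jn) mul0r.
- by move=> l j; apply: le_trans (center_equation l j) hW.
Qed.

End structure.

Section structure_theorem.
Variables (R : realType) (n k d : nat) (X : 'I_n -> 'rV[R]_d).
Variables (D rho eta kappa1 kappa2 epsF epsW : R) (g r C1 C2 : nat).

Theorem stable_pair_blueprint (u v : {ffun 'I_n -> 'I_k}) (z : 'I_k -> 'rV[R]_d) :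
  stable_pair X rho u v z -> (r < hamming u v)%N ->
  (forall i j, `|X i ord0 j| <= D) -> (0 < d)%N -> 0 <= rho -> rho <= D -> 0 < eta ->
  2 * eta *+ (d * n) <= kappa1 -> 2 * eta *+ (n * n) <= kappa2 -> rho *+ n <= kappa2 ->
  10 * D * rho *+ d <= epsF -> rho *+ n <= epsW ->
  (4 * d * (g.-1 * (9 * d)) <= C1)%N -> (2 * (g.-1 * (9 * d)) * (9 * d) <= C2)%N ->
  [\/ exists (Y : {set 'I_n}) j, #|Y| = (9 * d)%N /\ slab_event kappa1 Y j X,
      exists W : {ffun 'I_g -> weights n}, coincidence_family kappa2 (9 * d) W X |
      exists b : blueprint n k d, blueprint_adm r C1 C2 b /\ blueprint_event D epsF eta epsW b X].
Proof.
move=> sp far XD d0 rho0 rhoD eta0 h1 h2 h3 hF hW hC1 hC2.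
have [hs|noslab] := pselect (exists (Y : {set 'I_n}) j, #|Y| = (9 * d)%N /\ slab_event kappa1 Y j X).
  by constructor 1.
have [|[Z [Zg hitZ]]] := coincidence_hit kappa2 (9 * d) g X; first by constructor 2.
constructor 3.
have {}noslab (Y : {set 'I_n}) j : #|Y| = (9 * d)%N -> ~ slab_event kappa1 Y j X.
  by move=> cY hs; apply: noslab; exists Y, j.
pose M := moved u v; pose G := [set i in M | separated eta u v z i]%SET.
have hdelta i : i \in G -> eta <= `|z (u i) ord0 (sep_coord eta u v z d0 i) -
    z (v i) ord0 (sep_coord eta u v z d0 i)|.
  rewrite !inE => /andP[_ /existsP[j hj]]; rewrite /sep_coord; case: pickP => //= h.
  by have := h j; rewrite hj.
have GM : G \subset M by apply/fintype.subsetP => i; rewrite inE => /andP[].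
have [w wP] := weights_exist (jj := sep_coord eta u v z d0)
  (delta := fun i j => z (u i) ord0 j - z (v i) ord0 j) eta0 GM hdelta.
exists (bp_of eta u v z d0 w); split; last first.
  exact: (bp_of_event sp XD rho0 rhoD wP hF hW).
apply/and3P; split.
- by rewrite bedges_bp.
- apply: leq_trans hC2.
  apply: leq_trans (card_bad_bp sp d0 eta0 noslab hitZ h1 h2 w) _.
  by rewrite leq_mul2r leq_mul2l Zg !orbT.
- have [h [e [he hh ee]]] := card_bnet_bp sp d0 rho0 eta0 noslab hitZ h1 h2 h3 w.
  rewrite bedges_bp.
  have : (d * e <= C1)%N.
    apply: leq_trans hC1; apply: (@leq_trans (d * (4 * (g.-1 * (9 * d))))); last by rewrite mulnA [(d * 4)%N]mulnC.
    by rewrite leq_mul2l; apply/orP; right; apply: leq_trans ee _; rewrite leq_mul2l Zg orbT.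
  have : (d * #|bnet (bp_of eta u v z d0 w)| <= d * h + d * e)%N.
    by rewrite -mulnDr leq_mul2l he orbT.
  move: hh; rewrite -mulnA -/M; move: #|blow _| (d * #|bnet _|)%N (2 * #|M|)%N (d * h)%N (d * e)%N.
  by clear; lia.
Qed.

End structure_theorem.

(** * Probabilities of the rare events *)

Section packing_points.
Variables (R : realType) (n d : nat) (s : R) (mu : 'I_n -> 'rV[R]_d) (Y D th e : R).
Hypotheses (s0 : 0 < s) (Y0 : 0 <= Y) (e0 : 0 < e) (es : e <= s).
Hypothesis mu01 : forall i j, 0 <= mu i ord0 j <= 1.
Hypothesis YD : 1 + Y * s <= D.
Hypotheses (ths : th <= s) (thN : th * (Y + 2) *+ (n * d) <= s).

Definition mxtuple (A : 'M[R]_(n, d)) : (n * d).-tuple R := [tuple mxvec A ord0 p | p < n * d].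

Definition box_event (Ev : ('I_n -> 'rV[R]_d) -> Prop) : set ((n * d).-tuple (measurableTypeR R)) :=
  [set g | (forall p, `|tnth g p| <= Y * s) /\ Ev (perturbed mu g)]%classic.

Lemma perturbedE (g : (n * d).-tuple R) i j :
  perturbed mu g i ord0 j = mu i ord0 j + tnth g (mxvec_index i j).
Proof. by rewrite /perturbed !mxE. Qed.

Lemma perturbed_bound (g : (n * d).-tuple R) i j :
  (forall p, `|tnth g p| <= Y * s) -> `|perturbed mu g i ord0 j| <= D.
Proof.
move=> gY; rewrite perturbedE; apply: le_trans YD; apply: le_trans (ler_normD _ _) _.
by apply: lerD => //; have /andP[m0 m1] := mu01 i j; rewrite ger0_norm.
Qed.

Lemma points_packing (Ev : ('I_n -> 'rV[R]_d) -> Prop) (S C : finType)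
    (tau : S -> 'I_n -> 'I_d -> R) (code : ('I_n -> 'rV[R]_d) -> S -> C) :
  (forall v i j, `|tau v i j| <= th) ->
  (forall X X' v v', Ev X -> Ev X' ->
    (forall i j, `|X i ord0 j| <= D) -> (forall i j, `|X' i ord0 j| <= D) ->
    (forall i j, `|(X i ord0 j - X' i ord0 j) + (tau v i j - tau v' i j)| <= e *+ 2) ->
    code X v = code X' v' -> v = v') ->
  (#|S|%:R%:E * gauss_prob s (hull e (box_event Ev)) <= (expR 1 * #|C|%:R)%:E)%E.
Proof.
move=> tauth sep.
apply: (@gauss_packing R s s0 _ _ Y th e S C
  (fun v => mxtuple (\matrix_(i, j) tau v i j)) (fun g => code (perturbed mu g))) => //.
- by move=> h p [].
- by move=> v p; case/mxvec_indexP: p => i j; rewrite tnth_mktuple mxvecE mxE.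
- move=> h h' v v' [hY Eh] [h'Y Eh'] near; apply: sep => //.
  + by move=> i j; exact: perturbed_bound.
  + by move=> i j; exact: perturbed_bound.
  + move=> i j; rewrite !perturbedE; have := near (mxvec_index i j).
    rewrite !tnth_mktuple !mxvecE !mxE.
    by congr (`|_| <= _); ring.
Qed.

End packing_points.

(** * Rounding to a finite code *)

Section rounding.
Variable R : realType.

Definition round_code (M eps : R) G (x : R) : 'I_G.+1 := inord `|Num.floor ((x + M) / eps)|%N.

Lemma round_codeP (M eps : R) G x x' : 0 < eps -> 2 * M < eps * G.+1%:R ->
  `|x| <= M -> `|x'| <= M -> round_code M eps G x = round_code M eps G x' -> `|x - x'| <= eps.
Proof.
move=> eps0 MG.
have main y : `|y| <= M -> exists2 m : nat, (m < G.+1)%N & Num.floor ((y + M) / eps) = m%:Z.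
  rewrite ler_norml => /andP[y1 y2].
  have : (0 <= Num.floor ((y + M) / eps))%R.
    by rewrite floor_ge0; apply: divr_ge0; [lra|exact: ltW].
  case E: (Num.floor _) => [m|//] _; exists m => //.
  rewrite -(ltr_nat R); apply: (@le_lt_trans _ _ ((y + M) / eps)).
    by have := floor_le ((y + M) / eps); rewrite E.
  rewrite ltr_pdivrMr// mulrC; apply: le_lt_trans MG; lra.
move=> /main[m mG mE] /main[m' mG' mE']; rewrite /round_code mE mE' => /(congr1 val)/=.
rewrite !inordK// => mm.
have /andP[] := floor_itv ((x + M) / eps); have /andP[] := floor_itv ((x' + M) / eps).
rewrite mE mE' /= mm !ler_pdivlMr// !ltr_pdivrMr// intrD mulrDl mul1r => h1 h2 h3 h4.
by rewrite ler_norml; apply/andP; split; lra.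
Qed.

Lemma nat_gap (m m' : nat) (a b : R) : `|a * (m%:R - m'%:R)| <= b -> b < a -> m = m'.
Proof.
move=> h ba; apply/eqP; apply: contraLR h => ne; rewrite -ltNge.
have b1 : 1 <= `|m%:R - m'%:R : R|.
  case: (ltngtP m m') ne => // l1 _.
    by rewrite distrC ler_normr -natrB ?(ltnW l1)// ler1n subn_gt0 l1.
  by rewrite ler_normr -natrB ?(ltnW l1)// ler1n subn_gt0 l1.
apply: (lt_le_trans ba); rewrite normrM; have := ler_norm a; have := normr_ge0 a; nra.
Qed.

Lemma normD_le (x y a b : R) : `|x| <= a -> `|y| <= b -> `|x + y| <= a + b.
Proof. by move=> xa yb; apply: le_trans (ler_normD _ _) (lerD xa yb). Qed.

Lemma normB_le (x y a b : R) : `|x| <= a -> `|y| <= b -> `|x - y| <= a + b.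
Proof. by move=> xa yb; apply: le_trans (ler_normB _ _) (lerD xa yb). Qed.

Lemma ler_sum_const (m : nat) (F : 'I_m -> R) (c : R) :
  (forall i, `|F i| <= c) -> `|\sum_i F i| <= c *+ m.
Proof.
move=> h; apply: le_trans (ler_norm_sum _ _ _) _.
by rewrite -[X in _ *+ X](card_ord m) -sumr_const; apply: ler_sum.
Qed.

End rounding.

Section event_probability.
Variables (R : realType) (n k d : nat) (s : R) (mu : 'I_n -> 'rV[R]_d) (Y D th e : R).
Hypotheses (s0 : 0 < s) (Y0 : 0 <= Y) (e0 : 0 < e) (es : e <= s).
Hypothesis mu01 : forall i j, 0 <= mu i ord0 j <= 1.
Hypothesis YD : 1 + Y * s <= D.
Hypotheses (ths : th <= s) (thN : th * (Y + 2) *+ (n * d) <= s).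

Local Notation hull_prob Ev := (gauss_prob s (hull e (box_event s mu Y Ev))).

Lemma D_ge0 : 0 <= D.
Proof. by apply: le_trans YD; rewrite addr_ge0// mulr_ge0// ltW. Qed.

Lemma step_le (T : nat) (t : 'I_T) (a : R) : 0 <= a -> a * T%:R <= th -> a * t%:R <= th.
Proof.
move=> a0; apply: le_trans; rewrite ler_wpM2l// ler_nat; exact: ltnW.
Qed.

(** Each point of [A] is moved along coordinate [j0] by its own multiple of [step]. Once the [d.+1]
    parameters of the hyperplane are known up to rounding, every multiple is determined; off [A]
    nothing moves, and the idle indices are copied into the code. *)
Lemma slab_prob (kappa step epsv epsb : R) (A : {set 'I_n}) (j0 : 'I_d) (T G : nat) :
  (0 < #|A|)%N -> 0 <= step -> step * T%:R <= th -> 0 < epsv -> 0 < epsb ->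
  2 * 1 < epsv * G.+1%:R -> 2 * (D *+ d + kappa) < epsb * G.+1%:R ->
  2 * kappa + e *+ 2 *+ d + epsv * D *+ d + epsb < step ->
  ((T ^ n)%:R%:E * hull_prob (slab_event kappa A j0) <=
   (expR 1 * (G.+1 ^ d.+1 * T ^ (n - #|A|))%:R)%:E)%E.
Proof.
move=> A0 step0 stepT ev0 eb0 Gv Gb stepL.
pose S : finType := {ffun 'I_n -> 'I_T}.
pose C : finType := ({ffun 'I_d -> 'I_G.+1} * 'I_G.+1 * {ffun {i | i \notin A} -> 'I_T})%type.
pose tau (t : S) i j : R := if (i \in A) && (j == j0) then step * (t i)%:R else 0.
pose wit (X : 'I_n -> 'rV[R]_d) : ('I_d -> R) * R :=
  if pselect (slab_event kappa A j0 X) is left H then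
    (projT1 (cid H), projT1 (cid (projT2 (cid H)))) else (fun=> 0, 0).
have witP X : slab_event kappa A j0 X -> [/\ (wit X).1 j0 = 1, forall j, `|(wit X).1 j| <= 1 &
    forall y, y \in A -> `|\sum_j (wit X).1 j * X y ord0 j - (wit X).2| <= kappa].
  move=> H; rewrite /wit; case: pselect => // H'.
  exact: (projT2 (cid (projT2 (cid H')))).
pose code X (t : S) : C := ([ffun j => round_code 1 epsv G ((wit X).1 j)],
  round_code (D *+ d + kappa) epsb G (wit X).2, [ffun i => t (val i)]).
have cardS : #|S| = (T ^ n)%N by rewrite card_ffun !card_ord.
have cardC : #|C| = (G.+1 ^ d.+1 * T ^ (n - #|A|))%N.
  rewrite !card_prod !card_ffun !card_ord expnSr; congr (_ * _ ^ _)%N.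
  by rewrite card_sig -[X in (X - _)%N](card_ord n) -(cardC (mem A)) addKn; apply: eq_card => i.
rewrite -cardS -cardC.
apply: (points_packing s0 Y0 e0 es mu01 YD ths thN (tau := tau) (code := code)).
  move=> t i j; rewrite /tau; case: ifP => _; last first.
    rewrite normr0; apply: le_trans stepT; exact: mulr_ge0.
  by rewrite ger0_norm ?mulr_ge0//; exact: step_le.
move=> X X' t t' /witP[v1 vb vk] /witP[v1' vb' vk'] XD XD' near [cv cb ct].
have bbound X0 : (forall j, `|(wit X0).1 j| <= 1) ->
    (forall y, y \in A -> `|\sum_j (wit X0).1 j * X0 y ord0 j - (wit X0).2| <= kappa) ->
    (forall i j, `|X0 i ord0 j| <= D) -> `|(wit X0).2| <= D *+ d + kappa.
  move=> h1 h2 h3; have [y yA] := card_gt0P A0; have {}h2 := h2 y yA.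
  have h4 : `|\sum_j (wit X0).1 j * X0 y ord0 j| <= D *+ d.
    apply: ler_sum_const => j; rewrite normrM -[D]mul1r; exact: ler_pM.
  by rewrite -[X in `|X|](subKr (\sum_j (wit X0).1 j * X0 y ord0 j)); exact: normB_le.
have {}cb : `|(wit X).2 - (wit X').2| <= epsb.
  by apply: (round_codeP eb0 Gb _ _ cb); exact: bbound.
have {}cv j : `|(wit X).1 j - (wit X').1 j| <= epsv.
  move/ffunP/(_ j): cv; rewrite !ffunE => cv.
  by apply: (round_codeP ev0 Gv _ _ cv).
apply/ffunP => i; have [iA|iA] := boolP (i \in A); last first.
  by move/ffunP/(_ (exist _ i iA)): ct; rewrite !ffunE.
apply/val_inj; apply: (nat_gap _ stepL) => /=.
pose rem j := (X i ord0 j - X' i ord0 j) + (tau t i j - tau t' i j).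
have idn : step * ((t i)%:R - (t' i)%:R) =
   (\sum_j (wit X').1 j * X' i ord0 j - (wit X').2) - (\sum_j (wit X).1 j * X i ord0 j - (wit X).2)
   + \sum_j (wit X).1 j * rem j + \sum_j ((wit X).1 j - (wit X').1 j) * X' i ord0 j
   - ((wit X).2 - (wit X').2).
  have h1 : \sum_j (wit X).1 j * (tau t i j - tau t' i j) = step * ((t i)%:R - (t' i)%:R).
    rewrite (bigD1 j0)//= /tau iA eqxx v1 mul1r big1 ?addr0 ?mulrBr// => j /negPf ->.
    by rewrite subrr mulr0.
  rewrite -h1 /rem.
  under [X in _ = _ + X + _ - _]eq_bigr do rewrite mulrDr mulrBr.
  under [X in _ = _ + _ + X - _]eq_bigr do rewrite mulrBl.
  rewrite !sumrB big_split /= sumrB; ring.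
rewrite idn.
have r1 : `|\sum_j (wit X).1 j * rem j| <= e *+ 2 *+ d.
  apply: ler_sum_const => j; rewrite normrM -[e *+ 2]mul1r; apply: ler_pM => //; exact: near.
have r2 : `|\sum_j ((wit X).1 j - (wit X').1 j) * X' i ord0 j| <= epsv * D *+ d.
  by apply: ler_sum_const => j; rewrite normrM; apply: ler_pM.
apply: normB_le cb; apply: normD_le r2; apply: normD_le r1.
by rewrite mulr_natl mulr2n; apply: normB_le; [exact: vk'|exact: vk].
Qed.

Lemma wcoef_le (x : 'I_(n.*2.+1)) : `|wcoef R x| <= n%:R.
Proof.
have xn : (x <= n + n)%N by rewrite addnn -ltnS.
have x2 : x%:R <= n%:R + n%:R :> R by rewrite -natrD ler_nat.
have x0 : 0 <= x%:R :> R by [].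
by rewrite /wcoef ler_norml; apply/andP; split; lra.
Qed.

(** One point [p f] of each support is moved, in all [d] coordinates. By disjointness it is the only
    moved point in its combination, with a nonzero integer weight, so the translation is determined
    without any code. *)
Lemma coincidence_prob (kappa step : R) (m g T : nat) (W : {ffun 'I_g -> weights n}) :
  (forall f f', f != f' -> [disjoint wsupp (W f) & wsupp (W f')]) ->
  (forall f, 0 < #|wsupp (W f)|)%N -> 0 <= step -> step * T%:R <= th ->
  2 * kappa + n%:R * (e *+ 2) *+ n < step ->
  ((T ^ (g * d))%:R%:E * hull_prob (coincidence_family kappa m W) <= (expR 1)%:E)%E.
Proof.
move=> dis supp step0 stepT stepL.
pose p f : 'I_n := projT1 (cid (card_gt0P (supp f))).
have pP f : p f \in wsupp (W f) := projT2 (cid (card_gt0P (supp f))).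
have p_other f f' : f != f' -> p f' \notin wsupp (W f).
  move=> ff; apply/negP => h; have /pred0P/(_ (p f')) := dis _ _ ff.
  by rewrite /= h pP.
have p_inj f f' : p f = p f' -> f = f'.
  by move=> E; apply/eqP; apply: contraT => /p_other; rewrite -E pP.
pose S : finType := {ffun 'I_g * 'I_d -> 'I_T}.
pose tau (t : S) i j : R := if [pick f | p f == i] is Some f then step * (t (f, j))%:R else 0.
have cardS : #|S| = (T ^ (g * d))%N by rewrite card_ffun card_prod !card_ord.
rewrite -cardS -[X in (_ <= (X)%:E)%E]mulr1 -[X in (_ <= (_ * X)%:E)%E]/(1%:R) -card_unit.
apply: (points_packing s0 Y0 e0 es mu01 YD ths thN (tau := tau) (code := fun _ _ => tt)).
  move=> t i j; rewrite /tau; case: pickP => [f _|_]; last first.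
    rewrite normr0; apply: le_trans stepT; exact: mulr_ge0.
  by rewrite ger0_norm ?mulr_ge0//; exact: step_le.
move=> X X' t t' [_ XW] [_ XW'] XD XD' near _.
apply/ffunP => -[f j]; apply/val_inj.
set c := wcoef R (W f (p f)).
have c1 : 1 <= `|c| by apply: wcoef_ge1; exact: pP.
pose rem i := (X i ord0 j - X' i ord0 j) + (tau t i j - tau t' i j).
have idn : c * (step * ((t (f, j))%:R - (t' (f, j))%:R)) =
   \sum_i wcoef R (W f i) * X' i ord0 j - \sum_i wcoef R (W f i) * X i ord0 j
   + \sum_i wcoef R (W f i) * rem i.
  have h1 : \sum_i wcoef R (W f i) * (tau t i j - tau t' i j) =
     c * (step * ((t (f, j))%:R - (t' (f, j))%:R)).
    rewrite (bigD1 (p f))//= big1 => [|i ip].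
      rewrite addr0 /tau; case: pickP => [f' /eqP/p_inj ->|/(_ f)]; last by rewrite eqxx.
      by rewrite -mulrBr.
    have [iW|/wcoef_eq0 ->] := boolP (i \in wsupp (W f)); last by rewrite mul0r.
    rewrite /tau; case: pickP => [f' /eqP E|_]; last by rewrite subrr mulr0.
    have ff : f != f' by apply/eqP => ff; move: ip; rewrite -E ff eqxx.
    by move: iW; rewrite -E (negPf (p_other _ _ ff)).
  rewrite -h1 /rem.
  under [X in _ = _ + X]eq_bigr do rewrite mulrDr mulrBr.
  rewrite big_split /= sumrB; ring.
apply: (nat_gap _ stepL) => /=.
apply: (@le_trans _ _ `|c * (step * ((t (f, j))%:R - (t' (f, j))%:R))|).
  by rewrite [X in _ <= X]normrM ler_peMl.
rewrite idn.
have r1 : `|\sum_i wcoef R (W f i) * rem i| <= n%:R * (e *+ 2) *+ n.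
  apply: ler_sum_const => i; rewrite normrM; apply: ler_pM => //; first exact: wcoef_le.
  exact: near.
have [_ /(_ j) h] := XW f; have [_ /(_ j) h'] := XW' f.
apply: normD_le r1; rewrite mulr_natl mulr2n; exact: normB_le.
Qed.

End event_probability.

Section blueprint_probability.
Variables (R : realType) (n k d : nat) (s : R) (mu : 'I_n -> 'rV[R]_d) (Y D th e : R).
Hypotheses (s0 : 0 < s) (Y0 : 0 <= Y) (e0 : 0 < e) (es : e <= s).
Hypothesis mu01 : forall i j, 0 <= mu i ord0 j <= 1.
Hypothesis YD : 1 + Y * s <= D.
Hypotheses (ths : th <= s) (thN : th * (Y + 2) *+ (n * d) <= s).

Local Notation hull_prob Ev := (gauss_prob s (hull e (box_event s mu Y Ev))).

Lemma ler_sum_set (A : {set 'I_n}) (F : 'I_n -> R) (c : R) :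
  (forall i, `|F i| <= c) -> `|\sum_(i in A) F i| <= c *+ n.
Proof.
move=> h; rewrite big_mkcond; apply: ler_sum_const => i.
case: ifP => // _; rewrite normr0; exact: le_trans (h i).
Qed.

Lemma bdir_bound (b : blueprint n k d) j : 0 <= bdir R b j <= n%:R *+ n.
Proof.
have t0 i : 0 <= (if b i is Some x then (if ecoord x == j then (eweight x)%:R else 0) else 0 : R).
  by case: (b i) => // x; case: ifP.
apply/andP; split; first by apply: sumr_ge0 => i _; exact: t0.
apply: le_trans (ler_norm _) _; apply: ler_sum_const => i.
rewrite ger0_norm//; case: (b i) => // x; case: ifP => // _.
by rewrite ler_nat -ltnS.
Qed.

(** The translations move well-separated points along the direction of the blueprint.
    Among the translations that fix the equations of the low clusters and the rounded
    centers of the others, two distinct ones move some point across its bisector. *)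
Lemma blueprint_prob (epsF eta epsW epsz delta step : R) (b : blueprint n k d) (T G : nat) :
  0 <= eta -> 0 <= step -> step * (T%:R * (n%:R *+ n)) <= th -> 0 < epsz -> 2 * D < epsz * G.+1%:R ->
  epsz <= delta -> epsW + epsW + (e *+ 2 *+ n + e *+ 2 *+ n) <= delta ->
  epsF + epsF + 2 * ((D + D) * (e *+ 2) *+ d) + 2 * ((delta + delta) * D *+ d) +
    (delta * (D + D) + delta * (D + D)) *+ d < step * eta ->
  ((T ^ n)%:R%:E * hull_prob (blueprint_event D epsF eta epsW b) <=
   (expR 1 * ((n * T + n * T).+1 ^ #|blow b| * G.+1 ^ (#|bnet b| * d) *
              T ^ (n - #|bgood b|))%:R)%:E)%E.
Proof.
move=> eta0 step0 stepT ez0 Gz dz dW stepL.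
have D0 : 0 <= D := D_ge0 s0 Y0 YD.
pose S : finType := {ffun 'I_n -> 'I_T}.
pose C : finType := ({ffun {l | l \in blow b} -> 'I_(n * T + n * T).+1} *
  {ffun {l | l \in bnet b} * 'I_d -> 'I_G.+1} * {ffun {i | i \notin bgood b} -> 'I_T})%type.
pose tau (t : S) i j : R := if i \in bgood b then step * ((t i)%:R * bdir R b j) else 0.
pose wit (X : 'I_n -> 'rV[R]_d) : 'I_k -> 'rV[R]_d :=
  if pselect (blueprint_event D epsF eta epsW b X) is left H then projT1 (cid H) else (fun=> 0).
have witP X : blueprint_event D epsF eta epsW b X ->
  [/\ forall l j, l \in bactive b -> `|wit X l ord0 j| <= D,
      forall i x, b i = Some x ->
        `|sqdist (X i) (wit X (esrc x)) - sqdist (X i) (wit X (edst x))| <= epsF,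
      forall i x, b i = Some x -> egood x ->
        eta / 2 <= `|\sum_j bdir R b j * (wit X (esrc x) ord0 j - wit X (edst x) ord0 j)| &
      forall l j, `|wit X l ord0 j * (#|bin b l|%:R - #|bout b l|%:R) -
        (\sum_(i in bin b l) X i ord0 j - \sum_(i in bout b l) X i ord0 j)| <= epsW].
  move=> H; rewrite /wit; case: pselect => // H'; exact: (projT2 (cid H')).
(* The signed sum of [t] over entering minus leaving points, shifted by [T] per leaving point to be
   a natural number. *)
pose low (t : S) l := (\sum_(i in bin b l) t i + \sum_(i in bout b l) (T - t i))%N.
have low_lt t l : (low t l < (n * T + n * T).+1)%N.
  have card_le (A : {set 'I_n}) (F : 'I_n -> nat) : (forall i, (F i <= T)%N) ->
      (\sum_(i in A) F i <= n * T)%N.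
    move=> hF; apply: (@leq_trans (\sum_(i in A) T)); first by apply: leq_sum => i _; exact: hF.
    by rewrite sum_nat_const leq_mul2r -[X in (_ <= X)%N](card_ord n) max_card orbT.
  rewrite ltnS; apply: leq_add; apply: card_le => i; [exact: ltnW|exact: leq_subr].
pose code X (t : S) : C := ([ffun l => inord (low t (val l))],
  [ffun lj => round_code D epsz G (wit X (val lj.1) ord0 lj.2)], [ffun i => t (val i)]).
have cardS : #|S| = (T ^ n)%N by rewrite card_ffun !card_ord.
have cardC' : #|C| = ((n * T + n * T).+1 ^ #|blow b| * G.+1 ^ (#|bnet b| * d) *
              T ^ (n - #|bgood b|))%N.
  rewrite !card_prod !card_ffun !card_prod !card_ord !card_sig; congr (_ * _ * _ ^ _)%N.
  by rewrite -[X in (X - _)%N](card_ord n) -(cardC (mem (bgood b))) addKn; apply: eq_card => i.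
rewrite -cardS -cardC'.
apply: (points_packing s0 Y0 e0 es mu01 YD ths thN (tau := tau) (code := code)).
  move=> t i j; have /andP[w0 wn] := bdir_bound b j.
  rewrite /tau; case: ifP => _; last first.
    by rewrite normr0; apply: le_trans stepT; apply: mulr_ge0.
  rewrite ger0_norm; last by rewrite mulr_ge0// mulr_ge0.
  apply: le_trans stepT; apply: ler_wpM2l => //; apply: ler_pM => //.
  by rewrite ler_nat ltnW.
move=> X X' t t' /witP[zD zF zG zW] /witP[zD' zF' zG' zW'] XD XD' near [clow cnet cbad].
pose z := wit X; pose z' := wit X'.
pose rem i j := (X i ord0 j - X' i ord0 j) + (tau t i j - tau t' i j).
have zdiff l j : l \in bactive b -> `|z l ord0 j - z' l ord0 j| <= delta.
  move=> act; have [lo|nlo] := boolP (l \in blow b); last first.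
    have ln : l \in bnet b by rewrite finset.in_setD nlo.
    apply: le_trans dz; move/ffunP/(_ (exist _ l ln, j)): cnet; rewrite !ffunE /= => cn.
    by apply: (round_codeP ez0 Gz _ _ cn); [exact: zD|exact: zD'].
  move/ffunP/(_ (exist _ l lo)): clow; rewrite !ffunE /= => /(congr1 val).
  rewrite /= !inordK// => lowE.
  move: (lo); rewrite inE => /andP[_ /and3P[qne _ /fintype.subsetP good]].
  set q : R := #|bin b l|%:R - #|bout b l|%:R.
  have q1 : 1 <= `|q|.
    rewrite /q; case: (ltngtP #|bin b l| #|bout b l|) qne => // l1 _.
      by rewrite distrC ler_normr -natrB ?(ltnW l1)// ler1n subn_gt0 l1.
    by rewrite ler_normr -natrB ?(ltnW l1)// ler1n subn_gt0 l1.
  have lowR (t0 : S) : (low t0 l)%:R =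
      \sum_(i in bin b l) (t0 i)%:R - \sum_(i in bout b l) (t0 i)%:R + T%:R *+ #|bout b l| :> R.
    rewrite /low natrD !natr_sum -addrA; congr (_ + _).
    rewrite -sumr_const -sumrN -big_split /=; apply: eq_bigr => i _.
    by rewrite natrB ?(ltnW (ltn_ord _))// addrC.
  have dT : \sum_(i in bin b l) ((t i)%:R - (t' i)%:R) - \sum_(i in bout b l) ((t i)%:R - (t' i)%:R) = 0 :> R.
    have E0 : (low t l)%:R = (low t' l)%:R :> R by rewrite lowE.
    move: E0; rewrite !lowR => /addIr E0; rewrite !sumrB.
    by rewrite opprD addrACA -opprD E0 subrr.
  (* All these points move along [bdir], so equality of one integer cancels the translations in the
     center equation in every coordinate [j] at once. *)
  have tauE : \sum_(i in bin b l) (tau t i j - tau t' i j) - \sum_(i in bout b l) (tau t i j - tau t' i j) = 0.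
    have E (A : {set 'I_n}) : A \subset bgood b -> \sum_(i in A) (tau t i j - tau t' i j) =
        step * bdir R b j * \sum_(i in A) ((t i)%:R - (t' i)%:R).
      move=> /fintype.subsetP Ag; rewrite mulr_sumr; apply: eq_bigr => i iA.
      by rewrite /tau Ag//; ring.
    rewrite !E; last 2 first.
    - by apply/fintype.subsetP => i h; apply: good; rewrite finset.in_setU h ?orbT.
    - by apply/fintype.subsetP => i h; apply: good; rewrite finset.in_setU h ?orbT.
    by rewrite -mulrBr dT mulr0.
  apply: (@le_trans _ _ `|(z l ord0 j - z' l ord0 j) * q|).
    by rewrite normrM ler_peMr.
  apply: le_trans dW.
  have -> : (z l ord0 j - z' l ord0 j) * q =
     (z l ord0 j * q - (\sum_(i in bin b l) X i ord0 j - \sum_(i in bout b l) X i ord0 j))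
     - (z' l ord0 j * q - (\sum_(i in bin b l) X' i ord0 j - \sum_(i in bout b l) X' i ord0 j))
     + (\sum_(i in bin b l) rem i j - \sum_(i in bout b l) rem i j).
    have -> : \sum_(i in bin b l) rem i j - \sum_(i in bout b l) rem i j =
      (\sum_(i in bin b l) (X i ord0 j - X' i ord0 j) - \sum_(i in bout b l) (X i ord0 j - X' i ord0 j)) +
      (\sum_(i in bin b l) (tau t i j - tau t' i j) - \sum_(i in bout b l) (tau t i j - tau t' i j)).
      by rewrite /rem !big_split /=; ring.
    rewrite tauE addr0 !sumrB; ring.
  apply: normD_le; first by apply: normB_le; [exact: zW|exact: zW'].
  by apply: normB_le; apply: ler_sum_set => i; exact: near.
apply/ffunP => i; have [ig|ig] := boolP (i \in bgood b); last first.
  by move/ffunP/(_ (exist _ i ig)): cbad; rewrite !ffunE.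
have [x bi gx] : exists2 x, b i = Some x & egood x.
  by move: ig; rewrite inE /bpred; case: (b i) => // x gx; exists x.
have actP l : (l == esrc x) || (l == edst x) -> l \in bactive b.
  move=> h; rewrite inE /bdeg addn_gt0; apply/orP; case/orP: h => /eqP ->; [left|right];
    by apply/card_gt0P; exists i; rewrite inE /bpred bi eqxx.
have acts : esrc x \in bactive b by apply: actP; rewrite eqxx.
have actd : edst x \in bactive b by apply: actP; rewrite eqxx orbT.
pose p := esrc x; pose q := edst x.
pose P := \sum_j (z q ord0 j - z p ord0 j) * bdir R b j.
have Peta : eta <= `|2 * P|.
  have := zG i x bi gx; rewrite normrM ger0_norm// -/z -/p -/q.
  have -> : \sum_j bdir R b j * (z p ord0 j - z q ord0 j) = - P.
    by rewrite /P -sumrN; apply: eq_bigr => j _; ring.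
  by rewrite normrN ler_pdivrMr// mulrC.
pose Q j := (z q ord0 j ^+ 2 - z p ord0 j ^+ 2) - (z' q ord0 j ^+ 2 - z' p ord0 j ^+ 2).
pose dd j := (z q ord0 j - z p ord0 j) - (z' q ord0 j - z' p ord0 j).
(* The difference of squared distances to two fixed centers is affine in the point; the translation
   enters with factor [2 * P], and all other terms are errors. *)
have idn : 2 * P * (step * ((t i)%:R - (t' i)%:R)) =
   (sqdist (X' i) (z' p) - sqdist (X' i) (z' q)) - (sqdist (X i) (z p) - sqdist (X i) (z q))
   + 2 * (\sum_j (z q ord0 j - z p ord0 j) * rem i j) + 2 * (\sum_j dd j * X' i ord0 j)
   - \sum_j Q j.
  have h1 : \sum_j (z q ord0 j - z p ord0 j) * (tau t i j - tau t' i j) =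
     P * (step * ((t i)%:R - (t' i)%:R)).
    by rewrite /P mulr_suml; apply: eq_bigr => j _; rewrite /tau ig; ring.
  have -> : \sum_j (z q ord0 j - z p ord0 j) * rem i j =
     \sum_j (z q ord0 j - z p ord0 j) * X i ord0 j - \sum_j (z q ord0 j - z p ord0 j) * X' i ord0 j
     + \sum_j (z q ord0 j - z p ord0 j) * (tau t i j - tau t' i j).
    by rewrite -sumrB -big_split /=; apply: eq_bigr => j _; rewrite /rem; ring.
  have -> : \sum_j dd j * X' i ord0 j =
     \sum_j (z q ord0 j - z p ord0 j) * X' i ord0 j - \sum_j (z' q ord0 j - z' p ord0 j) * X' i ord0 j.
    by rewrite -sumrB; apply: eq_bigr => j _; rewrite /dd; ring.
  have -> : \sum_j Q j = \sum_j (z q ord0 j ^+ 2 - z p ord0 j ^+ 2) -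
      \sum_j (z' q ord0 j ^+ 2 - z' p ord0 j ^+ 2) by rewrite -sumrB.
  rewrite h1 !sqdistB; ring.
apply/val_inj; apply: (nat_gap (a := step * eta) _ stepL) => /=.
apply: (@le_trans _ _ `|2 * P * (step * ((t i)%:R - (t' i)%:R))|).
  have -> : step * eta * ((t i)%:R - (t' i)%:R) = eta * (step * ((t i)%:R - (t' i)%:R)) by ring.
  rewrite normrM [X in _ <= X]normrM; apply: ler_wpM2r; first exact: normr_ge0.
  by rewrite ger0_norm.
rewrite idn.
have r1 : `|\sum_j (z q ord0 j - z p ord0 j) * rem i j| <= (D + D) * (e *+ 2) *+ d.
  apply: ler_sum_const => j; rewrite normrM; apply: ler_pM => //; last exact: near.
  by apply: normB_le; exact: zD.
have r2 : `|\sum_j dd j * X' i ord0 j| <= (delta + delta) * D *+ d.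
  apply: ler_sum_const => j; rewrite normrM; apply: ler_pM => //.
  rewrite (_ : dd j = (z q ord0 j - z' q ord0 j) - (z p ord0 j - z' p ord0 j)); last by rewrite /dd; ring.
  by apply: normB_le; exact: zdiff.
have r3 : `|\sum_j Q j| <= (delta * (D + D) + delta * (D + D)) *+ d.
  apply: ler_sum_const => j.
  rewrite (_ : Q j = (z q ord0 j - z' q ord0 j) * (z q ord0 j + z' q ord0 j) -
     (z p ord0 j - z' p ord0 j) * (z p ord0 j + z' p ord0 j)); last by rewrite /Q; ring.
  apply: normB_le; rewrite normrM; apply: ler_pM => //; try exact: zdiff.
    by apply: normD_le; [exact: zD|exact: zD'].
  by apply: normD_le; [exact: zD|exact: zD'].
have n2 (y c : R) : `|y| <= c -> `|2 * y| <= 2 * c by move=> h; rewrite normrM ger0_norm// ler_wpM2l.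
apply: normB_le r3; apply: normD_le (n2 _ _ r2); apply: normD_le (n2 _ _ r1).
by apply: normB_le; [exact: zF'|exact: zF].
Qed.

End blueprint_probability.

(** * Counting sets, weights and blueprints *)

Section counting.
Variable n : nat.
Hypothesis n0 : (0 < n)%N.

Lemma card_sets_le m : (#|[set A : {set 'I_n} | #|A| == m]%SET| <= (n * 2) ^ m)%N.
Proof.
pose f (A : {set 'I_n}) : {ffun 'I_n -> bool} := [ffun i => i \in A].
have f_inj : injective f by move=> A A' /ffunP E; apply/setP => i; have := E i; rewrite !ffunE.
rewrite -(card_imset _ f_inj) -card_bool; apply: leq_trans (card_hamming_ball [ffun=> false] m n0).
apply/subset_leq_card/fintype.subsetP => x /imsetP[A]; rewrite inE => /eqP Am {x}->; rewrite inE.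
rewrite /hamming -Am; apply: subset_leq_card; apply/fintype.subsetP => i.
by rewrite !inE !ffunE; case: (i \in A).
Qed.

Lemma card_weights_le m :
  (#|[set w : weights n | #|wsupp w| <= m]%SET| <= (n * n.*2.+1) ^ m)%N.
Proof.
rewrite -[X in (n * X)%N](card_ord n.*2.+1).
have nlt : (n < n.*2.+1)%N by rewrite ltnS -addnn leq_addr.
apply: leq_trans (card_hamming_ball [ffun=> Ordinal nlt] m n0).
apply/subset_leq_card/fintype.subsetP => w; rewrite !inE => /(leq_trans _); apply.
apply/subset_leq_card/fintype.subsetP => i; rewrite !inE !ffunE.
by apply: contra => /eqP wi; apply/eqP/val_inj.
Qed.

Lemma card_families_le g m : (#|[set W : {ffun 'I_g -> weights n} |
    [forall f, (#|wsupp (W f)| <= m)%N]]%SET| <= (n * n.*2.+1) ^ (m * g))%N.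
Proof.
pose V := [set w : weights n | (#|wsupp w| <= m)%N]%SET.
apply: (@leq_trans #|[set W : {ffun 'I_g -> weights n} | W \in ffun_on (mem V)]%SET|).
  apply/subset_leq_card/fintype.subsetP => W; rewrite inE => /forallP h.
  by rewrite inE; apply/ffun_onP => f; rewrite inE.
rewrite cardsE card_ffun_on card_ord expnM.
by case: g => [|g']; rewrite ?expn0 // leq_exp2r //; exact: card_weights_le.
Qed.

End counting.

Section counting_blueprints.
Variables (n k d : nat).
Hypothesis n0 : (0 < n)%N.

Lemma card_blueprints_le m : (#|[set b : blueprint n k d | #|bedges b| == m]%SET| <=
  (n * (k * k * d * n.+1 * 2).+1) ^ m)%N.
Proof.
have -> : ((k * k * d * n.+1 * 2).+1 = #|{: option (edge n k d)}|)%N.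
  by rewrite card_option /edge !card_prod !card_ord card_bool.
apply: leq_trans (card_hamming_ball [ffun=> None] m n0).
apply/subset_leq_card/fintype.subsetP => b; rewrite !inE => /eqP <-.
rewrite /hamming; apply/subset_leq_card/fintype.subsetP => i; rewrite !inE ffunE.
by case: (b i).
Qed.

End counting_blueprints.

(** * The scales as powers of [b] *)

Section power_bounds.
Variables (R : realType) (b : nat).
Hypotheses (b1 : (0 < b)%N) (eb : expR 1 <= b%:R :> R).
Local Notation B := (b%:R : R).

Lemma prob_le_pow (P : \bar R) (c N y : nat) :
  (c%:R%:E * P <= (expR 1 * N%:R)%:E)%E -> (0 < c)%N -> (b * N * b ^ y <= c)%N ->
  (P <= (B ^- y)%:E)%E.
Proof.
move=> h c0 hc; have c0' : (0 < c%:R%:E :> \bar R)%E by rewrite lte_fin ltr0n.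
rewrite -(lee_pmul2l _ c0')//; apply: le_trans h _.
rewrite -EFinM lee_fin; apply: (@le_trans _ _ (B * N%:R)); first by rewrite ler_wpM2r.
rewrite ler_pdivlMr ?exprn_gt0 ?ltr0n//.
by rewrite -natrX -!natrM ler_nat.
Qed.

Lemma sum_prob_le_pow (I : finType) (Q : pred I) (F : I -> \bar R) (y z : nat) :
  (forall i, Q i -> (F i <= (B ^- (y + z))%:E)%E) -> (#|Q| <= b ^ z)%N ->
  (\sum_(i | Q i) F i <= (B ^- y)%:E)%E.
Proof.
move=> hF hQ; apply: le_trans (lee_sum _ hF) _.
rewrite sumr_const.
have -> m (x : R) : (x%:E *+ m)%R = (m%:R * x)%:E by rewrite EFinM mule_natl.
have Bp m : 0 < B ^+ m by rewrite exprn_gt0// ltr0n.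
by rewrite lee_fin ler_pdivrMr// exprD mulKf ?gt_eqF// -natrX ler_nat.
Qed.

End power_bounds.

Section bad_event_probability.
Variables (R : realType) (n k d b E g r C1 C2 : nat) (s Y : R) (mu : 'I_n -> 'rV[R]_d).
Local Notation B := (b%:R : R).
Hypotheses (n0 : (0 < n)%N) (d0 : (0 < d)%N) (kn : (k <= n)%N) (dn : (d <= n)%N).
Hypotheses (nb : (n < b)%N) (b64 : (64 <= b)%N) (eb : expR 1 <= B) (E220 : (220 <= E)%N).
Hypotheses (s0 : 0 < s) (Y0 : 0 <= Y) (YB : Y + 2 <= B ^+ 2) (YD : 1 + Y * s <= s * B ^+ 2).
Hypothesis mu01 : forall i j, 0 <= mu i ord0 j <= 1.
Hypothesis gd : (6 <= g * d)%N.
Hypothesis hr : (2 * (10 * C1 + 3 * C2 + 17) <= r)%N.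

Variables eta rho : R.
Hypotheses (etaE : eta * B ^+ E = s) (rhoE : rho * B ^+ (2 * E) = s).
Local Notation kappa := (eta * B ^+ 3).
Local Notation D := (s * B ^+ 2).
Local Notation th := (s / B ^+ 4).

Lemma b_gt0 : (0 < b)%N. Proof. exact: leq_trans b64. Qed.
Lemma B_gt0 : 0 < B. Proof. by rewrite ltr0n b_gt0. Qed.
Lemma B64 : 64 <= B. Proof. by rewrite (ler_nat R 64). Qed.
Lemma Bexp_gt0 m : 0 < B ^+ m. Proof. by rewrite exprn_gt0// B_gt0. Qed.
Lemma Bexp_le m m' : (m <= m')%N -> B ^+ m <= B ^+ m'.
Proof. by move=> h; rewrite ler_weXn2l// (le_trans _ B64)// ler1n. Qed.
Lemma Bexp_ge1 m : 1 <= B ^+ m.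
Proof. by rewrite exprn_ege1// ler1n b_gt0. Qed.
Lemma nB : n%:R <= B. Proof. by rewrite ler_nat ltnW. Qed.
Lemma dB : d%:R <= B. Proof. by rewrite ler_nat (leq_trans dn)// ltnW. Qed.

Lemma eta_gt0 : 0 < eta. Proof. by rewrite -(pmulr_lgt0 _ (Bexp_gt0 E)) etaE. Qed.
Lemma rho_gt0 : 0 < rho. Proof. by rewrite -(pmulr_lgt0 _ (Bexp_gt0 (2 * E))) rhoE. Qed.
Lemma rho_s : rho * s = eta ^+ 2.
Proof.
apply: (mulIf (lt0r_neq0 (Bexp_gt0 (2 * E)))); rewrite mulrAC rhoE.
by rewrite [(2 * E)%N]mulnC exprM -exprMn etaE.
Qed.
Lemma rho_eta : rho <= eta.
Proof.
rewrite -(ler_pM2r (Bexp_gt0 E)) etaE -rhoE ler_pM2l ?rho_gt0//.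
by rewrite Bexp_le// leq_pmull.
Qed.
Lemma eta_s : eta <= s.
Proof. by rewrite -etaE ler_peMr ?Bexp_ge1// ltW// eta_gt0. Qed.
Lemma rho_le_s : rho <= s. Proof. exact: le_trans rho_eta eta_s. Qed.
Lemma th_s : th <= s.
Proof. by rewrite ler_pdivrMr ?Bexp_gt0// ler_peMr ?Bexp_ge1// ltW. Qed.

Lemma thN : th * (Y + 2) *+ (n * d) <= s.
Proof.
have h : th * (Y + 2) <= th * B ^+ 2 by rewrite ler_wpM2l// divr_ge0 ?ltW// Bexp_gt0.
apply: (@le_trans _ _ (th * B ^+ 2 * B ^+ 2)); last first.
  by rewrite -mulrA -exprD divfK// gt_eqF// Bexp_gt0.
rewrite -mulr_natr natrM; apply: ler_pM => //.
- by rewrite mulr_ge0// ?addr_ge0// divr_ge0// ltW// Bexp_gt0.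
- by rewrite expr2; apply: ler_pM => //; [exact: nB|exact: dB].
Qed.

Local Notation hull_prob Ev := (gauss_prob s (hull rho (box_event s mu Y Ev))).

Lemma hull_prob_union (I : finType) (Q : pred I) (Ev : ('I_n -> 'rV[R]_d) -> Prop)
    (evs : I -> ('I_n -> 'rV[R]_d) -> Prop) :
  (forall X, Ev X -> exists2 i, Q i & evs i X) ->
  (hull_prob Ev <= \sum_(i | Q i) hull_prob (evs i))%E.
Proof.
move=> h; apply: gauss_prob_bigcup.
- exact: measurable_hull rho_gt0.
- by move=> i; exact: measurable_hull rho_gt0.
by move=> x [y [yY /h[i Qi ei]] xy]; exists i => //; exists y.
Qed.

Lemma pow_leq (x y : nat) : (x <= y)%N -> (b ^ x <= b ^ y)%N.
Proof. by move=> xy; rewrite leq_pexp2l// b_gt0. Qed.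

Lemma natrB_pow m : (b ^ m)%:R = B ^+ m :> R. Proof. by rewrite natrX. Qed.

Lemma step_th (x y : nat) : (x + y + 4 <= E)%N -> eta * B ^+ x * B ^+ y <= th.
Proof.
move=> h; rewrite ler_pdivlMr ?Bexp_gt0// -!mulrA -!exprD.
apply: (@le_trans _ _ (eta * B ^+ E)); last by rewrite etaE.
by rewrite ler_pM2l ?eta_gt0// Bexp_le// addnA.
Qed.

Lemma mulrn_le (x x' c : R) m : 0 <= x -> x <= x' -> m%:R <= c -> x *+ m <= x' * c.
Proof. by move=> x0 xx h; rewrite -mulr_natr; apply: ler_pM. Qed.

Lemma lt_Bexp (x : R) m (c : R) : 0 < x -> c < 64 -> c * (x * B ^+ m) < x * B ^+ m.+1.
Proof.
move=> x0 c64; rewrite exprS [x * (B * _)]mulrCA ltr_pM2r ?mulr_gt0 ?Bexp_gt0//.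
exact: lt_le_trans B64.
Qed.

Lemma Dd_le : D *+ d <= s * B ^+ 3.
Proof.
rewrite [_ ^+ 3]exprSr mulrA; apply: mulrn_le => //; last exact: dB.
by rewrite mulr_ge0 ?ltW ?Bexp_gt0.
Qed.

Lemma rho2_le m : (m <= b)%N -> rho *+ 2 *+ m <= eta * B ^+ 3.
Proof.
move=> mb; rewrite [_ ^+ 3]exprSr mulrA; apply: mulrn_le; rewrite ?ler_nat//.
  by rewrite mulrn_wge0// ltW// rho_gt0.
apply: mulrn_le; [exact: ltW rho_gt0|exact: rho_eta|].
apply: (@le_trans _ _ 64); first by rewrite ler_nat.
by apply: le_trans B64 _; rewrite ler_eXnr// ler1n b_gt0.
Qed.

Lemma leq_pow_base (x y m : nat) : (x <= y)%N -> (x ^ m <= y ^ m)%N.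
Proof. by case: m => // m xy; rewrite leq_exp2r. Qed.

(** The tight case is [d = 1]: nine conditions give about [b^(9E)], against [b^(2E)] for the rounded
    hyperplane and the required [b^(5E)]. The step [eta * B ^+ 4] taken [b ^ (E - 8)] times adds up
    to [th]. *)
Lemma prob_slab :
  (hull_prob (fun X => exists (A : {set 'I_n}) j, #|A| = (9 * d)%N /\ slab_event kappa A j X)
    <= (B ^- (5 * E).+1)%:E)%E.
Proof.
have := @hull_prob_union _ (fun Aj : {set 'I_n} * 'I_d => #|Aj.1| == (9 * d)%N)
  (fun X => exists (A : {set 'I_n}) j, #|A| = (9 * d)%N /\ slab_event kappa A j X)
  (fun Aj => slab_event kappa Aj.1 Aj.2).
move=> /(_ _)/le_trans; apply.
  by move=> X [A [j [cA h]]]; exists (A, j) => //=; apply/eqP.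
apply: (sum_prob_le_pow b_gt0 (z := (2 * (9 * d)).+1)).
  move=> [A j] /= /eqP cA.
  have H := @slab_prob R n d s mu Y D th rho s0 Y0 rho_gt0 rho_le_s mu01 YD th_s thN
    kappa (eta * B ^+ 4) (1 / B ^+ E) (eta * B ^+ 3) A j (b ^ (E - 8)) (b ^ (E.+1)).-1.
  have {}H : (((b ^ (E - 8)) ^ n)%:R%:E * hull_prob (slab_event kappa A j) <=
    (expR 1 * ((b ^ E.+1) ^ d.+1 * (b ^ (E - 8)) ^ (n - #|A|))%:R)%:E)%E.
    have bE : (b ^ E.+1).-1.+1 = (b ^ E.+1)%N by rewrite prednK// expn_gt0 b_gt0.
    rewrite bE in H; apply: H.
    - by rewrite cA muln_gt0 d0.
    - by rewrite mulr_ge0 ?ltW ?eta_gt0 ?Bexp_gt0.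
    - by rewrite natrB_pow; apply: step_th; move: E220; lia.
    - by rewrite divr_gt0 ?Bexp_gt0.
    - by rewrite mulr_gt0 ?eta_gt0 ?Bexp_gt0.
    - rewrite natrB_pow exprS mul1r mulrCA mulVf ?gt_eqF ?Bexp_gt0// !mulr1.
      by apply: lt_le_trans B64; rewrite ltr_nat.
    - rewrite natrB_pow [B ^+ E.+1]exprSr mulrACA etaE -exprSr.
      apply: le_lt_trans (lt_Bexp (c := 4) 3 s0 _); last by rewrite ltr_nat.
      have := Dd_le; have : kappa <= s * B ^+ 3 by rewrite ler_pM2r ?Bexp_gt0// eta_s.
      by move: kappa (D *+ d) (s * B ^+ 3) => x y z; lra.
    - apply: le_lt_trans (lt_Bexp (c := 5) 3 eta_gt0 _); last by rewrite ltr_nat.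
      have h1 : rho *+ 2 *+ d <= eta * B ^+ 3 by apply: rho2_le; apply: leq_trans dn (ltnW nb).
      have h2 : 1 / B ^+ E * D *+ d <= eta * B ^+ 3.
        have -> : 1 / B ^+ E * D = eta * B ^+ 2.
          by rewrite -[in LHS]etaE mul1r !mulrA [_ * eta]mulrC mulrVK ?unitfE ?gt_eqF ?Bexp_gt0.
        rewrite [_ ^+ 3]exprSr mulrA; apply: mulrn_le => //; last exact: dB.
        by rewrite mulr_ge0 ?ltW ?Bexp_gt0// eta_gt0.
      move: h1 h2; move: (rho *+ 2 *+ d) (1 / _ * D *+ d) (eta * B ^+ 3).
      by move=> x y z; lra.
  apply: (prob_le_pow b_gt0 eb H); first by rewrite !expn_gt0 b_gt0.
  rewrite -!expnM -!expnD -expnS cA -expnD; apply: pow_leq.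
  have dn9 : (9 * d <= n)%N by rewrite -cA -[X in (_ <= X)%N](card_ord n) max_card.
  have -> : ((E - 8) * n = (E - 8) * (9 * d) + (E - 8) * (n - 9 * d))%N by rewrite -mulnDr subnKC.
  move: E220 d0; move: ((E - 8) * (n - _))%N => z; nia.
apply: (@leq_trans #|finset.setX [set A : {set 'I_n} | #|A| == (9 * d)%N]%SET [set: 'I_d]|).
  by apply/subset_leq_card/fintype.subsetP => -[A j]; rewrite !inE /= andbT.
rewrite cardsX cardsT card_ord expnSr expnM.
apply: leq_mul; last by apply: leq_trans dn _; exact: ltnW.
apply: leq_trans (card_sets_le n0 _) _.
apply: leq_pow_base; rewrite -mulnn; apply: leq_mul; first exact: ltnW.
exact: leq_trans b64.
Qed.


Lemma card_family_bound : (n * n.*2.+1 <= b ^ 3)%N.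
Proof.
have -> : (b ^ 3 = b * (b * b))%N by rewrite !expnS expn0 muln1.
by move: nb b64; rewrite -addnn => *; nia.
Qed.

(** The condition on exponents is [(E - 35) * (g * d) >= 5 * E + 2]. It forces more than five
    conditions, hence [gd]; with six of them it requires [E >= 212], which [E220] provides. *)
Lemma prob_coincidence :
  (hull_prob (fun X => exists W : {ffun 'I_g -> weights n}, coincidence_family kappa (9 * d) W X)
    <= (B ^- (5 * E).+1)%:E)%E.
Proof.
pose Q (W : {ffun 'I_g -> weights n}) := [forall f, 0 < #|wsupp (W f)| <= 9 * d]%N &&
  [forall f, forall f', (f != f') ==> [disjoint wsupp (W f) & wsupp (W f')]].
have := @hull_prob_union _ Q
  (fun X => exists W : {ffun 'I_g -> weights n}, coincidence_family kappa (9 * d) W X)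
  (fun W => coincidence_family kappa (9 * d) W).
move=> /(_ _)/le_trans; apply.
  move=> X [W WP]; exists W => //; have [dis co] := WP; apply/andP; split.
    by apply/forallP => f; have [] := co f.
  by apply/forallP => f; apply/forallP => f'; apply/implyP => /dis.
apply: (sum_prob_le_pow b_gt0 (z := 3 * (9 * d * g))).
  move=> W /andP[/forallP Q1 /forallP Q2].
  have H := @coincidence_prob R n d s mu Y D th rho s0 Y0 rho_gt0 rho_le_s mu01 YD th_s thN
    kappa (eta * B ^+ 4) (9 * d) g (b ^ (E - 8)) W.
  have {}H : (((b ^ (E - 8)) ^ (g * d))%:R%:E * hull_prob (coincidence_family kappa (9 * d) W) <=
    (expR 1 * 1%:R)%:E)%E.
    rewrite mulr1; apply: H.
    - by move=> f f' ff; have /forallP/(_ f')/implyP := Q2 f; apply.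
    - by move=> f; case/andP: (Q1 f).
    - by rewrite mulr_ge0 ?ltW ?eta_gt0 ?Bexp_gt0.
    - by rewrite natrB_pow; apply: step_th; move: E220; lia.
    - apply: le_lt_trans (lt_Bexp (c := 3) 3 eta_gt0 _); last by rewrite ltr_nat.
      have : n%:R * (rho *+ 2) *+ n <= eta * B ^+ 3.
        have -> : eta * B ^+ 3 = B * (eta * B) * B by ring.
        have r2 : 0 <= rho *+ 2 by rewrite mulrn_wge0// ltW// rho_gt0.
        apply: mulrn_le; [exact: mulr_ge0| |exact: nB].
        apply: ler_pM => //; first exact: nB.
        apply: mulrn_le; [exact: ltW rho_gt0|exact: rho_eta|].
        by rewrite ler_nat; apply: leq_trans b64.
      by move: (_ *+ n) kappa => x y; lra.
  apply: (prob_le_pow b_gt0 eb H); first by rewrite !expn_gt0 b_gt0.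
  rewrite muln1 -expnM -expnS; apply: pow_leq.
  by move: gd E220; rewrite -[(9 * d * g)%N]mulnA [(d * g)%N]mulnC; move: (g * d)%N => z; nia.
apply: (@leq_trans #|[set W : {ffun 'I_g -> weights n} |
    [forall f, (#|wsupp (W f)| <= 9 * d)%N]]%SET|).
  apply/subset_leq_card/fintype.subsetP => W /andP[/forallP h _]; rewrite !inE.
  by apply/forallP => f; case/andP: (h f).
apply: leq_trans (card_families_le n0 _ _) _.
by rewrite [X in (_ <= X)%N]expnM; apply: leq_pow_base; exact: card_family_bound.
Qed.

(** Here [rho * s = eta ^+ 2] is decisive: the errors add up to [rho * D * (28 * d + 48 * n * d)],
    and the right-hand side equals [rho * D * B ^+ 4]. *)
Lemma blueprint_slack :
  10 * D * rho *+ d + 10 * D * rho *+ d + 2 * ((D + D) * (rho *+ 2) *+ d) +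
    2 * ((rho *+ (6 * n) + rho *+ (6 * n)) * D *+ d) +
    (rho *+ (6 * n) * (D + D) + rho *+ (6 * n) * (D + D)) *+ d < eta * B ^+ 6 * eta.
Proof.
have -> : eta * B ^+ 6 * eta = (rho * D * B ^+ 3) * B by rewrite mulrAC -expr2 -rho_s; ring.
have rD : 0 < rho * D by apply: mulr_gt0 rho_gt0 (mulr_gt0 s0 (Bexp_gt0 2)).
have -> : 10 * D * rho *+ d + 10 * D * rho *+ d + 2 * ((D + D) * (rho *+ 2) *+ d) +
    2 * ((rho *+ (6 * n) + rho *+ (6 * n)) * D *+ d) +
    (rho *+ (6 * n) * (D + D) + rho *+ (6 * n) * (D + D)) *+ d =
    rho * D * (28 * d%:R + 48 * n%:R * d%:R) by ring.
rewrite -[X in _ < X]mulrA ltr_pM2l//.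
have := B64; have := nB; have := dB; have := ler0n R d; have := ler0n R n.
move: B (n%:R : R) (d%:R : R) => x y z y0 z0 zx yx x64.
have h1 : y * z <= x * x by apply: ler_pM.
have h2 : 64 * x <= x * x by apply: ler_wpM2r => //; lra.
have h3 : 64 * (x * x) <= x * (x * x) by apply: ler_wpM2r => //; nra.
have h4 : 64 * (x * (x * x)) <= x ^+ 3 * x.
  have -> : x ^+ 3 * x = x * (x * (x * x)) by ring.
  by apply: ler_wpM2r => //; nra.
rewrite -mulrA; nra.
Qed.

(** The coefficient of [E] gains about [m / 3 - 3 * C1 - C2 - 5]. The choice of [r] keeps at least
    half of [m / 3], which for [E >= 220] also absorbs the terms free of [E]. *)
Lemma blueprint_exponent (m good L N : nat) :
  (r < m)%N -> (m <= good + C2)%N -> (3 * L + 9 * N <= 2 * m + 9 * C1)%N ->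
  (1 + (E - 10) * L + (2 * E + 3) * N + ((5 * E).+1 + 1 + 6 * m) <= (E - 12) * good)%N.
Proof.
move=> rm mg LN.
have [f ->] : exists f, E = (f + 220)%N by exists (E - 220)%N; rewrite subnK.
have -> : (f + 220 - 10 = f + 210)%N by lia.
have -> : (f + 220 - 12 = f + 208)%N by lia.
have h1 : (f * (2 * (10 * C1 + 3 * C2 + 17) + 1) <= f * m)%N.
  by rewrite leq_mul2l; apply/orP; right; move: hr rm; lia.
have h2 : (f * (3 * L + 9 * N) <= f * (2 * m + 9 * C1))%N by rewrite leq_mul2l LN orbT.
have h3 : (f * m <= f * (good + C2))%N by rewrite leq_mul2l mg orbT.
have h0 : (2 * (10 * C1 + 3 * C2 + 17) < m)%N by exact: leq_ltn_trans hr rm.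
by move: h0 h1 h2 h3 LN mg; rewrite !(mulnDr, mulnDl, mulnA); lia.
Qed.

Lemma card_edge_bound : (n * (k * k * d * n.+1 * 2).+1 <= b ^ 6)%N.
Proof.
have -> : (b ^ 6 = b * (b * (b * b * b) * b))%N by rewrite !expnS expn0 muln1 !mulnA.
apply: leq_mul; first exact: ltnW.
have kb : (k < b)%N by exact: leq_ltn_trans kn nb.
have db : (d < b)%N by exact: leq_ltn_trans dn nb.
have h : (k * k * d <= b * b * b)%N by apply: leq_mul; [apply: leq_mul|]; exact: ltnW.
have h2 : (k * k * d * n.+1 <= b * (b * b * b))%N by rewrite mulnC; apply: leq_mul.
have : (1 <= b * (b * b * b))%N by rewrite !muln_gt0 b_gt0.
move: (b * (b * b * b))%N h2 b64 => w h2 b64' w1.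
have : (w * 64 <= w * b)%N by rewrite leq_mul2l b64' orbT.
by lia.
Qed.

Lemma prob_one_blueprint (bp : blueprint n k d) :
  blueprint_adm r C1 C2 bp ->
  (hull_prob (blueprint_event D (10 * D * rho *+ d) eta (rho *+ n) bp)
    <= (B ^- ((5 * E).+1 + 1 + 6 * #|bedges bp|))%:E)%E.
Proof.
case/and3P => rm gm LN.
(* The direction has coordinates up to [n ^ 2], so [b ^ (E - 12)] steps of [eta * B ^+ 6] stay
   within [th]. A net of mesh [rho] in the range [D] needs [b ^ (2 * E + 3)] values. In [6 * n], two
   units come from [epsW] and four from the grid. *)
have H := @blueprint_prob R n k d s mu Y D th rho s0 Y0 rho_gt0 rho_le_s mu01 YD th_s thN
    (10 * D * rho *+ d) eta (rho *+ n) rho (rho *+ (6 * n)) (eta * B ^+ 6) bp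
    (b ^ (E - 12)) (b ^ (2 * E + 3)).-1.
have r0 := rho_gt0.
have {}H : (((b ^ (E - 12)) ^ n)%:R%:E *
  hull_prob (blueprint_event D (10 * D * rho *+ d) eta (rho *+ n) bp) <=
  (expR 1 * ((n * b ^ (E - 12) + n * b ^ (E - 12)).+1 ^ #|blow bp| *
    (b ^ (2 * E + 3)) ^ (#|bnet bp| * d) * (b ^ (E - 12)) ^ (n - #|bgood bp|))%:R)%:E)%E.
  have bE : (b ^ (2 * E + 3)).-1.+1 = (b ^ (2 * E + 3))%N by rewrite prednK// expn_gt0 b_gt0.
  rewrite bE in H; apply: H.
  - exact: ltW eta_gt0.
  - by rewrite mulr_ge0// ltW ?eta_gt0 ?Bexp_gt0.
  - have h : (n%:R : R) *+ n <= B ^+ 2.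
      by rewrite expr2; apply: mulrn_le => //; exact: nB.
    rewrite natrB_pow; apply: (@le_trans _ _ (eta * B ^+ 6 * B ^+ (E - 12 + 2))).
      rewrite exprD; apply: ler_wpM2l; first by rewrite mulr_ge0// ltW ?eta_gt0 ?Bexp_gt0.
      by apply: ler_wpM2l => //; exact: ltW (Bexp_gt0 _).
    by apply: step_th; move: E220; lia.
  - exact: rho_gt0.
  - rewrite natrB_pow (exprD _ (2 * E) 3) [X in _ < X]mulrA rhoE.
    apply: lt_le_trans (lt_Bexp (c := 2) 2 s0 _) _ => //; by rewrite ltr_nat.
  - by rewrite -[X in X <= _]mulr1n ler_pMn2l// muln_gt0.
  - by rewrite le_eqVlt; apply/orP; left; apply/eqP; ring.
  - exact: blueprint_slack.
apply: (prob_le_pow b_gt0 eb H); first by rewrite !expn_gt0 b_gt0.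
set good := #|bgood bp| in H *; set m := #|bedges bp| in rm gm LN *.
have gn : (good <= n)%N by rewrite -[X in (_ <= X)%N](card_ord n) max_card.
have mg : (m <= good + C2)%N.
  rewrite -leq_subLR; apply: leq_trans gm.
  rewrite cardsD; apply: leq_sub2l; exact: subset_leq_card (subsetIr _ _).
have T2 : ((n * b ^ (E - 12) + n * b ^ (E - 12)).+1 <= b ^ (E - 10))%N.
  have -> : (E - 10 = (E - 12).+2)%N by move: E220; lia.
  rewrite !expnS.
  have : (1 <= b ^ (E - 12))%N by rewrite expn_gt0 b_gt0.
  move: (b ^ _)%N => w w1; move: nb b64 => nb' b64'.
  have : (n * w <= b * w)%N by rewrite leq_mul2r ltnW ?orbT.
  have : (64 * (b * w) <= b * (b * w))%N by rewrite leq_mul2r b64' orbT.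
  have : (1 <= b * w)%N by rewrite muln_gt0 b_gt0.
  by lia.
have -> : ((b ^ (E - 12)) ^ n = (b ^ (E - 12)) ^ good * (b ^ (E - 12)) ^ (n - good))%N.
  by rewrite -expnD subnKC.
apply: (@leq_trans (b ^ 1 * ((b ^ (E - 10)) ^ #|blow bp| * (b ^ (2 * E + 3)) ^ (#|bnet bp| * d) *
   (b ^ (E - 12)) ^ (n - good)) * b ^ ((5 * E).+1 + 1 + 6 * m))%N).
  rewrite expn1 leq_mul2r leq_mul2l !leq_mul2r leq_pow_base ?orbT//.
rewrite -!expnM -!expnD; apply: pow_leq.
have := blueprint_exponent rm mg LN.
rewrite [(#|bnet bp| * d)%N]mulnC.
move: ((E - 10) * _)%N ((2 * E + 3) * _)%N ((E - 12) * (n - good))%N ((E - 12) * good)%N => u v w x.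
lia.
Qed.

Definition some_blueprint X : Prop := exists bp : blueprint n k d, blueprint_adm r C1 C2 bp /\
  blueprint_event D (10 * D * rho *+ d) eta (rho *+ n) bp X.

(** The union is split by the number [m] of edges, because the [b ^ (6 * m)] blueprints with [m]
    edges must be matched against a bound that improves with [m]. *)
Lemma prob_blueprint :
  (hull_prob some_blueprint
    <= (B ^- (5 * E).+1)%:E)%E.
Proof.
pose ev (bp : blueprint n k d) := blueprint_event D (10 * D * rho *+ d) eta (rho *+ n) bp.
have := @hull_prob_union 'I_n.+1 xpredT
  some_blueprint
  (fun m X => exists2 bp, blueprint_adm r C1 C2 bp && (#|bedges bp| == m) & ev bp X).
move=> /(_ _)/le_trans; apply.
  move=> X [bp [adm e]].
  have mn : (#|bedges bp| < n.+1)%N by rewrite ltnS -[X in (_ <= X)%N](card_ord n) max_card.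
  by exists (Ordinal mn) => //; exists bp; rewrite //= adm eqxx.
apply: (sum_prob_le_pow b_gt0 (z := 1)); last by rewrite card_ord expn1.
move=> m _.
have := @hull_prob_union _ (fun bp : blueprint n k d => blueprint_adm r C1 C2 bp && (#|bedges bp| == m))
  (fun X => exists2 bp, blueprint_adm r C1 C2 bp && (#|bedges bp| == m) & ev bp X) ev.
move=> /(_ _)/le_trans; apply; first by move=> X [bp adm e]; exists bp.
apply: (sum_prob_le_pow b_gt0 (z := 6 * m)).
  by move=> bp /andP[adm /eqP <-]; exact: prob_one_blueprint.
apply: (@leq_trans #|[set bp : blueprint n k d | #|bedges bp| == m]%SET|).
  by apply/subset_leq_card/fintype.subsetP => bp /andP[_ h]; rewrite inE.
apply: leq_trans (card_blueprints_le _ _ n0 _) _.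
by rewrite expnM; apply: leq_pow_base; exact: card_edge_bound.
Qed.

Lemma prob_bad (Ev : ('I_n -> 'rV[R]_d) -> Prop) :
  (forall X, Ev X ->
    [\/ exists (A : {set 'I_n}) j, #|A| = (9 * d)%N /\ slab_event kappa A j X,
        exists W : {ffun 'I_g -> weights n}, coincidence_family kappa (9 * d) W X |
        some_blueprint X]) ->
  (hull_prob Ev <= (B ^- (5 * E))%:E)%E.
Proof.
move=> h.
pose evs (i : 'I_3) X := match val i with
  | 0 => exists (A : {set 'I_n}) j, #|A| = (9 * d)%N /\ slab_event kappa A j X
  | 1 => exists W : {ffun 'I_g -> weights n}, coincidence_family kappa (9 * d) W X
  | _ => some_blueprint X end.
have := @hull_prob_union _ xpredT Ev evs.
move=> /(_ _)/le_trans; apply.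
  by move=> X /h[H|H|H]; [exists (inord 0)|exists (inord 1)|exists (inord 2)] => //;
    rewrite /evs /= inordK.
apply: (sum_prob_le_pow b_gt0 (z := 1)).
  rewrite addn1 /evs => -[[|[|i]] ilt] _ /=.
  - exact: prob_slab.
  - exact: prob_coincidence.
  - exact: prob_blueprint.
by rewrite card_ord expn1; apply: leq_trans b64.
Qed.

End bad_event_probability.

(** * Long runs are unlikely *)

Section long_runs.
Variables (R : realType) (n k d b g r C1 C2 : nat) (s Y : R) (mu : 'I_n -> 'rV[R]_d).
Local Notation B := (b%:R : R).
Hypotheses (n0 : (0 < n)%N) (d0 : (0 < d)%N) (kn : (k <= n)%N) (dn : (d <= n)%N).
Hypotheses (nb : (n < b)%N) (b64 : (64 <= b)%N) (eb : expR 1 <= B).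
Hypotheses (s0 : 0 < s) (Y0 : 0 <= Y) (YB : Y + 2 <= B ^+ 2) (YD : 1 + Y * s <= s * B ^+ 2).
Hypothesis mu01 : forall i j, 0 <= mu i ord0 j <= 1.
Hypothesis gd : (6 <= g * d)%N.
Hypothesis hr : (2 * (10 * C1 + 3 * C2 + 17) <= r)%N.
Hypothesis hC1 : (4 * d * (g.-1 * (9 * d)) <= C1)%N.
Hypothesis hC2 : (2 * (g.-1 * (9 * d)) * (9 * d) <= C2)%N.
Local Notation D := (s * B ^+ 2).

(** There are [b ^ (4 * E + 7) * L ^ 2] blocks of length [L], and [L] is at most [4 ^ k] times a
    power of [b]; the cube of [L] produces [64 ^ k]. *)
Definition long_run_bound E := (64 ^ k * b ^ (6 * r + 12 + 4 * E))%N.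

Definition long_run E (X : 'I_n -> 'rV[R]_d) : Prop :=
  (forall i j, `|X i ord0 j| <= D) /\
  ((long_run_bound E)%:R%:E < kmeans_worst_iterations k X)%E.

Lemma block_length_le : (block_length n k r <= 4 ^ k * b ^ (2 * r).+1)%N.
Proof.
have h : ((n * k) ^ r <= b ^ (2 * r))%N.
  rewrite expnM; apply: leq_pow_base; rewrite -mulnn.
  by apply: leq_mul; [|apply: leq_trans kn _]; exact: ltnW.
have h1 : (1 <= 4 ^ k * b ^ (2 * r))%N by rewrite muln_gt0 !expn_gt0 (b_gt0 b64).
rewrite /block_length expnSr mulnA.
apply: (@leq_trans (4 ^ k * b ^ (2 * r)).+1); first by rewrite ltnS leq_mul2l h orbT.
by move: h1 b64; move: (4 ^ k * _)%N => x; nia.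
Qed.

Lemma long_run_block E : ((b ^ (4 * E + 7) * block_length n k r ^ 2 * block_length n k r).+1
  < long_run_bound E)%N.
Proof.
set L := block_length n k r; rewrite /long_run_bound.
have L3 : (L ^ 2 * L <= 64 ^ k * b ^ (6 * r + 3))%N.
  have -> : (64 ^ k * b ^ (6 * r + 3) = (4 ^ k * b ^ (2 * r).+1) ^ 3)%N.
    rewrite expnMn -!expnM [(k * 3)%N]mulnC expnM; congr (_ * b ^ _)%N; lia.
  by rewrite -expnSr; apply: leq_pow_base; exact: block_length_le.
have -> : (64 ^ k * b ^ (6 * r + 12 + 4 * E) =
    64 ^ k * b ^ (6 * r + 3) * b ^ (4 * E + 7) * b ^ 2)%N.
  by rewrite -!mulnA -!expnD; congr (_ * b ^ _)%N; lia.
have w1 : (1 <= b ^ (4 * E + 7))%N by rewrite expn_gt0 (b_gt0 b64).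
have L1 : (1 <= L ^ 2 * L)%N by rewrite muln_gt0 expn_gt0.
rewrite -mulnA mulnC; move: L3 L1 w1; move: (L ^ 2 * L)%N (64 ^ k * _)%N (b ^ (4 * E + 7))%N.
move=> x y z xy x1 z1; have xz : (x * z <= y * z)%N by rewrite leq_mul2r xy orbT.
have z2 : (1 <= x * z)%N by rewrite muln_gt0 x1.
have b2 : (4 <= b ^ 2)%N by rewrite -mulnn; move: b64; nia.
have : (y * z * 4 <= y * z * b ^ 2)%N by rewrite leq_mul2l b2 orbT.
by move: (y * z * b ^ 2)%N (y * z)%N (x * z)%N xz z2; lia.
Qed.

Lemma long_run_prob E : (220 <= E)%N ->
  (gauss_prob s (hull (s / B ^+ (2 * E)) (box_event s mu Y (long_run E))) <= (B ^- (5 * E))%:E)%E.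
Proof.
move=> E220; set eta := s / B ^+ E; set rho := s / B ^+ (2 * E).
have Bp m : 0 < B ^+ m := Bexp_gt0 R b64 m.
have etaE : eta * B ^+ E = s by rewrite divfK ?gt_eqF.
have rhoE : rho * B ^+ (2 * E) = s by rewrite divfK ?gt_eqF.
have eta0 : 0 < eta by rewrite divr_gt0.
have rho0 : 0 < rho by rewrite divr_gt0.
have rho_eta : rho <= eta := rho_eta b64 s0 etaE rhoE.
have eta_s : eta <= s := eta_s b64 s0 etaE.
move: eta rho etaE rhoE eta0 rho0 rho_eta eta_s => eta rho etaE rhoE eta0 rho0 rho_eta eta_s.
apply: (prob_bad n0 d0 kn dn nb b64 eb E220 s0 Y0 YB YD mu01 gd hr etaE rhoE).
move=> X [XD /kmeans_worst_gt[c0 [a [c [run ns]]]]].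
set L := block_length n k r in run ns *.
have L0 : 0 < L%:R :> R by rewrite ltr0n.
(* A motion of [rho / L] per step adds up to [rho] over a block. The potential is at most [s ^+ 2]
   times a fixed power of [B], so [rho ^+ 2 = s ^+ 2 * B ^- (4 * E)] dictates the exponent
   [4 * E]. *)
have DM : (2 * D) ^+ 2 *+ (n * d) < (rho / L%:R) ^+ 2 *+ (b ^ (4 * E + 7) * L ^ 2)%N.
  have -> : (rho / L%:R) ^+ 2 *+ (b ^ (4 * E + 7) * L ^ 2)%N = rho ^+ 2 * B ^+ (4 * E + 7).
    rewrite -mulr_natr natrM !natrX expr_div_n; field; exact: lt0r_neq0.
  have -> : rho ^+ 2 * B ^+ (4 * E + 7) = s ^+ 2 * B ^+ 7.
    by rewrite -rhoE exprMn -exprM -[RHS]mulrA -exprD; congr (_ * B ^+ _); rewrite [in RHS]mulnAC.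
  have nd : (n * d)%:R <= B * B :> R.
    by rewrite natrM; apply: ler_pM => //; [exact: nB|exact: (dB R dn nb)].
  apply: (@le_lt_trans _ _ (s ^+ 2 * (4 * B ^+ 6))).
    rewrite -mulr_natr; apply: (@le_trans _ _ ((2 * D) ^+ 2 * (B * B))).
      by rewrite ler_wpM2l// sqr_ge0.
    by rewrite le_eqVlt; apply/orP; left; apply/eqP; ring.
  rewrite ltr_pM2l ?exprn_gt0// [_ ^+ 7]exprS ltr_pM2r//.
  by apply: lt_le_trans (B64 R b64); rewrite ltr_nat.
have e0 : 0 <= rho / L%:R by rewrite divr_ge0// ltW.
have [u [v [z [st huv]]]] := stable_pair_exists run n0 e0 XD DM (long_run_block E) ns.
rewrite -/L -[_ *+ L]mulr_natr divfK ?gt_eqF// in st.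
have D0 : 0 <= D by rewrite mulr_ge0 ?ltW.
have s_D : s <= D by rewrite ler_peMr ?(ltW s0)// (Bexp_ge1 R b64).
have two_eta m : (m <= b * b)%N -> 2 * eta *+ m <= eta * B ^+ 3.
  move=> mb; have -> : eta * B ^+ 3 = B * eta * (B * B) by ring.
  apply: mulrn_le; first by rewrite mulr_ge0// ltW.
    rewrite ler_wpM2r ?(ltW eta0)//; apply: le_trans (B64 R b64); by rewrite ler_nat.
  by rewrite -natrM ler_nat.
have nlb : (n <= b)%N := ltnW nb.
have dlb : (d <= b)%N := leq_trans dn nlb.
apply: (stable_pair_blueprint st huv XD d0 (ltW rho0) _ eta0 _ _ _ _ _ hC1 hC2) => //.
- by apply: le_trans rho_eta (le_trans eta_s s_D).
- by apply: two_eta; exact: leq_mul.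
- by apply: two_eta; exact: leq_mul.
- apply: (@le_trans _ _ (eta * B)).
    by apply: mulrn_le; [exact: ltW|exact: rho_eta|exact: nB].
  by rewrite ler_pM2l// -[X in X <= _]expr1 (Bexp_le R b64).
Qed.

End long_runs.

(** * The expected number of iterations *)

Section expectation_bound.
Variables (R : realType) (n k d b g r C1 C2 : nat) (s : R) (mu : 'I_n -> 'rV[R]_d).
Local Notation B := (b%:R : R).
Local Notation Y := ((n ^ 2).+1%:R : R).
Hypotheses (n0 : (0 < n)%N) (d0 : (0 < d)%N) (kn : (k <= n)%N) (dn : (d <= n)%N).
Hypotheses (nb : (n < b)%N) (b64 : (64 <= b)%N) (eb : expR 1 <= B).
Hypotheses (s0 : 0 < s) (YB : Y + 2 <= B ^+ 2) (YD : 1 + Y * s <= s * B ^+ 2).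
Hypothesis mu01 : forall i j, 0 <= mu i ord0 j <= 1.
Hypothesis gd : (6 <= g * d)%N.
Hypothesis hr : (2 * (10 * C1 + 3 * C2 + 17) <= r)%N.
Hypothesis hC1 : (4 * d * (g.-1 * (9 * d)) <= C1)%N.
Hypothesis hC2 : (2 * (g.-1 * (9 * d)) * (9 * d) <= C2)%N.

(** This fixes [Y]: as [k <= n <= expR n], the tail at [n ^ 2 + 1] outweighs the worst case
    [k ^ n]. *)
Lemma worst_case_tail : ((k ^ n).+2)%:R * expR (2^-1 - Y) <= 3 :> R.
Proof.
have kE : ((k ^ n).+2)%:R <= 3 * expR ((n * n)%:R) :> R.
  rewrite natrM expRM_natl.
  have h : n%:R + 1 <= expR n%:R :> R by rewrite addrC expR_ge1Dx.
  have k1 : (k ^ n)%:R <= expR n%:R ^+ n :> R.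
    rewrite natrX lerXn2r ?nnegrE ?expR_ge0//; apply: le_trans h.
    by rewrite natr1 ler_nat ltnW.
  have e1 : 1 <= expR n%:R ^+ n :> R.
    by rewrite exprn_ege1//; apply: le_trans h; rewrite lerDr.
  by rewrite -addn2 natrD; lra.
have -> : 3 = 3 * expR (n * n)%:R * expR (- (n * n)%:R) :> R by rewrite -mulrA -expRD subrr expR0 mulr1.
apply: ler_pM; rewrite ?expR_ge0//.
rewrite ler_expR mulnn -(natr1 (n ^ 2)); lra.
Qed.

Lemma expected_iterations_le :
  (gauss_outer_expect s (fun g0 => kmeans_worst_iterations k (perturbed mu g0))
    <= (64 ^ k * b ^ (6 * r + 893))%:R%:E)%E.
Proof.
have Y0 : 0 <= Y by [].
have bgt0 : (0 < b)%N := b_gt0 b64.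
have Bp m : 0 < B ^+ m := Bexp_gt0 R b64 m.
pose A i := hull (s / B ^+ (2 * (220 + i))) (box_event s mu Y (long_run k b r s (220 + i))).
(* Each layer multiplies the level by [b ^ 4], so [n] layers exceed [k ^ n + 2]. A product of the
   next level with the probability of a layer is free of [E], since [5 * E] beats [4 * E]. *)
have layers := @gauss_outer_layers R (n * d) s (fun x => kmeans_worst_iterations k (perturbed mu x))
  (fun i => long_run_bound k b r (220 + i)) A (gauss_out s Y) (k ^ n).+2 n.
apply: (le_trans (layers _ _ _ _ _)).
- by move=> i; apply: measurable_hull; rewrite divr_gt0.
- exact: measurable_gauss_out.
- by move=> x; exact: kmeans_worst_le.
- apply: (@leq_trans (b ^ n.+1)).
    have h : (k ^ n <= b ^ n)%N by apply: leq_pow_base; exact: leq_trans kn (ltnW nb).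
    have h1 : (1 <= b ^ n)%N by rewrite expn_gt0 bgt0.
    by rewrite expnS; move: h h1 b64; move: (k ^ n)%N (b ^ n)%N => x y; clear; nia.
  rewrite -[X in (X <= _)%N]mul1n; apply: leq_mul; first by rewrite expn_gt0.
  by rewrite leq_pexp2l//; clear; lia.
- move=> i x nO Ux; apply: sub_hull.
  have xY p : `|tnth x p| <= Y * s by rewrite leNgt; apply/negP => h; apply: nO; exists p.
  by split=> //; split=> // i' j; exact: (perturbed_bound mu01 YD).
have sumA : (\sum_(i < n) (long_run_bound k b r (220 + i.+1))%:R%:E * gauss_prob s (A i)
    <= (64 ^ k * b ^ (6 * r + 17))%:R%:E)%E.
  apply: (@le_trans _ _ (\sum_(i < n) (64 ^ k * b ^ (6 * r + 16))%:R%:E)%E).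
    apply: lee_sum => i _.
    have P : (gauss_prob s (A i) <= (B ^- (5 * (220 + i)))%:E)%E.
      by apply: (long_run_prob n0 d0 kn dn nb b64 eb s0 Y0 YB YD mu01 gd hr hC1 hC2); rewrite leq_addr.
    apply: (le_trans (lee_wpmul2l _ P)); first by rewrite lee_fin.
    rewrite -EFinM lee_fin ler_pdivrMr// -natrX -natrM ler_nat -mulnA leq_mul2l; apply/orP; right.
    by rewrite -expnD leq_pexp2l//; clear; lia.
  rewrite sumEFin lee_fin sumr_const card_ord -mulrnA ler_nat -mulnA leq_mul2l; apply/orP; right.
  have -> : (6 * r + 17 = (6 * r + 16).+1)%N by rewrite addnS.
  by rewrite expnSr leq_mul2l ltnW ?orbT.
have tail : (((k ^ n).+2)%:R%:E * gauss_prob s (@gauss_out R s (n * d) Y) <= (6 * (n * d))%:R%:E)%E.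
  apply: (le_trans (lee_wpmul2l _ (gauss_out_le s0 _ _))); first by rewrite lee_fin.
  rewrite -EFinM lee_fin mulrnAr -(mulr_natr (_ * _)).
  have -> : (6 * (n * d))%:R = 3 * (2 * (n * d))%:R :> R by rewrite -natrM [in RHS]mulnA.
  by rewrite ler_wpM2r//; exact: worst_case_tail.
apply: (le_trans (leeD (leeD (lexx _) sumA) tail)).
rewrite -!EFinD lee_fin -!natrD ler_nat addn0 /long_run_bound.
have -> : (6 * r + 12 + 4 * 220 = 6 * r + 892)%N by clear; lia.
have nd : (6 * (n * d) <= b ^ 3)%N.
  have : (n * d <= b * b)%N by apply: leq_mul; [|apply: leq_trans dn _]; exact: ltnW.
  by rewrite !expnS expn0 muln1; move: b64; move: (n * d)%N; clear; nia.
have b3 : (b ^ 3 <= 64 ^ k * b ^ (6 * r + 892))%N.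
  rewrite -[X in (X <= _)%N]mul1n; apply: leq_mul; first by rewrite expn_gt0.
  by rewrite leq_pexp2l//; clear; lia.
have b17 : (64 ^ k * b ^ (6 * r + 17) <= 64 ^ k * b ^ (6 * r + 892))%N.
  by rewrite leq_mul2l leq_pexp2l ?orbT//; clear; lia.
have -> : (64 ^ k * b ^ (6 * r + 893) = 64 ^ k * b ^ (6 * r + 892) * b)%N.
  by rewrite -mulnA -expnSr -addnS.
move: nd b3 b17 b64.
move: (64 ^ k * b ^ (6 * r + 892))%N (64 ^ k * b ^ (6 * r + 17))%N (b ^ 3)%N => x y z.
clear; nia.
Qed.

End expectation_bound.

(** Coincidences must supply six scalar conditions and each supplies [d]. For [d >= 6] one suffices,
    and [g.-1 = 0] removes all exceptions; for smaller [d], [g = 6] does. Hence [C1] and [C2], and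
    with them [r] and the degree of the polynomial, do not depend on [d]. *)
Lemma coincidence_constants : exists C1 C2 : nat, forall d, (0 < d)%N ->
  exists g, [/\ (6 <= g * d)%N, (4 * d * (g.-1 * (9 * d)) <= C1)%N &
    (2 * (g.-1 * (9 * d)) * (9 * d) <= C2)%N].
Proof.
exists (4 * 5 * (5 * (9 * 5)))%N, (2 * (5 * (9 * 5)) * (9 * 5))%N => d d0.
have [d6|d6] := leqP 6 d; first by exists 1%N; rewrite !muln0 mul1n.
exists 6; split; first by rewrite leq_pmulr.
- by rewrite !leq_mul.
- by rewrite !leq_mul.
Qed.

Theorem theorem2 (R : realType) :
  exists p : {poly {poly R}},
  forall (n k d : nat) (sigma : R) (mu : 'I_n -> 'rV[R]_d),
    (0 < n)%N -> (0 < k)%N -> (0 < d)%N -> (k <= n)%N -> (d <= n)%N ->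
    0 < sigma ->
    (forall (i : 'I_n) (j : 'I_d), 0 <= mu i ord0 j <= 1) ->
    (gauss_outer_expect sigma
       (fun g : (n * d).-tuple R => kmeans_worst_iterations k (perturbed mu g))
     <= ((k%:R ^+ (k * d)) * (p.[(sigma^-1)%:P]).[n%:R])%:E)%E.
Proof.
have [C1 [C2 C12]] := coincidence_constants.
pose r := (2 * (10 * C1 + 3 * C2 + 17))%N.
pose e := (6 * r + 893)%N.
(* The constant [64 ^ 64] covers [64 ^ k] for [k <= 64]; beyond that,
   [64 ^ k <= k ^ k <= k ^ (k * d)]. The inner variable [('X)%:P] stands for [n], the outer one for
   the inverse of [sigma]. *)
exists (((64%:R ^+ 64)%:P)%:P * (('X)%:P + 'X + (65%:R%:P)%:P) ^+ e).
move=> n k d s mu n0 k0 d0 kn dn s0 mu01.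
have [g [gd hC1 hC2]] := C12 d d0.
rewrite hornerM horner_exp !hornerD hornerX !hornerC hornerM horner_exp !hornerD hornerX !hornerC.
have si0 : 0 < s^-1 by rewrite invr_gt0.
pose t := Num.truncn s^-1.
have /andP[t1 t2] : t%:R <= s^-1 < t.+1%:R by apply: truncn_itv; exact: ltW.
pose b := (n + t + 65)%N.
have bE : (b%:R : R) = n%:R + t%:R + 65 by rewrite /b !natrD.
have eb : expR 1 <= (b%:R : R).
  have h1 : 2^-1 <= expR (- 2^-1) :> R by have := expR_ge1Dx (- 2^-1 : R); lra.
  have h2 : expR 1 * (expR (- 2^-1) * expR (- 2^-1)) = 1 :> R.
    rewrite -!expRD; have -> : 1 + (- 2^-1 + - 2^-1) = 0 :> R by lra.
    exact: expR0.
  have e0 : 0 <= expR 1 :> R by exact: expR_ge0.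
  have h3 : 2^-1 * 2^-1 <= expR (- 2^-1) * expR (- 2^-1) :> R by apply: ler_pM.
  have h4 : expR 1 * (2^-1 * 2^-1) <= 1 :> R by rewrite -[X in _ <= X]h2 ler_wpM2l.
  by have := ler0n R n; have := ler0n R t; lra.
have t0 : 0 <= t%:R :> R by [].
have nr0 : 0 <= n%:R :> R by [].
have tS : s^-1 < t%:R + 1 by rewrite natr1.
have b2 : (n ^ 2).+1%:R + s^-1 + 2 <= (b%:R : R) ^+ 2.
  by rewrite -(natr1 (n ^ 2)) natrX bE; move: (t%:R : R) (n%:R : R) (s^-1) t0 nr0 tS => x y z; nra.
have YB : (n ^ 2).+1%:R + 2 <= (b%:R : R) ^+ 2 by apply: le_trans b2; lra.
have YD : 1 + (n ^ 2).+1%:R * s <= s * (b%:R : R) ^+ 2.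
  have -> : 1 + (n ^ 2).+1%:R * s = s * ((n ^ 2).+1%:R + s^-1) by field; exact: lt0r_neq0.
  by rewrite ler_pM2l//; apply: le_trans b2; lra.
have nb : (n < b)%N by rewrite /b -addnA -[X in (X < _)%N]addn0 ltn_add2l addn_gt0 orbT.
have b64 : (64 <= b)%N by rewrite /b (leq_trans _ (leq_addl _ _)).
apply: le_trans (expected_iterations_le n0 d0 kn dn nb b64 eb s0 YB YD mu01 gd (leqnn r) hC1 hC2) _.
rewrite lee_fin natrM mulrA; apply: ler_pM => //.
  rewrite -!natrX -natrM ler_nat.
  have [k64|k64] := leqP k 64.
    by rewrite mulnC -[X in (X <= _)%N]muln1 leq_mul ?leq_pexp2l// expn_gt0 k0.
  rewrite -[X in (X <= _)%N]muln1 leq_mul ?expn_gt0//.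
  apply: (@leq_trans (k ^ k)); first by apply: leq_pow_base; exact: ltnW.
  by rewrite leq_pexp2l// leq_pmulr.
rewrite natrX lerXn2r ?nnegrE//.
  by rewrite addr_ge0// addr_ge0// ltW.
by rewrite bE; lra.
Qed.
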